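(* Let $X=\{f=0\}\subset\mathbb{A}^n$ be a hypersurface, with $f\in\mathbb{C}[x_1,\dots,x_n]$ a generator of the ideal of $X$. If $X$ is smooth or cuspidal, then $$\frac{D_{\mathbb{A}^n}}{D_{\mathbb{A}^n}\cdot f+f\cdot D_{\mathbb{A}^n}}=0,$$ i.e. $D_{\mathbb{A}^n}=D_{\mathbb{A}^n}f+fD_{\mathbb{A}^n}$.
   Context: A variety is a reduced separated scheme of finite type over $\mathbb{C}$. $D_{\mathbb{A}^n}$ is the Weyl algebra of algebraic differential operators on affine space $\mathbb{A}^n$ over $\mathbb{C}$; the quotient is a quotient of vector spaces. A Cohen–Macaulay variety $X$ is called cuspidal if there is a universal homeomorphism $Y\to X$ from a smooth variety $Y$. *)

(* Defs.v *)
From HB Require Import structures.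
From mathcomp Require Import all_boot all_order all_algebra.
From mathcomp Require Import complex mpoly.
From mathcomp Require Import boolp classical_sets reals topology.

Set Implicit Arguments.
Unset Strict Implicit.
Unset Printing Implicit Defensive.

Import GRing.Theory.
Local Open Scope classical_set_scope.
Local Open Scope ring_scope.

(* Rings of sections and stalks may a priori be zero, hence [comPzRingType],
   for which there is no library predicate of invertible elements. *)
Definition invertible (A : comPzRingType) (a : A) : Prop :=
  exists b, a * b = 1.

Definition prime_ideal (A : comPzRingType) (P : set A) : Prop :=
  [/\ P 0, (forall a b, P a -> P b -> P (a + b)),
      (forall a b, P b -> P (a * b)), ~ P 1
    & (forall a b, P (a * b) -> P a \/ P b)].

Definition local_ring (A : comPzRingType) : Prop :=
  ~ invertible (0 : A) /\
  (forall a b : A, invertible (a + b) -> invertible a \/ invertible b).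

Definition ideal_gen (A : comPzRingType) (d : nat) (a : nat -> A) : set A :=
  [set b | exists c : nat -> A, b = \sum_(i < d) c i * a i].

(* In a local ring the maximal ideal is the set of non-invertible elements;
   the condition that A / (a 0, ..., a (d - 1)) be nonzero is then automatic. *)
Definition regular_sequence (A : comPzRingType) (d : nat) (a : nat -> A) :
    Prop :=
  forall i, (i < d)%N ->
    ~ invertible (a i) /\
    forall b, ideal_gen i a (a i * b) -> ideal_gen i a b.

Definition has_regular_sequence (A : comPzRingType) (d : nat) : Prop :=
  exists a : nat -> A, regular_sequence d a.

Definition has_prime_chain (A : comPzRingType) (d : nat) : Prop :=
  exists P : nat -> set A,
    (forall i, (i <= d)%N -> prime_ideal (P i)) /\
    (forall i, (i < d)%N -> P i `<` P i.+1).

Definition depth_is (A : comPzRingType) (d : nat) : Prop :=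
  has_regular_sequence A d /\
  forall e, has_regular_sequence A e -> (e <= d)%N.

Definition krull_dim_is (A : comPzRingType) (d : nat) : Prop :=
  has_prime_chain A d /\ forall e, has_prime_chain A e -> (e <= d)%N.

Definition cohen_macaulay_ring (A : comPzRingType) : Prop :=
  local_ring A /\ exists2 d, depth_is A d & krull_dim_is A d.

Definition opensub (T : topologicalType) (V U : set T) : Prop :=
  [/\ open V, open U & V `<=` U].

(* Sections are indexed by all subsets so that [f @^-1` (g @^-1` V)] and
   [(g \o f) @^-1` V] give convertible types; only the values on open sets
   carry any structure. *)
Record ringedSpace := RingedSpace {
  points :> topologicalType;
  sect : set points -> comPzRingType;
  restr : forall V U : set points, opensub V U -> {rmorphism sect U -> sect V};
  restr_id : forall U (h : opensub U U) (s : sect U), restr h s = s;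
  restr_comp : forall W V U (hWV : opensub W V) (hVU : opensub V U)
      (hWU : opensub W U) (s : sect U),
    restr hWV (restr hVU s) = restr hWU s;
  sheaf_locality : forall (I : Type) (V : I -> set points) (U : set points)
      (h : forall i, opensub (V i) U),
    U `<=` \bigcup_i V i ->
    forall s t : sect U, (forall i, restr (h i) s = restr (h i) t) -> s = t;
  sheaf_gluing : forall (I : Type) (V : I -> set points) (U : set points)
      (h : forall i, opensub (V i) U),
    U `<=` \bigcup_i V i ->
    forall s : (forall i, sect (V i)),
      (forall i j (hi : opensub (V i `&` V j) (V i))
          (hj : opensub (V i `&` V j) (V j)),
        restr hi (s i) = restr hj (s j)) ->
      exists t : sect U, forall i, restr (h i) t = s i }.

(* The germ of [s] at [x] is invertible in the stalk at [x]. *)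
Definition unit_at (X : ringedSpace) (x : X) (U : set X) (s : sect U) : Prop :=
  exists (V : set X) (h : opensub V U), V x /\ invertible (restr h s).

(* The stalk of X at x, characterised as a filtered colimit. *)
Record is_stalk (X : ringedSpace) (x : X) (L : comPzRingType)
    (germ : forall U : set X, open U -> U x -> {rmorphism sect U -> L}) :
    Prop := IsStalk {
  germ_restr : forall V U (h : opensub V U) (oV : open V) (oU : open U)
      (Vx : V x) (Ux : U x) (s : sect U),
    germ V oV Vx (restr h s) = germ U oU Ux s;
  germ_surj : forall a : L, exists U (oU : open U) (Ux : U x) (s : sect U),
    germ U oU Ux s = a;
  germ_eq0 : forall U (oU : open U) (Ux : U x) (s : sect U),
    germ U oU Ux s = 0 ->
    exists (V : set X) (h : opensub V U), V x /\ restr h s = 0 }.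

(* Locality of the stalks, expressed on germs. *)
Record locallyRingedSpace := LocallyRingedSpace {
  ringed :> ringedSpace;
  stalk_nonzero : forall x : ringed, ~ unit_at x (0 : sect (setT : set ringed));
  stalk_local : forall (x : ringed) (U : set ringed) (s t : sect U),
    unit_at x (s + t) -> unit_at x s \/ unit_at x t }.

Definition basic_open (X : ringedSpace) (U : set X) (s : sect U) : set X :=
  [set x | unit_at x s].

Lemma basic_open_opensub (X : ringedSpace) (U : set X) (s : sect U) :
  open U -> opensub (basic_open s) U.
Proof.
move=> oU; split=> //; last by move=> x [V [[_ _ VU] [Vx _]]]; exact: VU.
rewrite openE => x [V [h [Vx us]]]; have [oV _ _] := h.
rewrite /interior nbhsE; exists V; first by split.
by move=> y Vy; exists V, h.
Qed.

(* The canonical morphism from U to Spec (sect U), which sends x to the prime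
   ideal of the sections vanishing at x, is an isomorphism: it is bijective,
   the preimages of the principal open sets D(s) form a basis of the topology
   of U, and the sections over each of them are the localisation of sect U
   at s. *)
Record affine_open (X : locallyRingedSpace) (U : set X) : Prop := AffineOpen {
  affine_is_open : open U;
  affine_inj : forall x y, U x -> U y ->
    (forall s : sect U, unit_at x s <-> unit_at y s) -> x = y;
  affine_surj : forall P : set (sect U), prime_ideal P ->
    exists2 x, U x & forall s, P s <-> ~ unit_at x s;
  affine_basis : forall (W : set X) x, opensub W U -> W x ->
    exists s : sect U, basic_open s x /\ basic_open s `<=` W;
  affine_frac : forall (s : sect U) (h : opensub (basic_open s) U)
      (t : sect (basic_open s)),
    exists (a : sect U) (m : nat), restr h s ^+ m * t = restr h a;
  affine_frac_eq0 : forall (s : sect U) (h : opensub (basic_open s) U)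
      (a : sect U),
    restr h a = 0 -> exists m : nat, s ^+ m * a = 0 }.

(* A scheme over k; by the adjunction between Spec and global sections, the
   structure morphism to Spec k amounts to a ring morphism from k to the
   global sections. *)
Record scheme (k : fieldType) := Scheme {
  locally_ringed :> locallyRingedSpace;
  affine_cover : forall x : locally_ringed, exists2 U, affine_open U & U x;
  scal : {rmorphism k -> sect (setT : set locally_ringed)} }.

Record morphism (k : fieldType) (X Y : scheme k) := Morphism {
  mfun :> X -> Y;
  mfun_continuous : continuous mfun;
  pull : forall V : set Y, open V ->
    {rmorphism sect V -> sect (mfun @^-1` V)};
  pull_restr : forall (V U : set Y) (h : opensub V U) (oV : open V)
      (oU : open U) (h' : opensub (mfun @^-1` V) (mfun @^-1` U)) (s : sect U),
    pull oV (restr h s) = restr h' (pull oU s);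
  pull_local : forall (x : X) (V : set Y) (oV : open V) (s : sect V),
    unit_at x (pull oV s) -> unit_at (mfun x) s;
  pull_scal : forall (oT : open (setT : set Y)) (c : k),
    pull oT (scal Y c) = scal X c :> sect (setT : set X) }.

Lemma open_preimage (k : fieldType) (X Y : scheme k) (f : morphism X Y)
    (V : set Y) :
  open V -> open (f @^-1` V).
Proof. by move=> oV; apply: open_comp => // x _; exact: mfun_continuous. Qed.

Lemma opensub_preimage (k : fieldType) (X Y : scheme k) (f : morphism X Y)
    (V U : set Y) :
  opensub V U -> opensub (f @^-1` V) (f @^-1` U).
Proof.
by move=> [oV oU VU]; split; [exact: open_preimage..|move=> x; exact: VU].
Qed.

Definition id_morphism (k : fieldType) (X : scheme k) : morphism X X.
Proof.
refine (@Morphism k X X idfun (fun x => @cvg_id _ _)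
  (fun V _ => (idfun : {rmorphism sect V -> sect V})) _ _ _) => //=.
by move=> V U h _ _ h' s; rewrite (Prop_irrelevance h h').
Defined.

Definition comp_morphism (k : fieldType) (X Y Z : scheme k)
    (g : morphism Y Z) (f : morphism X Y) : morphism X Z.
Proof.
refine (@Morphism k X Z (g \o f)
  (fun x => continuous_comp (@mfun_continuous _ _ _ f x)
              (@mfun_continuous _ _ _ g (f x)))
  (fun V oV => (pull f (open_preimage g oV) \o pull g oV
     : {rmorphism sect V -> sect (f @^-1` (g @^-1` V))})) _ _ _) => /=.
- move=> V U h oV oU h' s.
  rewrite (pull_restr h oV oU (opensub_preimage g h)).
  exact: pull_restr.
- by move=> x V oV s /pull_local/pull_local.
- by move=> oT c; rewrite pull_scal; exact: pull_scal.
Defined.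

Definition is_product (k : fieldType) (X Y P : scheme k)
    (p : morphism P X) (q : morphism P Y) : Prop :=
  forall (T : scheme k) (a : morphism T X) (b : morphism T Y),
    exists! c : morphism T P, comp_morphism p c = a /\ comp_morphism q c = b.

Definition is_fibre_product (k : fieldType) (X Y S P : scheme k)
    (f : morphism X S) (g : morphism Y S)
    (p : morphism P X) (q : morphism P Y) : Prop :=
  comp_morphism f p = comp_morphism g q /\
  forall (T : scheme k) (a : morphism T X) (b : morphism T Y),
    comp_morphism f a = comp_morphism g b ->
    exists! c : morphism T P, comp_morphism p c = a /\ comp_morphism q c = b.

Definition homeomorphism (S T : topologicalType) (f : S -> T) : Prop :=
  exists g : T -> S,
    [/\ cancel f g, cancel g f, continuous f & continuous g].

(* Any scheme over X acquires a k-structure by composition, so nothing is lost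
   in considering base changes of k-schemes only. *)
Definition universal_homeomorphism (k : fieldType) (Y X : scheme k)
    (f : morphism Y X) : Prop :=
  forall (X' Y' : scheme k) (g : morphism X' X)
      (f' : morphism Y' X') (g' : morphism Y' Y),
    is_fibre_product g f f' g' -> homeomorphism f'.

(* A homeomorphism onto a closed subset, surjective on stalks. *)
Definition closed_immersion (k : fieldType) (X Y : scheme k)
    (f : morphism X Y) : Prop :=
  [/\ injective f, (forall Z : set X, closed Z -> closed (f @` Z))
    & forall (x : X) (U : set X) (s : sect U), open U -> U x ->
        exists (V : set Y) (oV : open V) (t : sect V) (W : set X)
          (h : opensub W U) (h' : opensub W (f @^-1` V)),
          W x /\ restr h s = restr h' (pull f oV t)].

Definition separated (k : fieldType) (X : scheme k) : Prop :=
  forall (P : scheme k) (p q : morphism P X), is_product p q ->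
  forall delta : morphism X P,
    comp_morphism p delta = id_morphism X ->
    comp_morphism q delta = id_morphism X ->
    closed_immersion delta.

Definition reduced (k : fieldType) (X : scheme k) : Prop :=
  forall (U : set X) (s : sect U) (m : nat), open U -> s ^+ m = 0 -> s = 0.

Definition presentation (k : fieldType) (X : scheme k) (U : set X) (m : nat)
    (phi : {rmorphism {mpoly k[m]} -> sect U}) : Prop :=
  (forall (h : opensub U setT) (c : k), phi c%:MP = restr h (scal X c)) /\
  (forall s : sect U, exists p, phi p = s).

Definition finite_type (k : fieldType) (X : scheme k) : Prop :=
  compact (setT : set X) /\
  forall x : X, exists U : set X, [/\ affine_open U, U x &
    exists (m : nat) (phi : {rmorphism {mpoly k[m]} -> sect U}),
      presentation phi].

Definition variety (k : fieldType) (X : scheme k) : Prop :=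
  [/\ reduced X, separated X & finite_type X].

(* Locally on X the algebra of sections is standard smooth:
   k[x_1, ..., x_(c + d)] / (g_1, ..., g_c), where the Jacobian determinant of
   g_1, ..., g_c with respect to x_1, ..., x_c is invertible. *)
Definition smooth (k : fieldType) (X : scheme k) : Prop :=
  forall x : X, exists U : set X, [/\ affine_open U, U x &
    exists (c d : nat) (phi : {rmorphism {mpoly k[(c + d)%N]} -> sect U})
      (g : 'I_c -> {mpoly k[(c + d)%N]}),
      [/\ presentation phi,
          (forall p, phi p = 0 <->
             exists a : 'I_c -> {mpoly k[(c + d)%N]},
               p = \sum_j a j * g j)
        & invertible
            (phi (\det (\matrix_(i < c, j < c) mderiv (lshift d i) (g j))))]].

Definition cohen_macaulay (k : fieldType) (X : scheme k) : Prop :=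
  forall (x : X) (L : comPzRingType)
      (germ : forall U : set X, open U -> U x -> {rmorphism sect U -> L}),
    is_stalk germ -> cohen_macaulay_ring L.

Definition cuspidal (k : fieldType) (X : scheme k) : Prop :=
  [/\ variety X, cohen_macaulay X &
    exists (Y : scheme k) (f : morphism Y X),
      [/\ variety Y, smooth Y & universal_homeomorphism f]].

(* X is the variety Spec (k[x_1, ..., x_n] / (f)) with f nonconstant
   ([msize f] is one plus the degree of f); as X is reduced, f generates the
   radical ideal of the zero locus of f. *)
Definition is_hypersurface (k : fieldType) (n : nat) (f : {mpoly k[n]})
    (X : scheme k) : Prop :=
  [/\ (1 < msize f)%N, variety X, affine_open (setT : set X) &
    exists phi : {rmorphism {mpoly k[n]} -> sect (setT : set X)},
      presentation phi /\ forall p, phi p = 0 <-> exists q, p = q * f].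

(* The subalgebra of the endomorphisms of k[x_1, ..., x_n] generated by the
   multiplication operators and the partial derivatives. *)
Inductive weyl_algebra (k : fieldType) (n : nat) :
    set ({mpoly k[n]} -> {mpoly k[n]}) :=
| weyl_mul (p : {mpoly k[n]}) : weyl_algebra (fun g => p * g)
| weyl_deriv (i : 'I_n) : weyl_algebra (fun g => mderiv i g)
| weyl_add P Q : weyl_algebra P -> weyl_algebra Q ->
    weyl_algebra (fun g => P g + Q g)
| weyl_comp P Q : weyl_algebra P -> weyl_algebra Q ->
    weyl_algebra (fun g => P (Q g)).

Arguments weyl_algebra : clear implicits.

(* Main.v *)
(* Let [x, y] act on the Weyl algebra [D] by left and right multiplication with the
   coordinates. The commutator [x_i - y_i] lowers the order of an operator in [d_i],
   and [D = D f + f D] follows if for every [k] there is an [m] such that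
   [\prod_i (x_i - y_i) ^+ m] lies in the ideal generated by [f(x)], [f(y)] and the
   [(x_i - y_i) ^+ (k + m)], i.e. if the local cohomology of [X * X] along the diagonal
   vanishes in degree [n].

   This is local on [X]. For a bijective finite [Y -> X] with [Y] smooth of dimension
   [d < n], it may be tested on [Y * Y]: at a prime [q] of the base the pulled back
   algebra [B] has a nonzero linear form [B / q B -> A / q]. As [Y -> X] is injective,
   the preimage of the diagonal of [X] is the diagonal of [Y], which is defined locally
   by [d] equations, so that its Cech cohomology vanishes in degree [n > d].

   Finiteness of [Y -> X] comes from universal closedness, applied to the base change
   to the affine line and to the closed subset [s * T = 1] for each function [s]
   on [Y]. *)
Require Import Defs.
From HB Require Import structures.
From mathcomp Require Import all_boot all_order all_algebra.
From mathcomp Require Import complex mpoly.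
From mathcomp Require Import boolp classical_sets reals topology.
From mathcomp Require Import functions cardinality normedtype sequences.
From mathcomp Require Import ring_quotient ring.

Set Implicit Arguments.
Unset Strict Implicit.
Unset Printing Implicit Defensive.

Import Order.TTheory GRing.Theory Num.Theory.
Import numFieldNormedType.Exports.
Local Open Scope classical_set_scope.
Local Open Scope ring_scope.

(** * Prime ideals and the Nullstellensatz *)

(** The smooth case is the cuspidal one with the identity as universal homeomorphism. No cohomology
    group is ever formed. With [T] the product of the functions [t i], the class of [1 / T ^+ k]
    vanishes when some [T ^+ m] lies in the ideal of the [t i ^+ (k + m)], and all vanishing
    statements take this form of ideal membership. Noetherian induction reduces them to prime
    ideals, so that the double complex comparing the [n] equations of the diagonal with [d] others
    lives inside a single residue field. Schemes and polynomial algebra meet through [k]-points: a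
    chart is described by its points, and the Nullstellensatz, proved here from the uncountability
    of the base field, turns statements about points into ideal membership. The inequality [d < n]
    comes from a rank computation with tangent vectors, obtained by differentiating algebraic
    relations until they become separable. Characteristic 0 enters there and in the return to
    operators, where factorials have to be invertible. *)

Definition is_ideal (A : comPzRingType) (I : set A) : Prop :=
  [/\ I 0, (forall a b, I a -> I b -> I (a + b)) & forall a b, I b -> I (a * b)].

Section Ideals.
Variables (A : comPzRingType) (I : set A).
Hypothesis idI : is_ideal I.

Lemma ideal0 : I 0. Proof. by case: idI. Qed.
Lemma idealD a b : I a -> I b -> I (a + b). Proof. by case: idI => _ + _; exact. Qed.
Lemma ideal_mull a b : I b -> I (a * b). Proof. by case: idI => _ _; exact. Qed.
Lemma ideal_mulr a b : I b -> I (b * a). Proof. by rewrite mulrC; exact: ideal_mull. Qed.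
Lemma idealN a : I a -> I (- a). Proof. by move=> Ia; rewrite -mulN1r; exact: ideal_mull. Qed.
Lemma idealB a b : I a -> I b -> I (a - b).
Proof. by move=> Ia Ib; apply: idealD => //; exact: idealN. Qed.
Lemma ideal_sum (J : Type) (r : seq J) (P : pred J) (F : J -> A) :
  (forall i, P i -> I (F i)) -> I (\sum_(i <- r | P i) F i).
Proof. by move=> IF; elim/big_ind: _ => //; [exact: ideal0 | exact: idealD]. Qed.
End Ideals.

Definition ideal_add (A : comPzRingType) (I J : set A) : set A :=
  [set c | exists a b, [/\ I a, J b & c = a + b]].

Definition principal (A : comPzRingType) (a : A) : set A :=
  [set c | exists b, c = b * a].

Definition span_of (A : comPzRingType) (J : finType) (t : J -> A) : set A :=
  [set c | exists s : J -> A, c = \sum_i s i * t i].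

Lemma is_ideal_add (A : comPzRingType) (I J : set A) :
  is_ideal I -> is_ideal J -> is_ideal (ideal_add I J).
Proof.
move=> idI idJ; split.
- by exists 0, 0; rewrite addr0; split=> //; exact: ideal0.
- move=> _ _ [a [b [Ia Jb ->]]] [a' [b' [Ia' Jb' ->]]].
  by exists (a + a'), (b + b'); rewrite addrACA; split=> //; exact: idealD.
- move=> c _ [a [b [Ia Jb ->]]]; exists (c * a), (c * b).
  by rewrite mulrDr; split=> //; exact: ideal_mull.
Qed.

Lemma is_ideal_principal (A : comPzRingType) (a : A) : is_ideal (principal a).
Proof.
split; first by exists 0; rewrite mul0r.
- by move=> _ _ [b ->] [c ->]; exists (b + c); rewrite mulrDl.
- by move=> c _ [b ->]; exists (c * b); rewrite mulrA.
Qed.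

Lemma is_ideal_span (A : comPzRingType) (J : finType) (t : J -> A) :
  is_ideal (span_of t).
Proof.
split; first by exists (fun=> 0); rewrite big1 // => i _; rewrite mul0r.
- move=> _ _ [s ->] [s' ->]; exists (fun i => s i + s' i).
  by rewrite -big_split; apply: eq_bigr => i _ /=; rewrite mulrDl.
- move=> c _ [s ->]; exists (fun i => c * s i).
  by rewrite mulr_sumr; apply: eq_bigr => i _; rewrite mulrA.
Qed.

Lemma span_mem (A : comPzRingType) (J : finType) (t : J -> A) i :
  span_of t (t i).
Proof.
exists (fun j => (j == i)%:R); rewrite (bigD1 i) //= eqxx mul1r big1 ?addr0 //.
by move=> j /negPf ->; rewrite mul0r.
Qed.

Lemma ideal_addl (A : comPzRingType) (I J : set A) : is_ideal J ->
  I `<=` ideal_add I J.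
Proof. by move=> idJ a Ia; exists a, 0; rewrite addr0; split=> //; exact: ideal0. Qed.

Lemma ideal_addr (A : comPzRingType) (I J : set A) : is_ideal I ->
  J `<=` ideal_add I J.
Proof. by move=> idI a Ia; exists 0, a; rewrite add0r; split=> //; exact: ideal0. Qed.

Lemma prime_is_ideal (A : comPzRingType) (P : set A) : prime_ideal P -> is_ideal P.
Proof. by case. Qed.

Lemma prime_expr (A : comPzRingType) (P : set A) a m :
  prime_ideal P -> P (a ^+ m) -> P a.
Proof.
case=> _ _ _ P1 PM; elim: m => [|m IH]; first by rewrite expr0.
by rewrite exprS => /PM[].
Qed.

(* An ideal maximal among those containing no power of [h] is prime; the last
   clause records its maximality. *)
Lemma prime_avoiding (A : comPzRingType) (I : set A) (h : A) :
  is_ideal I -> (forall m, ~ I (h ^+ m)) ->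
  exists P, [/\ prime_ideal P, I `<=` P, ~ P h &
    forall g, ~ P g -> exists m p b, P p /\ h ^+ m = p + b * g].
Proof.
move=> idI Ih.
(* The union with [I] takes care of the empty chain in Zorn's lemma, whose union is empty. *)
pose Q (S : set A) := is_ideal (S `|` I) /\ forall m, ~ (S `|` I) (h ^+ m).
have [|S [[idS Sh] Smax]] := @Zorn_bigcup A Q.
  move=> F FQ Ftot.
  have FE a : (\bigcup_(X in F) X `|` I) a -> (exists2 X, F X & (X `|` I) a) \/ I a.
    by move=> [[X FX Xa]|]; [left; exists X => //; left | right].
  have FI X : F X -> X `|` I `<=` \bigcup_(X in F) X `|` I.
    by move=> FX a [Xa|]; [left; exists X | right].
  split; last first.
    by move=> m /FE [[X FX]|//]; [have [_] := FQ _ FX; exact | exact: Ih].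
  split; first by right; exact: ideal0.
  - move=> a b /FE [[X FX Xa]|Ia] /FE [[Y FY Yb]|Ib].
    + have [XY|YX] := Ftot _ _ FX FY.
        apply: (FI Y FY); apply: (idealD (proj1 (FQ _ FY))) => //.
        by case: Xa => [/XY|]; [left | right].
      apply: (FI X FX); apply: (idealD (proj1 (FQ _ FX))) => //.
      by case: Yb => [/YX|]; [left | right].
    + by apply: (FI X FX); apply: (idealD (proj1 (FQ _ FX))) => //; right.
    + by apply: (FI Y FY); apply: (idealD (proj1 (FQ _ FY))) => //; right.
    + by right; exact: idealD.
  - move=> a b /FE [[X FX Xb]|Ib]; last by right; exact: ideal_mull.
    by apply: (FI X FX); exact: (ideal_mull (proj1 (FQ _ FX))).
pose P := S `|` I.
have Pmax g : ~ P g -> exists m p b, P p /\ h ^+ m = p + b * g.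
  move=> Pg; apply: contrapT => nex.
  pose J := ideal_add P (principal g).
  have idJ : is_ideal J by apply: is_ideal_add => //; exact: is_ideal_principal.
  have PJ : P `<=` J by apply: ideal_addl; exact: is_ideal_principal.
  have JE : J `|` I = J.
    by apply/seteqP; split=> x; [case=> // Ix; apply: PJ; right | left].
  apply: (Smax J); last first.
    split; rewrite JE // => m [p [_ [Pp [b ->] hE]]].
    by apply: nex; exists m, p, b.
  split; first by move=> x Sx; apply: PJ; left.
  move=> JS; apply: Pg; left; apply: JS; exists 0, g; rewrite add0r.
  by split=> //; [exact: ideal0 | exists 1; rewrite mul1r].
exists P; split=> //; first last.
- by move=> Ph; apply: (Sh 1%N); rewrite expr1.
- by move=> x Ix; right.
split; [exact: ideal0|exact: idealD|exact: ideal_mull| |].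
  by move=> P1; apply: (Sh 0%N); rewrite expr0.
move=> a b Pab; apply: contrapT => /not_orP[/Pmax[m [p [c [Pp hm]]]] /Pmax[m' [p' [c' [Pp' hm']]]]].
apply: (Sh (m + m')%N); rewrite exprD hm hm'.
have -> : (p + c * a) * (p' + c' * b) = p * (p' + c' * b) + (c * a * p' +
  (c * c') * (a * b)) by ring.
by apply: idealD => //; [exact: ideal_mulr|apply: idealD => //; exact: ideal_mull].
Qed.

(** * Noetherian rings and Hilbert's basis theorem *)

Definition noetherian (A : comPzRingType) : Prop :=
  forall I : nat -> set A, (forall i, is_ideal (I i)) ->
    (forall i, I i `<=` I i.+1) -> exists i, I i.+1 `<=` I i.

(** If [Q] failed somewhere, dependent choice would build a strictly increasing sequence of ideals
    for which it fails. *)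
Lemma noetherian_ind (A : comPzRingType) (Q : set A -> Prop) :
  noetherian A ->
  (forall I, is_ideal I ->
     (forall J, is_ideal J -> I `<=` J -> ~ J `<=` I -> Q J) -> Q I) ->
  forall I, is_ideal I -> Q I.
Proof.
move=> noeA step I0 idI0; apply: contrapT => nQ0.
pose T := {I : set A | is_ideal I /\ ~ Q I}.
have next (I : T) : {J : T | sval I `<=` sval J /\ ~ sval J `<=` sval I}.
  apply: cid; case: I => I [idI nQI] /=; apply: contrapT => nJ; apply: (nQI).
  apply: step => // J idJ IJ JI; apply: contrapT => nQJ; apply: nJ.
  by exists (exist _ J (conj idJ nQJ)).
pose u := fix u n : T := if n is m.+1 then sval (next (u m)) else exist _ I0 (conj idI0 nQ0).
have [|i /=|i] := noeA (fun i => sval (u i)).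
- by move=> i; have [] := svalP (u i).
- by have [] := svalP (next (u i)).
- by have [] := svalP (next (u i)).
Qed.

(** Each new index minimises [u] on the tail beyond the previous one, so the chosen values can only
    increase. *)
Lemma monotone_subsequence (u : nat -> nat) :
  exists phi : nat -> nat, (forall i j, (i < j)%N -> (phi i < phi j)%N) /\
    (forall i j, (i <= j)%N -> (u (phi i) <= u (phi j))%N).
Proof.
have tailmin N : {j | (N <= j)%N & forall l, (N <= l)%N -> (u j <= u l)%N}.
  apply: cid2.
  have ex : exists v, `[< exists2 j, (N <= j)%N & u j = v >] by exists (u N); apply/asboolP;
    exists N.
  case: (ex_minnP ex) => v /asboolP[j Nj <-] vmin; exists j => // l Nl.
  by apply: vmin; apply/asboolP; exists l.
pose g N := s2val (tailmin N).
have gge N : (N <= g N)%N := s2valP (tailmin N).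
have gmin N l : (N <= l)%N -> (u (g N) <= u l)%N := s2valP' (tailmin N) l.
pose phi := fix phi i := if i is j.+1 then g (phi j).+1 else g 0%N.
have phiS i : (phi i < phi i.+1)%N by exact: gge.
have phi_lt i j : (i < j)%N -> (phi i < phi j)%N.
  by apply: (homo_ltn ltn_trans).
exists phi; split=> //.
apply: (homo_leq leqnn leq_trans) => -[|i] /=; first by apply: gmin.
by apply: gmin; exact: leq_trans (phiS i) (ltnW (phiS i.+1)).
Qed.

(** Passing to a subsequence once per variable makes every exponent nondecreasing; its first two
    terms then compare. *)
Lemma dickson (n : nat) (m : nat -> 'X_{1..n}) :
  exists i j, (i < j)%N /\ (m i <= m j)%MM.
Proof.
have [phi [phi_lt phi_mono]] : exists phi : nat -> nat,
    (forall i j, (i < j)%N -> (phi i < phi j)%N) /\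
    (forall x : 'I_n, x \in enum 'I_n -> forall i j, (i <= j)%N -> (m (phi i) x <= m (phi j) x)%N).
  elim: (enum 'I_n) => [|x s [phi [phi_lt mono]]]; first by exists id.
  have [psi [psi_lt psi_mono]] := monotone_subsequence (fun i => m (phi i) x).
  exists (phi \o psi); split=> [i j ij|y]; first exact/phi_lt/psi_lt.
  rewrite inE => /orP[/eqP ->|ys] i j ij; first exact: psi_mono.
  apply: mono => //; move: ij; rewrite leq_eqVlt => /orP[/eqP -> //|/psi_lt].
  exact: ltnW.
exists (phi 0%N), (phi 1%N); split; first exact: phi_lt.
by apply/mnm_lepP => x; apply: phi_mono => //; rewrite mem_enum.
Qed.

(** Choose in each [I i.+1] an element outside [I i] with minimal leading monomial. By Dickson's
    lemma one leading monomial divides a later one; cancelling the later leading term stays outside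
    [I j] and contradicts minimality. *)
Lemma mpoly_noetherian (k : fieldType) (n : nat) : noetherian {mpoly k[n]}.
Proof.
move=> I idI Inc; apply: contrapT => nstab.
have strict i : exists p, I i.+1 p /\ ~ I i p.
  apply: contrapT => /forallNP nex; apply: nstab; exists i => p Ip.
  by apply: contrapT => nIp; exact: (nex p).
have pmin i : {p | I i.+1 p /\ ~ I i p &
    forall q, I i.+1 q -> ~ I i q -> ~ (mlead q < mlead p)%O}.
  apply: cid2; have [p Ip] := strict i.
  have [mu mup] : exists mu, mlead p = mu by exists (mlead p).
  elim/(@ltmwf n): mu p Ip mup => mu IH p Ip mup.
  have [[q [[Iq nIq] qp]]|nex] := pselect (exists q, (I i.+1 q /\ ~ I i q) /\ (mlead q < mlead
    p)%O).
    have lt : (mlead q < mu)%O by rewrite -mup.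
    exact: (IH _ lt q).
  by exists p => // q Iq nIq qp; apply: nex; exists q.
pose p i := s2val (pmin i).
have [i [j [ij mij]]] := dickson (fun i => mlead (p i)).
have [Ii nIi] := s2valP (pmin i); have [Ij nIj] := s2valP (pmin j).
have jmin := s2valP' (pmin j).
rewrite -/(p i) -/(p j) in Ii nIi Ij nIj jmin.
have Imono a b : (a <= b)%N -> I a `<=` I b.
  by apply: homo_leq => [x //|x y z|]; [exact: subset_trans | exact: Inc].
have nz l q : ~ I l q -> q != 0 by move=> nI; apply/eqP => q0; apply: nI; rewrite q0; exact: ideal0.
have pi0 := nz _ _ nIi; have pj0 := nz _ _ nIj.
pose s := (mleadc (p j) / mleadc (p i)) *: 'X_[mlead (p j) - mlead (p i)] : {mpoly k[n]}.
have Isp : I j (s * p i) by apply: ideal_mull => //; exact: Imono Ii.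
have cs0 : mleadc (p j) / mleadc (p i) != 0.
  by rewrite mulf_neq0 ?invr_eq0 ?mleadc_eq0.
have s0 : s != 0 by rewrite scaler_eq0 negb_or cs0 -msupp_eq0 msuppX.
have sl : mlead s = (mlead (p j) - mlead (p i))%MM by rewrite mleadZ // mleadXm.
have ml : mlead (s * p i) = mlead (p j) by rewrite mleadM // sl submK.
have mc : mleadc (s * p i) = mleadc (p j).
  by rewrite ml -{1}(submK mij) -{1}sl mleadcM /s mleadcZE mleadXm mcoeffX eqxx mulr1 divfK
    ?mleadc_eq0.
have lt : (mlead (p j - s * p i) < mlead (p j))%O \/ p j - s * p i = 0.
  have [->|d0] := eqVneq (p j - s * p i) 0; [by right | left].
  rewrite lt_neqAle; apply/andP; split; last first.
    by apply: le_trans (mleadB_le _ _) _; rewrite ml joinxx.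
  apply: contraNneq d0 => dE; rewrite -mleadc_eq0 dE mcoeffB -{2}ml mc.
  by rewrite subrr.
have nIjs : ~ I j (p j - s * p i).
  by move=> /(idealD (idI j))/(_ Isp); rewrite subrK.
case: lt => [|d0]; last by apply: nIjs; rewrite d0; exact: ideal0.
apply: jmin => //; apply: idealB => //; exact: (Imono _ _ (leqnSn j)).
Qed.

Lemma prime_prod (A : comPzRingType) (P : set A) (J : eqType) (r : seq J) (F : J -> A) :
  prime_ideal P -> P (\prod_(i <- r) F i) -> exists2 i, i \in r & P (F i).
Proof.
case=> _ _ _ P1 PM; elim: r => [|i r IH]; first by rewrite big_nil.
rewrite big_cons => /PM[Pi|/IH[j jr Pj]]; first by exists i; rewrite ?mem_head.
by exists j; rewrite ?inE ?jr ?orbT.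
Qed.

Lemma prime_constP (k : fieldType) n (P : set {mpoly k[n]}) c :
  is_ideal P -> ~ P 1 -> P c%:MP -> c = 0.
Proof.
move=> idP P1 Pc; apply: contrapT => /eqP c0; apply: P1.
by rewrite -mpolyC1 -(mulVf c0) mpolyCM; exact: ideal_mull.
Qed.

Lemma mpoly_ind_ring (k : comNzRingType) n (Q : {mpoly k[n]} -> Prop) :
  (forall c, Q c%:MP) -> (forall i, Q 'X_i) ->
  (forall p q, Q p -> Q q -> Q (p + q)) -> (forall p q, Q p -> Q q -> Q (p * q)) ->
  forall p, Q p.
Proof.
move=> QC QX QD QM; elim/mpolyind => [|c m p _ _ Qp]; first by rewrite -mpolyC0.
apply/QD => //; rewrite -mul_mpolyC; apply/QM => //.
rewrite mpolyXE_id; apply: (big_ind Q) => [|p' q'|i _]; [by rewrite -mpolyC1 | exact/QM |].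
by elim: (m i) => [|e IH]; rewrite ?expr0 -?mpolyC1 // exprS; apply/QM.
Qed.

Lemma ideal_point (k : comNzRingType) n (I : set {mpoly k[n]}) (v : 'I_n -> k) :
  is_ideal I -> (forall i, I ('X_i - (v i)%:MP)) -> forall p, I (p - (p.@[v])%:MP).
Proof.
move=> idI Iv; elim/mpoly_ind_ring => [c|i|p q Ip Iq|p q Ip Iq].
- by rewrite mevalC subrr; exact: ideal0.
- by rewrite mevalXU.
- by rewrite mevalD mpolyCD opprD addrACA; exact: idealD.
- rewrite mevalM mpolyCM.
  rewrite (_ : _ - _ = q * (p - (p.@[v])%:MP) + (p.@[v])%:MP * (q - (q.@[v])%:MP)); last by ring.
  by apply: idealD => //; exact: ideal_mull.
Qed.

Lemma uncountable_fibre (T U : choiceType) (f : T -> U) :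
  countable [set: U] -> ~ countable [set: T] -> exists u, infinite_set (f @^-1` [set u]).
Proof.
move=> cU ncT; apply: contrapT => /forallNP nex; apply: ncT.
rewrite (_ : [set: T] = \bigcup_(u in [set: U]) f @^-1` [set u]); last first.
  by apply/seteqP; split=> // t _; exists (f t).
apply: bigcup_countable => // u _; apply: finite_set_countable.
by apply: contrapT; exact: (nex u).
Qed.

Lemma exists_left_kernel (k : fieldType) (p q : nat) (B : 'M[k]_(p, q)) :
  (q < p)%N -> exists2 u : 'rV_p, u != 0 & u *m B = 0.
Proof.
move=> qp; have /rowV0Pn[u] : kermx B != 0.
  rewrite -mxrank_eq0 mxrank_ker -lt0n subn_gt0.
  exact: leq_ltn_trans (rank_leq_col B) qp.
by move=> /sub_kermxP uB u0; exists u.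
Qed.

Lemma mpoly_linear_dependence (k : fieldType) n D p (b : 'I_p -> {mpoly k[n]}) :
  (forall j, msize (b j) <= D)%N -> (#|{: 'X_{1..n < D}}| < p)%N ->
  exists2 u : 'I_p -> k, exists j, u j != 0 & \sum_j u j *: b j = 0.
Proof.
move=> bD lt; pose B := \matrix_(j < p, m < #|{: 'X_{1..n < D}}|) (b j)@_(enum_val m).
have [u u0 uB] := @exists_left_kernel k _ _ B lt.
exists (u 0); first by have /rV0Pn := u0.
apply/mpolyP => m; rewrite mcoeff0 raddf_sum /=.
have [mD|Dm] := ltnP (mdeg m) D; last first.
  rewrite big1 // => j _; rewrite mcoeffZ memN_msupp_eq0 ?mulr0 //.
  by apply: msize_mdeg_ge; exact: leq_trans (bD j) Dm.
have := congr1 (fun x : 'rV_ _ => x 0 (enum_rank (BMultinom mD))) uB.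
rewrite !mxE => sE; rewrite -[RHS]sE; apply: eq_bigr => j _.
by rewrite mcoeffZ !mxE enum_rankK.
Qed.

Section Nullstellensatz.
Variables (k : closedFieldType) (n : nat).
Hypothesis k_uncountable : ~ countable [set: k].

(* Otherwise every [X_i - c] is invertible modulo [P] after inverting [h]; as
   [k] is uncountable, infinitely many of these inverses lie in one
   finite-dimensional space, and a linear relation between them yields a
   nonzero polynomial in [X_i] alone belonging to [P]. *)
Lemma coordinate_in_prime (P : set {mpoly k[n]}) (h : {mpoly k[n]}) (i : 'I_n) :
  prime_ideal P -> ~ P h ->
  (forall g, ~ P g -> exists m p b, P p /\ h ^+ m = p + b * g) ->
  exists c, P ('X_i - c%:MP).
Proof.
move=> primeP Ph Pmax; apply: contrapT => /forallNP nP.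
have idP := prime_is_ideal primeP.
have [_ _ _ P1 PM] := primeP.
have /choice[w wP] c : exists w : nat * {mpoly k[n]},
    P (h ^+ w.1 - w.2 * ('X_i - c%:MP)).
  by have [m [p [b [Pp hE]]]] := Pmax _ (nP c); exists (m, b); rewrite /= hE addrK.
have [[m D] inf] := @uncountable_fibre k (nat * nat)%type (fun c => ((w c).1, msize (w c).2))
  (countableP _) k_uncountable.
pose N := #|{: 'X_{1..n < D}}|.+1.
have [C CF CN] := infinite_set_fset N inf.
pose c (j : 'I_N) := nth 0 (finmap.enum_fset C) j.
have cC j : c j \in finmap.enum_fset C by apply: mem_nth; exact: leq_trans (ltn_ord j) CN.
have cinj : injective c.
  move=> x y /eqP; rewrite nth_uniq ?finmap.fset_uniq ?(leq_trans (ltn_ord _) CN) //.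
  by move/eqP/val_inj.
have wc j : (w (c j)).1 = m /\ msize (w (c j)).2 = D by have [] := CF (c j) (cC j).
have [|u [j0 uj0] usum] := @mpoly_linear_dependence k n D N (fun j => (w (c j)).2) _ (ltnSn _).
  by move=> j; rewrite (wc j).2.
(* The relation between the inverses of the [X - c_j], with denominators cleared. At [c j0] only the
   term [j0] survives, so [q] is nonzero. *)
pose q : {poly k} := \sum_j u j *: \prod_(l | l != j) ('X - (c l)%:P).
have q0 : q != 0.
  apply/eqP => qz; have : q.[c j0] = 0 by rewrite qz horner0.
  rewrite horner_sum (bigD1 j0) //= hornerZ horner_prod [X in _ + X]big1 ?addr0; last first.
    move=> j jj0; rewrite hornerZ horner_prod (bigD1 j0) 1?eq_sym //=.
    by rewrite hornerD hornerX hornerN hornerC subrr mul0r mulr0.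
  move=> /eqP; rewrite mulf_eq0 (negPf uj0) /= => /eqP/eqP /prodf_eq0[l lj0].
  by rewrite !hornerE subr_eq0 => /eqP/cinj lE; rewrite lE eqxx in lj0.
pose E (p : {poly k}) := (map_poly (@mpolyC n k) p).['X_i].
have EC a : E a%:P = a%:MP by rewrite /E map_polyC hornerC.
have EX a : E ('X - a%:P) = 'X_i - a%:MP.
  by rewrite /E rmorphB /= map_polyX map_polyC hornerD hornerN hornerX hornerC.
have EM : {morph E : p p' / p * p'} by move=> p p'; rewrite /E rmorphM hornerM.
have E1 : E 1 = 1 by rewrite -[1]/(1%:P) EC mpolyC1.
have Eprod (J : finType) (pr : pred J) (F : J -> {poly k}) :
    E (\prod_(l | pr l) F l) = \prod_(l | pr l) E (F l) by apply: big_morph.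
have Eq : E q = \sum_j (u j)%:MP * \prod_(l | l != j) ('X_i - (c l)%:MP).
  rewrite /E rmorph_sum horner_sum; apply: eq_bigr => j _.
  rewrite -mul_polyC -/(E _) EM EC Eprod; congr (_ * _).
  by apply: eq_bigr => l _; exact: EX.
have PEq : P (E q).
  suff : P (h ^+ m * E q) by case/PM => // /(prime_expr primeP).
  (* Subtracting the zero combination of the [w_j], times the product of all [X_i - c_l], leaves
     multiples of the elements [h ^+ m - w_j * (X_i - c_j)] of [P]. *)
  have -> : h ^+ m * E q = \sum_j (u j)%:MP * \prod_(l | l != j) ('X_i - (c l)%:MP) *
      (h ^+ m - (w (c j)).2 * ('X_i - (c j)%:MP)).
    transitivity (h ^+ m * E q - (\sum_j u j *: (w (c j)).2) * \prod_l ('X_i - (c l)%:MP)).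
      by rewrite usum mul0r subr0.
    rewrite Eq mulr_sumr mulr_suml -sumrB; apply: eq_bigr => j _.
    by rewrite [in X in _ - X](bigD1 j) //= -mul_mpolyC; ring.
  apply: ideal_sum => // j _; apply: ideal_mull => //.
  by rewrite -{1}(wc j).1; exact: wP.
have [r qE] := closed_field_poly_normal q.
move: PEq; rewrite qE -mul_polyC EM EC => /PM[/(prime_constP idP P1)/eqP|].
  by rewrite lead_coef_eq0 (negPf q0).
rewrite (_ : E _ = \prod_(z <- r) ('X_i - z%:MP)); last first.
  rewrite (big_morph E EM E1); apply: eq_bigr => z _; exact: EX.
by move=> /(prime_prod primeP)[z _]; exact: nP.
Qed.

(** If no power of [h] lies in [I], a maximal ideal avoiding these powers contains some [X_i - v_i]
    for every [i]. Then [v] is a zero of [I], and [h] cannot vanish there. *)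
Theorem nullstellensatz (I : set {mpoly k[n]}) (h : {mpoly k[n]}) : is_ideal I ->
  (forall v, (forall p, I p -> p.@[v] = 0) -> h.@[v] = 0) -> exists m, I (h ^+ m).
Proof.
move=> idI hI; apply: contrapT => /forallNP /(prime_avoiding idI)[P [primeP IP Ph Pmax]].
have idP := prime_is_ideal primeP; have [_ _ _ P1 _] := primeP.
have /choice[v Pv] i := coordinate_in_prime i primeP Ph Pmax.
have Pp := ideal_point idP Pv.
have Pval p : P p -> p.@[v] = 0.
  move=> Pp'; apply: (prime_constP idP P1).
  by have := idealB idP Pp' (Pp p); rewrite opprB addrC subrK.
apply: Ph; have := Pp h; rewrite hI ?mpolyC0 ?subr0 // => p /IP; exact: Pval.
Qed.

End Nullstellensatz.

(** * Cech cohomology *)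

(* A Cech cochain assigns to each [sigma : {set 'I_M}] an element of the localisation
   of a ring [O] at the product of the [w i], [i] in [sigma]; all of them lie in a field
   [K]. The differential [wedge E] only involves the indices in [E], and [contract v] is
   a homotopy for it as soon as the [v i], [i] in [E], add up to [1]. *)
Section Cochains.
Variables (K : fieldType) (M : nat).
Implicit Types (c : {set 'I_M} -> K) (v : 'I_M -> K) (E sigma : {set 'I_M}) (i j : 'I_M).

(** The sign of exterior multiplication by the basis vector [i]: one factor [-1] for each element of
    [sigma] that it passes. *)
Definition sgn (i : 'I_M) (sigma : {set 'I_M}) : K :=
  (-1) ^+ #|[set j in sigma | (j < i)%N]|.

Definition wedge E c : {set 'I_M} -> K := fun sigma =>
  \sum_(i in sigma :&: E) sgn i sigma * c (sigma :\ i).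

Definition contract v c : {set 'I_M} -> K := fun sigma =>
  \sum_(i in ~: sigma) sgn i sigma * v i * c (i |: sigma).

Lemma sgn_add i j sigma : i \notin sigma ->
  sgn j (i |: sigma) = (-1) ^+ (i < j)%N * sgn j sigma.
Proof.
move=> inot; rewrite /sgn; have [ij|ji] := boolP (i < j)%N; last first.
  rewrite expr0 mul1r; congr (_ ^+ _); apply: eq_card => x; rewrite !inE.
  by have [->|//] := eqVneq x i; rewrite (negPf ji) !andbF.
rewrite -exprD; congr (_ ^+ _).
rewrite (_ : [set x in i |: sigma | (x < j)%N] = i |: [set x in sigma | (x < j)%N]).
  by rewrite cardsU1 !inE (negPf inot).
by apply/setP => x; rewrite !inE; have [->|] := eqVneq x i; rewrite ?ij.
Qed.

Lemma sgn_del i j sigma : i \in sigma ->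
  sgn j (sigma :\ i) = (-1) ^+ (i < j)%N * sgn j sigma.
Proof.
move=> si; rewrite -{2}(finset.setD1K si) sgn_add ?finset.setD11 // mulrA -exprD addnn -mul2n.
by rewrite exprM sqrrN !expr1n mul1r.
Qed.

Lemma sgn_sq i sigma : sgn i sigma * sgn i sigma = 1.
Proof. by rewrite -expr2 sqrr_sign. Qed.

Lemma signr_lt (i j : 'I_M) : i != j ->
  (-1) ^+ (i < j)%N = - (-1) ^+ (j < i)%N :> K.
Proof. by rewrite neq_ltn => /orP[] lt; rewrite lt ltnNge ltnW //= ?opprK. Qed.

Lemma sgn_swap i j sigma : i \in sigma -> j \in sigma -> i != j ->
  sgn i sigma * sgn j (sigma :\ i) = - (sgn j sigma * sgn i (sigma :\ j)).
Proof. by move=> si sj ij; rewrite !sgn_del // (signr_lt ij); ring. Qed.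

(** Exchanging two removals flips the sign. For [E = E'] this says that the differential squares to
    zero once 2 is invertible; for disjoint sets it gives the two differentials of a double
    complex. *)
Lemma wedge_anticomm E E' c :
  wedge E (wedge E' c) = fun sigma => - wedge E' (wedge E c) sigma.
Proof.
apply/funext => sigma; rewrite /wedge -sumrN.
under eq_bigr do rewrite mulr_sumr.
under [RHS]eq_bigr do rewrite mulr_sumr -sumrN.
rewrite (exchange_big_dep (mem (sigma :&: E'))) /=; last first.
  by move=> i j _; rewrite !inE => /andP[/andP[_ ->] ->].
apply: eq_bigr => j; rewrite inE => /andP[sj Ej].
rewrite (eq_bigl (mem ((sigma :\ j) :&: E))) /=; last first.
  by move=> i; rewrite !inE Ej sj !andbT [j == i]eq_sym; case: (i \in sigma); case: (i \in E);
    case: (i == j).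
apply: eq_bigr => i; rewrite !inE => /andP[/andP[ij si] Ei].
rewrite !mulrA sgn_swap // mulNr; congr (- (_ * c _)).
by apply/setP => x; rewrite !inE andbCA.
Qed.

(** Cartan's homotopy formula: removing and inserting the same index gives the right-hand side, and
    the terms with two distinct indices cancel by the sign rules. *)
Lemma wedge_contract E v c sigma :
  wedge E (contract v c) sigma + contract v (wedge E c) sigma =
  (\sum_(i in E) v i) * c sigma.
Proof.
have -> : wedge E (contract v c) sigma = \sum_(j in sigma :&: E) v j * c sigma +
    \sum_(j in sigma :&: E) \sum_(i in ~: sigma)
      sgn j sigma * (sgn i (sigma :\ j) * v i * c (i |: (sigma :\ j))).
  rewrite -big_split /=; apply: eq_bigr => j; rewrite inE => /andP[sj Ej].
  rewrite /contract (bigD1 j) /=; last by rewrite !inE eqxx.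
  rewrite mulrDr mulr_sumr; congr (_ + _).
    rewrite finset.setD1K // sgn_del // ltnn expr0 mul1r !mulrA sgn_sq mul1r //.
  by apply: eq_bigl => i; rewrite !inE; have [->|_] := eqVneq i j; rewrite ?sj ?andbT.
have -> : contract v (wedge E c) sigma = \sum_(j in ~: sigma :&: E) v j * c sigma +
    \sum_(i in ~: sigma) \sum_(j in sigma :&: E)
      sgn i sigma * v i * (sgn j (i |: sigma) * c ((i |: sigma) :\ j)).
  rewrite (_ : \sum_(j in ~: sigma :&: E) _ = \sum_(j in ~: sigma) (j \in E)%:R * (v j * c sigma)).
    rewrite -big_split /=; apply: eq_bigr => i; rewrite inE => si.
    rewrite /wedge mulr_sumr; have [Ei|nEi] := boolP (i \in E).
      rewrite (bigD1 i) /=; last by rewrite !inE eqxx.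
      rewrite mul1r finset.setU1K // sgn_add // ltnn expr0 mul1r; congr (_ + _).
        by rewrite mulrACA sgn_sq mul1r.
      by apply: eq_bigl => j; rewrite !inE; have [->|_] := eqVneq j i;
        rewrite /= ?andbT ?andbF // (negPf si).
    rewrite mul0r add0r; apply: eq_bigl => j; rewrite !inE.
    by have [->|_] := eqVneq j i; rewrite /= ?(negPf nEi) ?andbF.
  under eq_bigl do rewrite inE.
  rewrite big_mkcondr; apply: eq_bigr => j _.
  by case: ifP => _; rewrite ?mul1r ?mul0r.
rewrite addrACA [X in _ + X](_ : _ = 0) ?addr0; last first.
  rewrite exchange_big -big_split big1 //= => i; rewrite inE => si.
  rewrite -big_split big1 //= => j; rewrite inE => /andP[sj Ej].
  have ij : i != j by apply: contraNneq si => ->.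
  rewrite sgn_del // sgn_add // (signr_lt ij) (_ : i |: (sigma :\ j) = (i |: sigma) :\ j);
    first by ring.
  by apply/setP => x; rewrite !inE; have [->|] := eqVneq x i; rewrite ?ij.
rewrite mulr_suml [RHS](bigID (mem sigma)) /=; congr (_ + _).
  by apply: eq_bigl => j; rewrite !inE andbC.
by apply: eq_bigl => j; rewrite !inE andbC.
Qed.

End Cochains.

Definition is_subring (A : comPzRingType) (O : set A) : Prop :=
  [/\ O 1, (forall a b, O a -> O b -> O (a - b)) & forall a b, O a -> O b -> O (a * b)].

Section Subring.
Variables (A : comPzRingType) (O : set A).
Hypothesis ringO : is_subring O.

Lemma subring1 : O 1. Proof. by case: ringO. Qed.
Lemma subringB a b : O a -> O b -> O (a - b). Proof. by case: ringO => _ + _; exact. Qed.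
Lemma subringM a b : O a -> O b -> O (a * b). Proof. by case: ringO => _ _; exact. Qed.
Lemma subring0 : O 0. Proof. by rewrite -(subrr 1); apply: subringB; exact: subring1. Qed.
Lemma subringN a : O a -> O (- a).
Proof. by rewrite -sub0r; apply: subringB; exact: subring0. Qed.
Lemma subringD a b : O a -> O b -> O (a + b).
Proof. by move=> Oa Ob; rewrite -[b]opprK; apply: subringB => //; exact: subringN. Qed.
Lemma subringX a m : O a -> O (a ^+ m).
Proof. by move=> Oa; elim: m => [|m IH]; [exact: subring1|rewrite exprS; exact: subringM]. Qed.
Lemma subring_prod (J : Type) (r : seq J) (P : pred J) (F : J -> A) :
  (forall i, P i -> O (F i)) -> O (\prod_(i <- r | P i) F i).
Proof. by move=> OF; elim/big_ind: _ => //; [exact: subring1|exact: subringM]. Qed.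
Lemma subring_sum (J : Type) (r : seq J) (P : pred J) (F : J -> A) :
  (forall i, P i -> O (F i)) -> O (\sum_(i <- r | P i) F i).
Proof. by move=> OF; elim/big_ind: _ => //; [exact: subring0|exact: subringD]. Qed.

(** In a field, with [g] nonzero, this is the localisation of [O] at [g]. *)
Definition frac_over (g : A) : set A := [set x | exists N, O (g ^+ N * x)].

Lemma is_subring_frac g : O g -> is_subring (frac_over g).
Proof.
move=> Og; split; first by exists 0%N; rewrite mulr1 expr0; exact: subring1.
- move=> a b [N Na] [N' Nb]; exists (N + N')%N.
  rewrite (_ : _ * _ = g ^+ N' * (g ^+ N * a) - g ^+ N * (g ^+ N' * b)); last by rewrite exprD;
    ring.
  by apply: subringB; apply: subringM => //; exact: subringX.
- move=> a b [N Na] [N' Nb]; exists (N + N')%N.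
  by rewrite exprD mulrACA; exact: subringM.
Qed.

Lemma frac_over_sub g : O `<=` frac_over g.
Proof. by move=> a Oa; exists 0%N; rewrite expr0 mul1r. Qed.

Lemma frac_over_mul g g' : O g' -> frac_over g `<=` frac_over (g' * g).
Proof.
move=> Og' a [N Na]; exists N; rewrite exprMn -mulrA; apply: subringM => //.
exact: subringX.
Qed.

End Subring.

(* [O] plays the role of the scalars; for [O = setT], the set [J] is an ideal. *)
Lemma radical_add (A : comPzRingType) (O J : set A) a b m m' :
  is_subring O -> J 0 -> (forall x y, J x -> J y -> J (x + y)) ->
  (forall x y, O x -> J y -> J (x * y)) -> O a -> O b ->
  J (a ^+ m) -> J (b ^+ m') -> J ((a + b) ^+ (m + m')).
Proof.
move=> ringO J0 JD JM Oa Ob Jam Jbm; rewrite exprDn.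
apply: (big_ind J) => // -[i /= _] _.
rewrite -mulr_natl; apply: (JM).
  by elim: 'C(_, _) => [|e IH]; [exact: subring0|rewrite -natr1; apply: subringD => //;
    exact: subring1].
have [im'|m'i] := leqP i m'.
  rewrite -(subnK im') addnA addnK addnC exprD mulrAC; apply: (JM) => //.
  by apply: subringM => //; exact: subringX.
rewrite -(subnK (ltnW m'i)) [b ^+ _]exprD mulrA; apply: (JM) => //.
by apply: subringM => //; exact: subringX.
Qed.

Lemma radical_sum (A : comPzRingType) (O J : set A) (I : Type) (r : seq I) (P : pred I)
    (F : I -> A) :
  is_subring O -> J 0 -> (forall x y, J x -> J y -> J (x + y)) ->
  (forall x y, O x -> J y -> J (x * y)) -> (forall i, P i -> O (F i)) ->
  (forall i, P i -> exists m, J (F i ^+ m)) -> exists m, J ((\sum_(i <- r | P i) F i) ^+ m).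
Proof.
move=> ringO J0 JD JM OF JF.
suff [] : O (\sum_(i <- r | P i) F i) /\ exists m, J ((\sum_(i <- r | P i) F i) ^+ m) by [].
apply: (big_ind (fun x => O x /\ exists m, J (x ^+ m))) => [|x y|i Pi].
- by split; [exact: subring0|exists 1%N; rewrite expr1].
- move=> [Ox [m Jx]] [Oy [m' Jy]]; split; first exact: subringD.
  by exists (m + m')%N; exact: (radical_add ringO).
- by split; [exact: OF|exact: JF].
Qed.

Section Exactness.
Variables (K : fieldType) (M : nat) (O : set K) (w : 'I_M -> K).
Hypothesis ringO : is_subring O.
Hypothesis Ow : forall i, O (w i).
Implicit Types (c : {set 'I_M} -> K) (E sigma tau : {set 'I_M}).

Let wprod sigma := \prod_(i in sigma) w i.
Let frac sigma := frac_over O (wprod sigma).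

Let Owprod sigma : O (wprod sigma).
Proof. by apply: subring_prod. Qed.

Let ring_frac sigma : is_subring (frac sigma).
Proof. exact: is_subring_frac. Qed.

Let frac_subset sigma tau : sigma \subset tau -> frac sigma `<=` frac tau.
Proof.
move=> st; rewrite /frac (_ : wprod tau = wprod (tau :\: sigma) * wprod sigma).
  exact: frac_over_mul.
rewrite /wprod (bigID (mem sigma)) /= mulrC; congr (_ * _).
  by apply: eq_bigl => i; rewrite !inE andbC.
apply: eq_bigl => i; have [si|nsi] := boolP (i \in sigma); last by rewrite andbF.
by rewrite (fintype.subsetP st).
Qed.

Definition admissible c := forall sigma, frac sigma (c sigma).

Definition bidegree E E' p q c := forall sigma, c sigma != 0 ->
  [/\ sigma \subset E :|: E', #|sigma :&: E| = p & #|sigma :&: E'| = q].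

(** Where [w j] is inverted, the [w i] with [i] in [E] generate the unit ideal; this is what makes
    the complex in the direction [E] exact there. *)
Definition power_in_span E E' := forall j, j \in E' -> w j != 0 /\
  exists N (r : 'I_M -> K), (forall i, O (r i)) /\ w j ^+ N = \sum_(i in E) r i * w i.

Lemma admissible_sgn i sigma : O (sgn K i sigma).
Proof. by apply: subringX => //; apply: subringN => //; exact: subring1. Qed.

Lemma admissible_wedge E c : admissible c -> admissible (wedge E c).
Proof.
move=> ac sigma; apply: (subring_sum (ring_frac sigma)) => i _.
apply: (subringM (ring_frac sigma)).
  by apply: frac_over_sub; exact: admissible_sgn.
by apply: (frac_subset (finset.subD1set sigma i)); exact: ac.
Qed.

Lemma admissibleB c c' : admissible c -> admissible c' -> admissible (fun s => c s - c' s).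
Proof. by move=> ac ac' s; apply: (subringB (ring_frac s)). Qed.

Lemma admissibleN c : admissible c -> admissible (fun s => - c s).
Proof. by move=> ac s; apply: (subringN (ring_frac s)). Qed.

Lemma wedgeB E c c' : wedge E (fun s => c s - c' s) = fun s => wedge E c s - wedge E c' s.
Proof. by apply/funext => s; rewrite /wedge -sumrB; apply: eq_bigr => i _; rewrite mulrBr. Qed.

Lemma wedgeN E c : wedge E (fun s => - c s) = fun s => - wedge E c s.
Proof. by apply/funext => s; rewrite /wedge -sumrN; apply: eq_bigr => i _; rewrite mulrN. Qed.

(** After inverting [w j], the [w i] generate the unit ideal, hence so do their [N]-th powers. The
    factor [w i ^+ N] will absorb the poles along [w i] of a cochain on which the contraction
    acts. *)
Lemma partition_of_unity E E' j N : power_in_span E E' -> j \in E' ->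
  exists v : 'I_M -> K, [/\ \sum_(i in E) v i = 1, (forall i, i \notin E -> v i = 0) &
    forall i, exists y, frac [set j] y /\ v i = y * w i ^+ N].
Proof.
move=> pow jE'; have [wj0 [N' [r [Or wE]]]] := pow j jE'.
(* The ideal of [O] generated by the [N]-th powers; its radical contains each [r i * w i], hence
   [w j]. *)
pose J : set K := [set x | exists r : 'I_M -> K, (forall i, O (r i)) /\
  x = \sum_(i in E) r i * w i ^+ N].
have [|x y|x y|i iE|i iE|m [s [Os sE]]] := @radical_sum K O J _ (index_enum 'I_M) (mem E) (fun i
  => r i * w i) ringO.
- by exists (fun=> 0); split=> [i|]; [exact: subring0|rewrite big1 // => i _; rewrite mul0r].
- move=> [a [Oa ->]] [b [Ob ->]]; exists (fun i => a i + b i); split.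
    by move=> i; apply: subringD.
  by rewrite -big_split; apply: eq_bigr => i _ /=; rewrite mulrDl.
- move=> Ox [a [Oa ->]]; exists (fun i => x * a i); split.
    by move=> i; apply: subringM.
  by rewrite mulr_sumr; apply: eq_bigr => i _; rewrite mulrA.
- by apply: subringM.
- exists N, (fun l => if l == i then r i ^+ N else 0); split.
    by move=> l; case: ifP => _; [exact: subringX|exact: subring0].
  rewrite (bigD1 i) //= eqxx big1 ?addr0 ?exprMn //.
  by move=> l /andP[_ /negPf ->]; rewrite mul0r.
pose D := w j ^+ (N' * m); have D0 : D != 0 by rewrite expf_neq0.
exists (fun i => if i \in E then s i * w i ^+ N / D else 0); split.
- rewrite (eq_bigr (fun i => s i * w i ^+ N / D)); last by move=> i ->.
  by rewrite -mulr_suml -sE -wE -exprM divff.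
- by move=> i /negPf ->.
- move=> i; case: ifP => _; last first.
    by exists 0; rewrite mul0r; split=> //; exact: (subring0 (ring_frac _)).
  exists (s i / D); split; last by rewrite mulrAC.
  exists (N' * m)%N; rewrite /wprod big_set1 -/D mulrC divfK //.
Qed.

Lemma common_exponent N (J : finType) (g x : J -> K) : (forall i, O (g i)) ->
  (forall i, frac_over O (g i) (x i)) -> exists N', (N <= N')%N /\ forall i, O (g i ^+ N' * x i).
Proof.
move=> Og /choice[e ex]; exists (N + \sum_i e i)%N; split; first exact: leq_addr.
move=> i; rewrite (bigD1 i) //= addnCA exprD mulrAC [_ * x i]mulrC.
rewrite [x i * _]mulrC; apply: subringM => //; exact: subringX.
Qed.

(** As [q > 0], every simplex in the support has an index in [E'], and the partition of unity
    attached to it makes [contract] a homotopy. The partition is chosen as a function of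
    [sigma :&: E'], which [wedge E] does not change, so the homotopy formula holds although [v]
    varies with [sigma]. *)
Lemma wedge_exact E E' p q c : (forall i, i \in E -> i \notin E') -> power_in_span E E' ->
  (0 < q)%N ->
  admissible c -> bidegree E E' p q c -> wedge E c = (fun=> 0) ->
  exists e, [/\ admissible e, (forall sigma, e sigma != 0 ->
    [/\ sigma \subset E :|: E', #|sigma :&: E|.+1 = p & #|sigma :&: E'| = q]) & wedge E e = c].
Proof.
move=> disj pow q0 ac bc dc.
have [N [_ Nc]] := common_exponent 0 Owprod ac.
have /choice[v vP] (tau : {set 'I_M}) : exists v : 'I_M -> K,
    [/\ (forall j, j \in tau -> j \in E' -> \sum_(i in E) v i = 1),
        (tau :&: E' = finset.set0 -> forall i, v i = 0),
        (forall i, i \notin E -> v i = 0) &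
        forall i, exists y, frac tau y /\ v i = y * w i ^+ N].
  have [E0|[j]] := set_0Vmem (tau :&: E').
    exists (fun=> 0); split=> //.
      move=> j jt jE'; have : j \in tau :&: E' by rewrite inE jt jE'.
      by rewrite E0 inE.
    by move=> i; exists 0; rewrite mul0r; split=> //; exact: (subring0 (ring_frac _)).
  rewrite inE => /andP[jt jE'].
  have [v [v1 vE vy]] := partition_of_unity N pow jE'; exists v; split=> //.
    move=> E0; have : j \in tau :&: E' by rewrite inE jt jE'.
    by rewrite E0 inE.
  move=> i; have [y [fy ->]] := vy i; exists y; split=> //.
  by apply: (frac_subset _ fy); rewrite finset.sub1set.
exists (fun sigma => contract (v (sigma :&: E')) c sigma); split.
- move=> sigma; apply: (subring_sum (ring_frac sigma)) => i; rewrite inE => si.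
  have [_ _ _ /(_ i)[y [fy ->]]] := vP (sigma :&: E').
  rewrite (_ : _ * _ = sgn K i sigma * y * (w i ^+ N * c (i |: sigma))); last by ring.
  apply: (subringM (ring_frac sigma)).
    apply: (subringM (ring_frac sigma)); first by apply: frac_over_sub; exact: admissible_sgn.
    by apply: (frac_subset (finset.subsetIl sigma E')).
  (* The factor [w i ^+ N] completes the power of [wprod sigma] to that of [wprod (i |: sigma)],
     which clears the pole of [c]. *)
  exists N; rewrite mulrA -exprMn (_ : wprod sigma * w i = wprod (i |: sigma)); first exact: Nc.
  by rewrite /wprod big_setU1 //= mulrC.
- move=> sigma /eqP sn0.
  have [i [si vi ci]] : exists i, [/\ i \notin sigma, v (sigma :&: E') i != 0 & c (i |: sigma) !=
    0].
    apply: contrapT => nex; apply: sn0; rewrite /contract big1 // => i; rewrite inE => si.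
    have [->|vi] := eqVneq (v (sigma :&: E') i) 0; first by rewrite mulr0 mul0r.
    have [->|ci] := eqVneq (c (i |: sigma)) 0; first by rewrite mulr0.
    by case: nex; exists i.
  have iE : i \in E by apply: contraNT vi; have [_ _ + _] := vP (sigma :&: E') => /[apply] ->.
  have iE' : i \notin E' := disj i iE.
  have [sub <- <-] := bc _ ci; split.
  + by apply: fintype.subset_trans sub; exact: finset.subsetUr.
  + rewrite (_ : (i |: sigma) :&: E = i |: (sigma :&: E)) ?cardsU1 ?inE ?(negPf si) //.
    by apply/setP => x; rewrite !inE; have [->|//] := eqVneq x i; rewrite iE.
  + congr #|pred_of_set _|; apply/setP => x; rewrite !inE.
    by have [->|//] := eqVneq x i; rewrite (negPf iE') !andbF.
- apply/funext => sigma.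
  have -> : wedge E (fun s => contract (v (s :&: E')) c s) sigma =
      wedge E (contract (v (sigma :&: E')) c) sigma.
    apply: eq_bigr => i; rewrite inE => /andP[si iE]; congr (_ * contract (v _) c _).
    apply/setP => x; rewrite !inE; have [->|//] := eqVneq x i.
    by rewrite (negPf (disj _ iE)) !andbF.
  have := wedge_contract E (v (sigma :&: E')) c sigma.
  rewrite dc /contract [X in _ + X]big1 ?addr0; last by move=> i _; rewrite mulr0.
  move=> ->; have [v1 v0 _ _] := vP (sigma :&: E').
  have [E0|[j]] := set_0Vmem (sigma :&: E'); last first.
    by rewrite inE => /andP[js jE']; rewrite (v1 j) ?mul1r // inE js.
  have [->|/bc[_ _ card]] := eqVneq (c sigma) 0; first by rewrite mulr0.
  by move: q0; rewrite -card E0 cards0.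
Qed.

End Exactness.

Section Zigzag.
Variables (K : fieldType) (M : nat) (O : set K) (w : 'I_M -> K) (L R : {set 'I_M}).
Hypothesis ringO : is_subring O.
Hypothesis Ow : forall i, O (w i).
Hypothesis LR : forall i, i \in L -> i \notin R.
Hypothesis powR : power_in_span O w L R.
Hypothesis powL : power_in_span O w R L.
Hypothesis two_neq0 : 2%:R != 0 :> K.
Hypothesis lt : (#|R| < #|L|)%N.
Implicit Types (c : {set 'I_M} -> K) (E sigma : {set 'I_M}).

Let RL i : i \in R -> i \notin L.
Proof. by move=> iR; apply: contraL iR => /LR. Qed.

Let wedge_step E E' p q c sigma : (forall i, i \in E -> i \notin E') ->
  bidegree E E' p q c -> wedge E c sigma != 0 ->
  [/\ sigma \subset E :|: E', #|sigma :&: E| = p.+1 & #|sigma :&: E'| = q].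
Proof.
move=> disj bc /eqP ne0.
have [i [si iE]] : exists i, [/\ i \in sigma, i \in E & c (sigma :\ i) != 0].
  apply: contrapT => nex; apply: ne0; rewrite /wedge big1 // => i; rewrite inE => /andP[si iE].
  have [->|ci] := eqVneq (c (sigma :\ i)) 0; first by rewrite mulr0.
  by case: nex; exists i.
move=> /bc[sub <- <-]; split.
- by rewrite -(finset.setD1K si) finset.subUset sub finset.sub1set inE iE.
- rewrite (_ : (sigma :\ i) :&: E = (sigma :&: E) :\ i).
    by rewrite [in LHS](cardsD1 i) inE si iE.
  by apply/setP => x; rewrite !inE andbA.
- congr #|pred_of_set _|; apply/setP => x; rewrite !inE.
  by have [->|//] := eqVneq x i; rewrite (negPf (disj _ iE)) !andbF.
Qed.

Let bidegreeC E E' p q c : bidegree E E' p q c -> bidegree E' E q p c.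
Proof. by move=> bc s /bc[sub cp cq]; split=> //; rewrite finset.setUC. Qed.

Let wedge_wedge E c : wedge E (wedge E c) = (fun=> 0).
Proof.
apply/funext => s; apply/eqP; rewrite -(mulrI_eq0 _ (mulfI two_neq0)) mulr_natl mulr2n.
by rewrite {1}wedge_anticomm addNr.
Qed.

Let wedge0 E : wedge E (fun=> 0) = (fun=> 0) :> ({set 'I_M} -> K).
Proof. by apply/funext => s; rewrite /wedge big1 // => i _; rewrite mulr0. Qed.

(** The cochain is corrected by an [L]-coboundary until it is [R]-closed. The induction follows the
    antidiagonal [p + q = #|L|] up to [q = #|R|], where [wedge R] has no index left to add. Since
    [#|R| < #|L|], the degree [p] stays large enough for exactness along [R] on the way back. *)
Let zigzag j : forall q p c, (q + j)%N = #|R| -> (p + q)%N = #|L| ->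
  admissible O w c -> bidegree L R p q c -> wedge L (wedge R c) = (fun=> 0) ->
  exists h, [/\ admissible O w h, (forall s, h s != 0 ->
    [/\ s \subset L :|: R, #|s :&: L|.+1 = p & #|s :&: R| = q]) &
    wedge R (fun s => c s - wedge L h s) = (fun=> 0)].
Proof.
elim: j => [|j IH] q p c qj pq ac bc dc.
  have wR0 : wedge R c = (fun=> 0).
    apply/funext => s; apply/eqP/negP => /negP /(wedge_step RL (bidegreeC bc))[_ card _].
    have : (#|s :&: R| <= #|R|)%N by rewrite subset_leq_card ?finset.subsetIr.
    by rewrite card -qj addn0 ltnn.
  exists (fun=> 0); split=> //; first by move=> s; exists 0%N; rewrite mulr0; exact: subring0.
    by move=> s; rewrite eqxx.
  by rewrite wedge0 (_ : (fun s => _) = c) //; apply/funext => s; rewrite subr0.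
have bRc : bidegree L R p q.+1 (wedge R c).
  by move=> s /(wedge_step RL (bidegreeC bc))[sub cq cp]; split; rewrite 1?finset.setUC.
have [c' [ac' bc' dc']] := wedge_exact ringO Ow LR powR (ltn0Sn q) (admissible_wedge ringO Ow R
  ac) bRc dc.
have p2 : (1 < p)%N.
  by rewrite -(ltn_add2r q) add1n pq; apply: leq_ltn_trans lt; rewrite -qj addnS ltnS leq_addr.
have bc2 : bidegree L R p.-1 q.+1 c'.
  by move=> s /bc'[sub cp cq]; split=> //; rewrite -cp.
have dc2 : wedge L (wedge R c') = (fun=> 0).
  rewrite wedge_anticomm dc' wedge_wedge.
  by apply/funext => s; rewrite oppr0.
have pq2 : (p.-1 + q.+1)%N = #|L| by rewrite addnS -addSn prednK ?(ltnW p2).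
have qj2 : (q.+1 + j)%N = #|R| by rewrite addSnnS.
have [h [ah bh dh]] := IH _ _ _ qj2 pq2 ac' bc2 dc2.
have p1 : (0 < p.-1)%N by rewrite -ltnS prednK ?(ltnW p2).
pose c2 := fun s => c' s - wedge L h s.
have ac2 : admissible O w c2 by apply: admissibleB => //; exact: admissible_wedge.
have bh2 : bidegree L R p.-2 q.+1 h by move=> s /bh[sub cp cq]; split=> //; rewrite -cp.
have bcc2 : bidegree R L q.+1 p.-1 c2.
  move=> s c2s; apply: bidegreeC (c2s) => {c2s} {}s; rewrite /c2.
  have [c'0|c's _] := eqVneq (c' s) 0; last exact: bc2.
  rewrite c'0 sub0r oppr_eq0 => /(wedge_step LR bh2)[sub cp cq].
  by split=> //; rewrite cp prednK.
have [e [ae be de]] := wedge_exact ringO Ow RL powL p1 ac2 bcc2 dh.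
(* By anticommutation, [wedge R (wedge L e) = - wedge L (wedge R e) = - wedge L c' = - wedge R c],
   so [c + wedge L e] is [R]-closed. *)
exists (fun s => - e s); split.
- exact: admissibleN.
- move=> s; rewrite oppr_eq0 => /be[sub [cq] cp]; split; rewrite 1?finset.setUC //.
  by rewrite cp prednK ?(ltnW p2).
- have -> : wedge L (fun s => - e s) = fun s => - wedge L e s by exact: wedgeN.
  rewrite (_ : (fun s => _) = (fun s => c s - (- wedge L e s))) // wedgeB wedgeN.
  rewrite [wedge R (wedge L e)]wedge_anticomm de wedgeB wedge_wedge -dc'.
  by apply/funext => s /=; rewrite !opprK subr0 subrr.
Qed.

(* With more elements in [L] than in [R], the Cech cohomology for [L] vanishes in
   top degree: it agrees with the one for [R]. *)
Lemma cech_top_vanishing k : exists m s, (forall i, O (s i)) /\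
  (\prod_(i in L) w i) ^+ m = \sum_(i in L) s i * w i ^+ (k + m).
Proof.
pose D := \prod_(i in L) w i.
have D0 : D != 0 by apply/prodf_neq0 => i /powL[].
(* The class of [1 / D ^+ k] in top degree, viewed in bidegree [(#|L|, 0)] of the double complex. *)
pose c (s : {set 'I_M}) := if s == L then D ^- k else 0.
have cL s : c s != 0 -> s = L by rewrite /c; case: (s =P L) => // _; rewrite eqxx.
have ac : admissible O w c.
  move=> s; rewrite /c; case: eqP => [->|_].
    by exists k; rewrite -/D divff ?expf_neq0 //; exact: subring1.
  by exists 0%N; rewrite mulr0; exact: subring0.
have bc : bidegree L R #|L| 0 c.
  move=> s /cL ->; split; rewrite ?finset.subsetUl ?finset.setIid //.
  apply/eqP; rewrite cards_eq0; apply/eqP/setP => x; rewrite !inE.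
  by apply/negP => /andP[/LR /negPf ->].
have dc : wedge L (wedge R c) = (fun=> 0).
  rewrite wedge_anticomm (_ : wedge L c = (fun=> 0)) ?wedge0; last first.
    apply/funext => s; apply/eqP/negP => /negP /(wedge_step LR bc)[_ card _].
    have : (#|s :&: L| <= #|L|)%N by rewrite subset_leq_card ?finset.subsetIr.
    by rewrite card ltnn.
  by apply/funext => s; rewrite oppr0.
have [h [ah bh dh]] := zigzag (add0n _) (addn0 _) ac bc dc.
have L0 : (0 < #|L|)%N by exact: leq_ltn_trans lt.
pose c2 := fun s => c s - wedge L h s.
have bh2 : bidegree L R #|L|.-1 0 h by move=> s /bh[sub cp cq]; split=> //; rewrite -cp.
have bcc2 : bidegree R L 0 #|L| c2.
  move=> s c2s; apply: bidegreeC (c2s) => {c2s} {}s; rewrite /c2.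
  have [c0|cs _] := eqVneq (c s) 0; last exact: bc.
  rewrite c0 sub0r oppr_eq0 => /(wedge_step LR bh2)[sub cp cq].
  by split=> //; rewrite cp prednK.
have ac2 : admissible O w c2 by apply: admissibleB => //; exact: admissible_wedge.
have [e [_ be de]] := wedge_exact ringO Ow RL powL L0 ac2 bcc2 dh.
(* A primitive for [wedge R] would have degree [-1] in [R], so it vanishes, and [c] is an
   [L]-coboundary. *)
have e0 : e = (fun=> 0) by apply/funext => s; apply/eqP/negP => /negP /be[].
have DE : D ^- k = wedge L h L.
  apply/eqP; rewrite -subr_eq0; have := congr1 (@^~ L) de.
  by rewrite e0 wedge0 /c2 /c /= eqxx => <-.
have Oprod (s : {set 'I_M}) : O (\prod_(i in s) w i) by exact: subring_prod.
have [N [kN Nh]] := common_exponent ringO k Oprod ah.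
have Dsplit i : i \in L -> D = (\prod_(j in L :\ i) w j) * w i.
  by move=> iL; rewrite /D -{1}(finset.setD1K iL) big_setU1 ?finset.setD11 //= mulrC.
(* Multiplying by [D ^+ N], with [N >= k], clears all poles of [h]; the term [i] keeps the factor
   [w i ^+ N], that is [w i ^+ (k + (N - k))]. *)
exists (N - k)%N, (fun i => sgn K i L * ((\prod_(j in L :\ i) w j) ^+ N * h (L :\ i))); split.
  by move=> i; apply: subringM => //; exact: admissible_sgn.
have -> : D ^+ (N - k) = D ^+ N * D ^- k by rewrite -{2}(subnK kN) exprD mulfK ?expf_neq0.
rewrite DE /wedge mulr_sumr finset.setIid; apply: eq_bigr => i iL.
by rewrite (Dsplit i iL) exprMn subnKC //; ring.
Qed.

End Zigzag.

(** * Top local cohomology and finite descent *)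

(* Over [A / I], localised at [e], this says that the top local cohomology
   module with respect to the elements [t i] vanishes. *)
Definition top_vanishing (A : comPzRingType) (J : finType) (t : J -> A) (e : A)
    (I : set A) : Prop :=
  forall k, exists m N (s : J -> A),
    I (e ^+ N * (\prod_i t i) ^+ m - \sum_i s i * t i ^+ (k + m)).

Section TopVanishing.
Variables (A : comPzRingType) (J : finType) (t : J -> A) (e : A).
Notation good := (top_vanishing t e).

Lemma top_vanishing_power (I : set A) N : is_ideal I -> I (e ^+ N) -> good I.
Proof.
move=> idI IeN k; exists 0%N, N, (fun=> 0); rewrite expr0 mulr1 big1 ?subr0 //.
by move=> i _; rewrite mul0r.
Qed.

Lemma prod_pow_mul i m n : (\prod_j t j) ^+ m * t i ^+ n =
  (\prod_(j | j != i) t j) ^+ m * t i ^+ (n + m).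
Proof. by rewrite (bigD1 i) //= exprMn exprD; ring. Qed.

(** Vanishing modulo [I + (a)] leaves an error [r * a], which the second hypothesis removes. The
    latter is used with [k + m] in place of [k], so that both sums end with the exponent
    [k + (m + m')]. *)
Lemma top_vanishing_extend (I : set A) (a : A) : is_ideal I ->
  good (ideal_add I (principal a)) ->
  (forall k, exists m N (s : J -> A),
    I (e ^+ N * (\prod_i t i) ^+ m * a - \sum_i s i * t i ^+ (k + m))) ->
  good I.
Proof.
move=> idI good1 good2 k.
have [m [N [s [y [_ [Iy [r ->] sE]]]]]] := good1 k.
have [m' [N' [s' Is']]] := good2 (k + m)%N.
exists (m + m')%N, (N + N')%N, (fun i => e ^+ N' * s i * (\prod_(j | j != i) t j) ^+ m' + r * s' i).
set T := \prod_i t i; rewrite -/T in sE Is'.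
rewrite (_ : _ - _ = e ^+ N' * T ^+ m' * y + r * (e ^+ N' * T ^+ m' * a - \sum_i s' i *
  t i ^+ (k + m + m'))).
  by apply: idealD => //; exact: ideal_mull.
have -> : \sum_i (e ^+ N' * s i * (\prod_(j | j != i) t j) ^+ m' + r * s' i) * t i ^+ (k + (m +
  m')) =
    e ^+ N' * T ^+ m' * (\sum_i s i * t i ^+ (k + m)) + r * (\sum_i s' i * t i ^+ (k + m + m')).
  rewrite !mulr_sumr -big_split; apply: eq_bigr => i _ /=.
  rewrite addnA [in RHS]mulrCA -[in RHS]mulrA /T prod_pow_mul; ring.
have -> : e ^+ (N + N') * T ^+ (m + m') = e ^+ N' * T ^+ m' * (e ^+ N * T ^+ m).
  by rewrite !exprD; ring.
have -> : e ^+ N * T ^+ m = y + r * a + \sum_i s i * t i ^+ (k + m) by rewrite -sE subrK.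
by ring.
Qed.

(** The annihilator of the class of [1 / T ^+ k], with [T] the product of the [t i], in the top
    local cohomology of [A / I]. *)
Definition cleared (I : set A) k : set A :=
  [set x | exists m (s : J -> A), I (x * (\prod_i t i) ^+ m - \sum_i s i * t i ^+ (k + m))].

Lemma is_ideal_cleared (I : set A) k : is_ideal I -> is_ideal (cleared I k).
Proof.
move=> idI; set T := \prod_i t i; split.
- exists 0%N, (fun=> 0); rewrite mul0r sub0r big1 ?oppr0; first exact: ideal0.
  by move=> i _; rewrite mul0r.
- move=> x y [m1 [s1 I1]] [m2 [s2 I2]].
  pose P i := \prod_(j | j != i) t j.
  exists (m1 + m2)%N, (fun i => s1 i * P i ^+ m2 + s2 i * P i ^+ m1).
  rewrite (_ : _ - _ = T ^+ m2 * (x * T ^+ m1 - \sum_i s1 i * t i ^+ (k + m1)) +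
    T ^+ m1 * (y * T ^+ m2 - \sum_i s2 i * t i ^+ (k + m2))).
    by apply: idealD => //; exact: ideal_mull.
  rewrite !mulrBr !mulr_sumr addrACA -opprD -big_split exprD /=; congr (_ - _); first by ring.
  apply: eq_bigr => i _; rewrite mulrCA [X in _ = _ + X]mulrCA /T !prod_pow_mul -/(P i).
  by rewrite -(addnA k m2) [(m2 + m1)%N]addnC addnA; ring.
- move=> x y [m1 [s1 I1]]; exists m1, (fun i => x * s1 i).
  rewrite (_ : _ - _ = x * (y * T ^+ m1 - \sum_i s1 i * t i ^+ (k + m1))); first exact: ideal_mull.
  by rewrite mulrBr mulr_sumr mulrA; congr (_ - _); apply: eq_bigr => i _; rewrite mulrA.
Qed.

Lemma cleared_sub (I : set A) k : I `<=` cleared I k.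
Proof.
move=> x Ix; exists 0%N, (fun=> 0); rewrite expr0 mulr1 big1 ?subr0 // => i _.
by rewrite mul0r.
Qed.

Lemma cleared_pow (I : set A) k i : is_ideal I -> cleared I k (t i ^+ k).
Proof.
move=> idI; exists 0%N, (fun j => (j == i)%:R); rewrite expr0 mulr1 addn0.
rewrite (bigD1 i) //= eqxx mul1r big1 ?addr0 ?subrr; first exact: ideal0.
by move=> j /negPf ->; rewrite mul0r.
Qed.

(** Noetherian induction. If [a * b] is in [I] and neither factor is, then [A / I] is an extension
    of [A / (I + (a))] by [A / (I : a)], and both ideals are strictly larger. What remains are the
    primes that do not contain [e]. *)
Lemma top_vanishing_prime_ind (I0 : set A) : noetherian A -> is_ideal I0 ->
  (forall q, prime_ideal q -> I0 `<=` q -> ~ q e ->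
     (forall I, is_ideal I -> q `<=` I -> ~ I `<=` q -> good I) -> good q) ->
  good I0.
Proof.
move=> noeA idI0 step.
suff H : forall I, is_ideal I -> I0 `<=` I -> good I by exact: H.
apply: (noetherian_ind noeA) => I idI IH I0I.
have {}IH K : is_ideal K -> I `<=` K -> ~ K `<=` I -> good K.
  by move=> idK IK KI; apply: IH => //; exact: subset_trans IK.
have [[N IeN]|/forallNP nIe] := pselect (exists N, I (e ^+ N)).
  exact: top_vanishing_power IeN.
have [[a [b [Iab nIa nIb]]]|nab] := pselect (exists a b, [/\ I (a * b), ~ I a & ~ I b]).
  apply: (@top_vanishing_extend I a) => //.
    apply: IH; first exact: (is_ideal_add idI (is_ideal_principal a)).
      exact: (ideal_addl (is_ideal_principal a)).
    move=> sub; apply/nIa/sub; apply: (ideal_addr idI); exists 1; by rewrite mul1r.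
  pose K : set A := [set x | I (x * a)].
  suff : good K.
    move=> goodK k; have [m [N [s Ks]]] := goodK k; exists m, N, (fun i => a * s i).
    rewrite (_ : _ - _ = (e ^+ N * (\prod_i t i) ^+ m - \sum_i s i * t i ^+ (k + m)) * a) //.
    rewrite mulrBl mulr_suml; congr (_ - _); apply: eq_bigr => i _; ring.
  apply: IH.
  - split; rewrite /K /=; first by rewrite mul0r; exact: ideal0.
    + by move=> x y Ix Iy; rewrite mulrDl; exact: idealD.
    + by move=> x y Iy; rewrite -mulrA; exact: ideal_mull.
  - by move=> x Ix; exact: (ideal_mulr idI _ Ix).
  - by move=> sub; apply/nIb/sub; rewrite /K /= mulrC.
apply: step => //; last by move=> Ie; apply: (nIe 1%N); rewrite expr1.
split; [exact: ideal0|exact: idealD|exact: ideal_mull| |].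
  by move=> I1; apply: (nIe 0%N); rewrite expr0.
move=> a b Iab; apply: contrapT => /not_orP[nIa nIb]; apply: nab.
by exists a, b.
Qed.

End TopVanishing.

Section FiniteDescent.
Variables (A B : comPzRingType) (rho : {rmorphism A -> B}) (J : finType) (t : J -> A) (e : A).
Variables (I0 : set A) (IB : set B).
Hypothesis noeA : noetherian A.
Hypothesis idI0 : is_ideal I0.
Hypothesis idIB : is_ideal IB.

Definition extension (q : set A) : set B :=
  [set x | exists l (b : 'I_l -> B) (p : 'I_l -> A), (forall i, q (p i)) /\
     x = \sum_i b i * rho (p i)].

Lemma is_ideal_extension q : is_ideal q -> is_ideal (extension q).
Proof.
move=> idq; split.
- by exists 0%N, (fun=> 0), (fun=> 0); rewrite big_ord0; split=> // i; exact: ideal0.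
- move=> _ _ [l [b [p [qp ->]]]] [l' [b' [p' [qp' ->]]]].
  exists (l + l')%N, (fun i => match fintype.split i with inl j => b j | inr j => b' j end).
  exists (fun i => match fintype.split i with inl j => p j | inr j => p' j end); split.
    by move=> i; case: (fintype.split i).
  rewrite big_split_ord /=; congr (_ + _); apply: eq_bigr => i _.
    by rewrite (unsplitK (inl i)).
  by rewrite (unsplitK (inr i)).
- move=> a _ [l [b [p [qp ->]]]]; exists l, (fun i => a * b i), p; split=> //.
  by rewrite mulr_sumr; apply: eq_bigr => i _; rewrite mulrA.
Qed.

Lemma extension_mem (q : set A) b x : q x -> extension q (b * rho x).
Proof. by move=> qx; exists 1%N, (fun=> b), (fun=> x); rewrite big_ord1. Qed.

Variables (r : nat) (m : nat -> B).
Hypothesis finiteB : forall s, exists N (a : nat -> A),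
  IB (rho (e ^+ N) * s - \sum_(i < r) rho (a i) * m i).
Hypothesis contract_prime : forall q, prime_ideal q -> I0 `<=` q -> ~ q e ->
  forall c, ideal_add IB (extension q) (rho c) -> q c.

(* Modulo a prime [q] of [A], a minimal generating family yields a nonzero
   [A / q]-linear map from [B / q B] to [A / q], namely the last coordinate; its
   image is a nonzero ideal of [A / q] on which the vanishing over [B] can be
   transported. *)
Lemma top_vanishing_descent :
  top_vanishing (fun i => rho (t i)) (rho e) IB -> top_vanishing t e I0.
Proof.
move=> goodB; apply: top_vanishing_prime_ind => // q primeq I0q nqe IH.
have idq := prime_is_ideal primeq; have [_ _ _ q1 qM] := primeq.
have nqeX N : ~ q (e ^+ N) by move=> /(prime_expr primeq).
pose E := ideal_add IB (extension q).
have idE : is_ideal E by apply: is_ideal_add => //; exact: is_ideal_extension.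
have IBE : IB `<=` E by apply: ideal_addl; exact: is_ideal_extension.
pose spanned l x := exists a : nat -> A, E (x - \sum_(i < l) rho (a i) * m i).
have spD l x y : spanned l x -> spanned l y -> spanned l (x + y).
  move=> [a Ea] [b Eb]; exists (fun i => a i + b i).
  rewrite (_ : _ - _ = (x - \sum_(i < l) rho (a i) * m i) + (y - \sum_(i < l) rho (b i) * m i)).
    exact: idealD.
  rewrite addrACA -opprD -big_split; congr (_ - _).
  by apply: eq_bigr => i _; rewrite rmorphD mulrDl.
have spM l c x : spanned l x -> spanned l (rho c * x).
  move=> [a Ea]; exists (fun i => c * a i).
  rewrite (_ : _ - _ = rho c * (x - \sum_(i < l) rho (a i) * m i)); first exact: ideal_mull.
  by rewrite mulrBr mulr_sumr; congr (_ - _); apply: eq_bigr => i _; rewrite rmorphM mulrA.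
have spE l x : E x -> spanned l x.
  move=> Ex; exists (fun=> 0); rewrite big1 ?subr0 // => i _; by rewrite rmorph0 mul0r.
have spB l x y : spanned l x -> spanned l y -> spanned l (x - y).
  move=> sx sy; apply: (spD) => //; rewrite -mulN1r -[1](rmorph1 rho) -rmorphN; exact: spM.
have sp_sum l (K : Type) (u : seq K) (F : K -> B) : (forall i, spanned l (F i)) ->
    spanned l (\sum_(i <- u) F i).
  move=> sF; elim/big_ind: _ => //; [apply: (spE); exact: ideal0|exact: spD].
(* The first [l] elements [m i] generate [B] modulo [E] once [e] and some [c] outside [q] are
   inverted. A minimal such [l] makes the last generator independent of the others over [A / q]. *)
pose gens l := exists2 c, ~ q c & forall s, exists N, spanned l (rho (e ^+ N * c) * s).
have : exists l, `[< gens l >].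
  exists r; apply/asboolP; exists 1 => // s; have [N [a Na]] := finiteB s.
  by exists N, a; rewrite mulr1; exact: IBE.
(* No generator at all would put [e ^+ N * c] into the contraction of [E], hence into [q]. *)
case/ex_minnP => -[|l] /asboolP[c nqc cB] lmin.
  have [N [a]] := cB 1; rewrite big_ord0 subr0 mulr1 => /contract_prime.
  by move=> /(_ primeq I0q nqe)/qM[/nqeX|].
(* A multiple [y * m l] spanned by the other generators, with [y] outside [q], would make [y * c] a
   denominator for a shorter family. *)
have lastq y : spanned l (rho y * m l) -> q y.
  move=> ymin; apply: contrapT => nqy.
  suff : `[< gens l >] by move/lmin; rewrite ltnn.
  apply/asboolP; exists (y * c); first by move=> /qM[].
  move=> s; have [N [a Na]] := cB s; exists N.
  have : spanned l (rho y * (rho (e ^+ N * c) * s - rho (a l) * m l)).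
    by apply: (spM); exists a; rewrite big_ord_recr /= opprD addrA addrAC in Na.
  move/spD/(_ (spM _ (a l) _ ymin)).
  rewrite [X in spanned l X -> _](_ : _ = rho (e ^+ N * (y * c)) * s) //.
  by rewrite !rmorphM; ring.
have coord s : exists N x, spanned l (rho (e ^+ N * c) * s - rho x * m l).
  have [N [a Na]] := cB s; exists N, (a l), a.
  by rewrite big_ord_recr /= opprD addrA addrAC in Na.
(* If all last coordinates were in [q], the last generator could be dropped. *)
have [s0 [N0 [x0 [sp0 nqx0]]]] : exists s N x, spanned l (rho (e ^+ N * c) * s - rho x *
  m l) /\ ~ q x.
  apply: contrapT => nex; suff : `[< gens l >] by move/lmin; rewrite ltnn.
  apply/asboolP; exists c => // s; have [N [x sx]] := coord s; exists N.
  rewrite -[X in spanned l X](subrK (rho x * m l)); apply: (spD) => //.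
  apply: (spE); apply: (ideal_addr idIB); rewrite mulrC; apply: extension_mem.
  by apply: contrapT => nqx; apply: nex; exists s, N, x.
apply: (@top_vanishing_extend _ _ _ _ q x0) => //.
  apply: IH; first by apply: is_ideal_add => //; exact: is_ideal_principal.
    by apply: ideal_addl; exact: is_ideal_principal.
  by move=> sub; apply/nqx0/sub; apply: (ideal_addr idq); exists 1; rewrite mul1r.
(* The vanishing relation over [B], multiplied by [s0], is read in the last coordinate: it becomes a
   relation over [A / q] for [x0] in place of [1]. *)
move=> k; have [m' [N1 [sg sgE]]] := goodB k.
have /choice[w wP] i : exists w : nat * A, spanned l (rho (e ^+ w.1 * c) * (sg i *
  s0) - rho w.2 * m l).
  by have [N [x sx]] := coord (sg i * s0); exists (N, x).
(* A common exponent of [e] for the coordinates of [s0] and of all the [sg i * s0]. *)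
pose N2 := (N0 + \sum_i (w i).1)%N.
pose d i := e ^+ (N2 - (w i).1) * (w i).2.
exists m', (N1 + (N2 - N0))%N, d.
apply: lastq.
set T := \prod_i t i.
have wN2 i : ((w i).1 <= N2)%N by rewrite /N2 (bigD1 i) //= addnCA leq_addr.
have scale i : spanned l (rho (t i ^+ (k + m')) * (rho (e ^+ N2 * c) * (sg i * s0) - rho (d i) *
  m l)).
  apply: (spM); have := spM _ (e ^+ (N2 - (w i).1)) _ (wP i).
  by rewrite mulrBr !mulrA -!rmorphM mulrA -exprD subnK.
have scale0 : spanned l (rho (e ^+ N1 * T ^+ m') * (rho (e ^+ N2 * c) *
  s0 - rho (e ^+ (N2 - N0) * x0) * m l)).
  apply: (spM); have := spM _ (e ^+ (N2 - N0)) _ sp0.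
  by rewrite mulrBr !mulrA -!rmorphM mulrA -exprD subnK ?leq_addr.
have sp1 : spanned l (rho (e ^+ N2 * c) * s0 * (rho e ^+ N1 *
  (\prod_i rho (t i)) ^+ m' - \sum_i sg i * rho (t i) ^+ (k + m'))).
  by apply: (spE); apply: ideal_mull => //; exact: IBE.
have := spB _ _ _ (spD _ _ _ sp1 (sp_sum l J (index_enum J) _ scale)) scale0.
rewrite [X in spanned l X -> _](_ : _ = rho (e ^+ (N1 +
  (N2 - N0)) * T ^+ m' * x0 - \sum_i d i * t i ^+ (k + m')) * m l) //.
have -> : \sum_i rho (t i ^+ (k + m')) * (rho (e ^+ N2 * c) * (sg i * s0) - rho (d i) * m l) =
    rho (e ^+ N2 * c) * s0 * (\sum_i sg i * rho (t i) ^+ (k +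
      m')) - rho (\sum_i d i * t i ^+ (k + m')) * m l.
  rewrite rmorph_sum mulr_sumr mulr_suml -sumrB; apply: eq_bigr => i _.
  by rewrite !rmorphM rmorphXn; ring.
rewrite -(rmorph_prod rho) -/T exprD !(rmorphB, rmorphM, rmorphXn).
by ring.
Qed.

End FiniteDescent.

(** * Charts of a hypersurface *)

(* [a] cuts out a principal open subset of the hypersurface [f = 0], and [xt] maps
   the open subset [a (xt z) != 0] of the smooth variety [g = 0] bijectively and
   finitely onto it. All the conditions bear on closed points. *)
Section Charts.
Variables (k : fieldType) (n : nat) (f a : {mpoly k[n]}) (c d : nat).
Variables (g : 'I_c -> {mpoly k[(c + d)%N]}) (xt : n.-tuple {mpoly k[(c + d)%N]}).
Implicit Types (z : 'I_(c + d) -> k) (p s : {mpoly k[(c + d)%N]}).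

Definition chart_map z : 'I_n -> k := fun i => (tnth xt i).@[z].
Definition on_zeros z : Prop := forall j, (g j).@[z] = 0.
Definition on_chart z : Prop := on_zeros z /\ a.@[chart_map z] != 0.

Record chart : Prop := Chart {
  chart_radical : forall p, (forall z, on_zeros z -> p.@[z] = 0) ->
    exists b : 'I_c -> {mpoly k[(c + d)%N]}, p = \sum_j b j * g j;
  chart_zero : forall z, on_zeros z -> f.@[chart_map z] = 0;
  chart_jacobian : forall z, on_zeros z ->
    (\det (\matrix_(i < c, j < c) mderiv (lshift d i) (g j))).@[z] != 0;
  chart_injective : forall z z', on_chart z -> on_chart z' ->
    chart_map z = chart_map z' -> z = z';
  chart_surjective : forall x, f.@[x] = 0 -> a.@[x] != 0 ->
    exists2 z, on_chart z & chart_map z = x;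
  chart_integral : forall s, exists N r (al : 'I_r -> {mpoly k[n]}), forall z, on_chart z ->
    a.@[chart_map z] ^+ N * s.@[z] ^+ r = \sum_(j < r) (al j).@[chart_map z] * s.@[z] ^+ j }.

End Charts.

Lemma map_poly_MXaddC (A B : nzRingType) (h : {additive A -> B}) (P : {poly A}) b y :
  (map_poly h (P * 'X + b%:P)).[y] = (map_poly h P).[y] * y + h b.
Proof.
rewrite raddfD /= map_polyC /= hornerD hornerC; congr (_ + _).
rewrite -hornerMX; congr _.[_]; apply/polyP => i.
by rewrite coef_map coefMX [RHS]coefMX; case: i => [|i] /=; rewrite ?raddf0 ?coef_map.
Qed.

Lemma meval_horner_comp (k : comNzRingType) n m (xt : n.-tuple {mpoly k[m]}) z
    (P : {poly {mpoly k[n]}}) s :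
  (map_poly (comp_mpoly xt) P).[s].@[z] =
  (map_poly (meval (fun i => (tnth xt i).@[z])) P).[s.@[z]].
Proof.
elim/poly_ind: P => [|Q e IHQ]; first by rewrite !raddf0 !horner0 meval0.
by rewrite !map_poly_MXaddC mevalD mevalM IHQ comp_mpoly_meval.
Qed.

Lemma submm n (m : 'X_{1..n}) : (m - m = 0)%MM.
Proof. by apply/mnmP => i; rewrite mnmBE subnn mnm0E. Qed.

(** * Tangent vectors and the dimension of a chart *)

Section PointDerivations.
Variables (k : fieldType) (m : nat) (z : 'I_m -> k) (delta : {mpoly k[m]} -> k).

Definition point_derivation : Prop :=
  [/\ (forall c, delta c%:MP = 0), (forall p q, delta (p + q) = delta p + delta q) &
      forall p q, delta (p * q) = delta p * q.@[z] + p.@[z] * delta q].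

Hypothesis derivD : point_derivation.
Let dC := let: And3 h _ _ := derivD in h.
Let dD := let: And3 _ h _ := derivD in h.
Let dM := let: And3 _ _ h := derivD in h.

Lemma point_derivation_comp n (xt : n.-tuple {mpoly k[m]}) p :
  delta (p \mPo xt) =
  \sum_i (mderiv i p).@[fun i => (tnth xt i).@[z]] * delta (tnth xt i).
Proof.
elim/mpoly_ind_ring: p => [c|i|p q IHp IHq|p q IHp IHq].
- by rewrite comp_mpolyC dC big1 // => i _; rewrite mderivC meval0 mul0r.
- rewrite comp_mpolyXU -tnth_nth (bigD1 i) //= big1 ?addr0.
    by rewrite mderivX mnm1E eqxx scale1r submm mpolyX0 meval1 mul1r.
  by move=> j ji; rewrite mderivX mnm1E eq_sym (negPf ji) scale0r meval0 mul0r.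
- rewrite raddfD /= dD IHp IHq -big_split; apply: eq_bigr => i _ /=.
  by rewrite mderivD mevalD mulrDl.
- rewrite rmorphM /= dM IHp IHq !comp_mpoly_meval mulr_suml mulr_sumr -big_split.
  by apply: eq_bigr => i _ /=; rewrite mderivM mevalD !mevalM; ring.
Qed.

Lemma point_derivation_horner n (xt : n.-tuple {mpoly k[m]}) (P : {poly {mpoly k[n]}}) s :
  let x := fun i => (tnth xt i).@[z] in
  delta (map_poly (comp_mpoly xt) P).[s] =
  \sum_i (map_poly (meval x \o mderiv i) P).[s.@[z]] * delta (tnth xt i) +
  (map_poly (meval x) P^`()).[s.@[z]] * delta s.
Proof.
move=> x; elim/poly_ind: P => [|P b IH].
  rewrite deriv0 !raddf0 !horner0 -mpolyC0 dC mul0r addr0 big1 // => i _.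
  by rewrite raddf0 horner0 mul0r.
rewrite map_poly_MXaddC dD dM IH point_derivation_comp.
under [in RHS]eq_bigr do rewrite map_poly_MXaddC mulrDl.
rewrite big_split /= derivMXaddC rmorphD rmorphM /= map_polyX hornerD hornerMX.
rewrite meval_horner_comp -/x.
rewrite mulrDl mulr_suml (eq_bigr (fun i => (map_poly (meval x \o mderiv i) P).[s.@[z]] *
  s.@[z] * delta (tnth xt i))).
  by ring.
by move=> i _; ring.
Qed.

End PointDerivations.

Section ChartDimension.
Variables (k : fieldType) (n : nat) (f a : {mpoly k[n]}) (c d : nat).
Variables (g : 'I_c -> {mpoly k[(c + d)%N]}) (xt : n.-tuple {mpoly k[(c + d)%N]}).
Hypothesis char0 : [pchar k] =i pred0.
Hypothesis chartP : chart f a g xt.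
Implicit Types (z : 'I_(c + d) -> k) (b p s : {mpoly k[(c + d)%N]}).
Notation on_chart := (on_chart a g xt).

Let natr_neq0 i : (0 < i)%N -> i%:R != 0 :> k.
Proof. by move/pcharf0P: char0 => ->; rewrite lt0n. Qed.

Let ev (P : {poly {mpoly k[n]}}) s z := (map_poly (meval (chart_map xt z)) P).[s.@[z]].

(** Differentiate the integral equation of [s] until its value at [s] no longer vanishes on all of
    [b != 0]. In characteristic 0 this stops at the latest with the [r]-th derivative, which is
    [r! * a ^+ N]. The last vanishing derivative has [s] as a simple root on a smaller open set, cut
    out by [b']. *)
Lemma chart_separating s b : (exists2 z, on_chart z & b.@[z] != 0) ->
  exists P b', (exists2 z, on_chart z & (b * b').@[z] != 0) /\
    forall z, on_chart z -> (b * b').@[z] != 0 -> ev P s z = 0 /\ ev P^`() s z != 0.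
Proof.
move=> [z0 z0c bz0]; have [N [r [al alE]]] := chart_integral chartP s.
pose P := (a ^+ N)%:P * 'X^r - \sum_(j < r) (al j)%:P * 'X^j.
have PE z : on_chart z -> ev P s z = 0.
  move=> zc; rewrite /ev /P rmorphB rmorphM /= map_polyC map_polyXn.
  rewrite [map_poly _ (\sum_(j < r) _)]rmorph_sum /=.
  rewrite hornerD hornerN hornerM hornerC hornerXn horner_sum rmorphXn /= alE //.
  apply/eqP; rewrite subr_eq0; apply/eqP/eq_bigr => j _.
  by rewrite rmorphM /= map_polyC map_polyXn hornerM hornerC hornerXn.
have Pr z : on_chart z -> ev P^`(r) s z != 0.
  move=> [_ az]; rewrite /ev (_ : P^`(r) = (a ^+ N *+ r`!)%:P).
    rewrite map_polyC hornerC /= rmorphMn rmorphXn /= -mulr_natr mulf_neq0 ?expf_neq0 //.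
    by rewrite natr_neq0 // fact_gt0.
  apply/polyP => i; rewrite coef_derivn coefC /P coefB coefMXn coef_sum.
  rewrite big1 ?subr0 => [|j _]; last first.
    by rewrite coefCM coefXn gtn_eqF ?mulr0 // (leq_trans (ltn_ord j)) ?leq_addr.
  rewrite ltnNge leq_addr /= addnC addnK coefC; case: i => [|i]; last by rewrite mul0rn.
  by rewrite add0n ffactnn.
have ex : exists i, `[< exists2 z, on_chart z & b.@[z] != 0 /\ ev P^`(i) s z != 0 >].
  by exists r; apply/asboolP; exists z0 => //; split=> //; exact: Pr.
case: (ex_minnP ex) => -[|i] /asboolP[z1 z1c [bz1 Pz1]] imin.
  by rewrite derivn0 PE ?eqxx in Pz1.
exists P^`(i), (map_poly (comp_mpoly xt) P^`(i.+1)).[s].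
split; first by exists z1 => //; rewrite mevalM mulf_neq0 // meval_horner_comp.
move=> z zc; rewrite mevalM mulf_eq0 negb_or meval_horner_comp => /andP[bz Pz].
split; last by rewrite -derivnS.
apply/eqP/negP => /negP Piz.
have /imin : `[< exists2 z, on_chart z & b.@[z] != 0 /\ ev P^`(i) s z != 0 >].
  by apply/asboolP; exists z.
by rewrite ltnn.
Qed.

Lemma chart_separating_seq (u : seq 'I_d) : (exists z, on_chart z) ->
  exists b, (exists2 z, on_chart z & b.@[z] != 0) /\ forall l, l \in u -> exists P, forall z,
    on_chart z -> b.@[z] != 0 -> ev P 'X_(rshift c l) z = 0 /\ ev P^`() 'X_(rshift c l) z != 0.
Proof.
move=> [z0 z0c]; elim: u => [|l u [b [exb bu]]].
  by exists 1; split=> //; exists z0 => //; rewrite meval1 oner_neq0.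
have [P [b' [exbb' PE]]] := chart_separating 'X_(rshift c l) exb.
exists (b * b'); split=> // j; rewrite inE => /orP[/eqP ->|ju]; first by exists P.
have [Q QE] := bu j ju; exists Q => z zc; rewrite mevalM mulf_eq0 negb_or => /andP[bz _].
exact: QE.
Qed.

(** Take a partial derivative of [f] of least order that does not vanish on all of the image; the
    one along the leading monomial is a nonzero constant, so the order is bounded. It has positive
    order as [f] vanishes on the image, and removing one differentiation gives [h]. *)
Lemma chart_relation b : f != 0 -> (exists2 z, on_chart z & b.@[z] != 0) ->
  exists h, (forall z, on_chart z -> b.@[z] != 0 -> h.@[chart_map xt z] = 0) /\
    exists i z, [/\ on_chart z, b.@[z] != 0 & (mderiv i h).@[chart_map xt z] != 0].
Proof.
move=> f0 [z0 z0c bz0].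
pose Q D := exists m z, [/\ mdeg m = D, on_chart z, b.@[z] != 0 & (f^`M[m]).@[chart_map xt z] != 0].
have ex : exists D, `[< Q D >].
  exists (mdeg (mlead f)); apply/asboolP; exists (mlead f), z0; split=> //.
  rewrite (_ : f^`M[mlead f] = (mleadc f *+ \prod_i (mlead f i)`!)%:MP); last first.
    apply/mpolyP => m; rewrite mcoeff_mderivm mcoeffC.
    have [->|m0] := eqVneq m 0%MM.
      rewrite addm0 mulr1; congr (_ *+ _); apply: eq_bigr => i _.
      by rewrite ffactnn.
    rewrite mulr0 mcoeff_gt_mlead ?mul0rn //.
    by rewrite lt_neqAle lemc_addr andbT -{1}[mlead f]addm0 eqm_add2l eq_sym.
  rewrite mevalC -mulr_natr mulf_neq0 ?mleadc_eq0 // natr_neq0 //.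
  by apply: prodn_gt0 => i; exact: fact_gt0.
case: (ex_minnP ex) => D /asboolP[m [z [mD zc bz mz]]] Dmin.
have [i mi] : exists i, m i != 0%N.
  apply: contrapT => /forallNP m0; move: mz.
  rewrite (_ : m = 0%MM) ?mderivm0m ?(chart_zero chartP) ?eqxx //; first by case: zc.
  by apply/mnmP => i; rewrite mnm0E; apply/eqP/negP => /negP /m0.
have mE : m = (m - U_(i) + U_(i))%MM by rewrite submK // lep1mP.
exists f^`M[m - U_(i)]; split; last first.
  by exists i, z; split=> //; rewrite -mderivmU1m -mderivmDm -mE.
move=> z' zc' bz'; apply/eqP/negP => /negP mz'.
have /Dmin : `[< Q (mdeg (m - U_(i))%MM) >] by apply/asboolP; exists (m - U_(i))%MM, z'.
by rewrite -mD {1}mE mdegD mdeg1 addn1 ltnn.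
Qed.

(** Multiplied by [b] and by the pullback of [a], the function [p] vanishes on all zeros of [g], so
    it lies in the ideal of the [g j], which [delta] kills. Leibniz's rule at [z0], where both
    factors are nonzero, then gives the value of [delta p]. *)
Lemma chart_tangent b z0 delta p : point_derivation z0 delta -> (forall j, delta (g j) = 0) ->
  on_chart z0 -> b.@[z0] != 0 -> (forall z, on_chart z -> b.@[z] != 0 -> p.@[z] = 0) ->
  delta p = 0.
Proof.
move=> derivD dg z0c bz0 pE; have [dC dD dM] := derivD.
have d0 : delta 0 = 0 by rewrite -mpolyC0 dC.
have [|w wE] := chart_radical chartP (p := p * (b * (a \mPo xt))).
  move=> z zY; rewrite mevalM mevalM comp_mpoly_meval.
  have [->|bz] := eqVneq b.@[z] 0; first by rewrite mul0r mulr0.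
  have [az|az] := eqVneq a.@[chart_map xt z] 0; first by rewrite -/(chart_map xt z) az !mulr0.
  by rewrite pE ?mul0r.
have : delta (p * (b * (a \mPo xt))) = 0.
  rewrite wE (big_morph delta dD d0) big1 // => j _.
  by rewrite dM dg mulr0 addr0 (proj1 z0c) mulr0.
rewrite dM pE // mul0r addr0 mevalM comp_mpoly_meval => /eqP.
by rewrite mulf_eq0 (negPf (mulf_neq0 bz0 (proj2 z0c))) orbF => /eqP.
Qed.

(** Implicit differentiation: the coefficients along the first [c] coordinates solve a linear system
    with the invertible Jacobian matrix [J]. *)
Lemma chart_tangent_frame z0 : on_chart z0 -> exists delta : 'I_d -> {mpoly k[(c + d)%N]} -> k,
  [/\ forall l, point_derivation z0 (delta l), forall l j, delta l (g j) = 0 &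
      forall l j, delta l 'X_(rshift c j) = (l == j)%:R].
Proof.
move=> [z0Y _].
pose J := \matrix_(i < c, j < c) (mderiv (lshift d i) (g j)).@[z0].
have Ju : J \in unitmx.
  rewrite unitmxE unitfE; have := chart_jacobian chartP z0Y.
  rewrite -det_map_mx (_ : map_mx _ _ = J) //.
  by apply/matrixP => i j; rewrite !mxE.
pose W := \matrix_(l < d, j < c) (mderiv (rshift c l) (g j)).@[z0].
pose V := - W *m invmx J.
have VJ : V *m J = - W by rewrite mulmxKV.
exists (fun l p => \sum_i V l i * (mderiv (lshift d i) p).@[z0] + (mderiv (rshift c l) p).@[z0]).
split.
- move=> l; split=> [e|p q|p q].
  + by rewrite mderivC meval0 addr0 big1 // => i _; rewrite mderivC meval0 mulr0.
  + rewrite mderivD mevalD addrACA -big_split; congr (_ + _).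
    by apply: eq_bigr => i _; rewrite mderivD mevalD mulrDr.
  + rewrite mderivM mevalD !mevalM mulrDl mulrDr addrACA; congr (_ + _).
    rewrite [X in _ = X + _]mulr_suml [X in _ = _ + X]mulr_sumr -big_split.
    by apply: eq_bigr => i _; rewrite mderivM mevalD !mevalM /=; ring.
- move=> l j; have := congr1 (fun A : 'M_(d, c) => A l j) VJ.
  rewrite !mxE => /eqP; rewrite -subr_eq0 opprK => /eqP VE; rewrite -[RHS]VE; congr (_ + _).
  by apply: eq_bigr => i _; rewrite [J _ _]mxE.
- move=> l j; rewrite big1 ?add0r => [|i _].
    rewrite mderivX mnm1E eq_sym eq_rshift; have [->|_] := eqVneq l j;
      last by rewrite scale0r meval0.
    by rewrite scale1r submm mpolyX0 meval1.
  by rewrite mderivX mnm1E eq_rlshift scale0r meval0 mulr0.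
Qed.

(** The rows of [X] are the images of the tangent frame under the differential of [xt]. They are
    independent because [X *m Q] is invertible, the last [d] coordinates being separable over the
    image, and they are orthogonal to the nonzero gradient of [h]. *)
Lemma chart_dim : f != 0 -> (exists z, on_chart z) -> (d < n)%N.
Proof.
move=> f0 /(chart_separating_seq (enum 'I_d))[b [exb bE]].
have /choice[P PE] l : exists P, forall z, on_chart z -> b.@[z] != 0 ->
    ev P 'X_(rshift c l) z = 0 /\ ev P^`() 'X_(rshift c l) z != 0.
  by apply: bE; rewrite mem_enum.
have [h [hE [i0 [z0 [z0c bz0 hz0]]]]] := chart_relation f0 exb.
have [delta [derivD dg dX]] := chart_tangent_frame z0c.
pose x0 := chart_map xt z0.
pose X := \matrix_(l < d, i < n) delta l (tnth xt i).
pose Q := \matrix_(i < n, j < d) (map_poly (meval x0 \o mderiv i) (P j)).[('X_(rshift c j)).@[z0]].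
pose D : 'rV[k]_d := \row_j ev (P j)^`() 'X_(rshift c j) z0.
have XQ : X *m Q = - diag_mx D.
  apply/matrixP => l j; rewrite !mxE.
  have : delta l (map_poly (comp_mpoly xt) (P j)).['X_(rshift c j)] = 0.
    apply: (chart_tangent (derivD l) (dg l) z0c bz0) => z zc bz.
    by rewrite meval_horner_comp; have [] := PE j z zc bz.
  rewrite (point_derivation_horner (derivD l)) dX => /eqP; rewrite addr_eq0 => /eqP sE.
  transitivity (- ((ev (P j)^`() 'X_(rshift c j) z0) *+ (l == j))); last first.
    by have [->|//] := eqVneq l j.
  rewrite -mulr_natr /ev -sE.
  by apply: eq_bigr => i _; rewrite !mxE mulrC.
have Xd : \rank X = d.
  apply/eqP; rewrite eqn_leq rank_leq_row /=.
  rewrite -[X in (X <= _)%N](@mxrank_unit _ d (X *m Q)) ?mxrankM_maxl //.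
  rewrite XQ -scaleN1r unitmxE detZ det_diag unitfE mulf_neq0 //.
    by rewrite expf_neq0 // oppr_eq0 oner_neq0.
  by apply/prodf_neq0 => j _; rewrite mxE; have [_] := PE j z0 z0c bz0.
pose G := \col_i (mderiv i h).@[x0].
have XG : X *m G = 0.
  apply/matrixP => l j; rewrite !mxE.
  have : delta l (h \mPo xt) = 0.
    apply: (chart_tangent (derivD l) (dg l) z0c bz0) => z zc bz.
    by rewrite comp_mpoly_meval; exact: hE.
  rewrite (point_derivation_comp (derivD l)) => sE; rewrite -[RHS]sE.
  by apply: eq_bigr => i _; rewrite !mxE mulrC.
have G0 : (0 < \rank G)%N.
  rewrite lt0n mxrank_eq0; apply/eqP => GE; move: hz0.
  by have := congr1 (fun A : 'cV_n => A i0 0) GE; rewrite !mxE => ->; rewrite eqxx.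
have : (X <= kermx G)%MS by apply/sub_kermxP.
move/mxrankS; rewrite Xd mxrank_ker => dn.
by apply: leq_ltn_trans dn _; rewrite ltn_subrL G0 (leq_ltn_trans _ (ltn_ord i0)).
Qed.

End ChartDimension.

(** * The residue field of a prime ideal *)

Section PrimeField.
Variables (A : comNzRingType) (q : set A).
Hypothesis primeq : prime_ideal q.

Definition prime_mem : A -> bool := fun x => `[< q x >].

Let prime_mem_ideal : idealr_closed prime_mem.
Proof.
have idq := prime_is_ideal primeq; have [_ _ _ q1 _] := primeq.
split; first by apply/asboolP; exact: ideal0.
  by apply/asboolP.
move=> a x y /asboolP qx /asboolP qy; apply/asboolP.
by apply: idealD => //; exact: ideal_mull.
Qed.

HB.instance Definition _ := isIdealr.Build A prime_mem prime_mem_ideal.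

Let prime_mem_prime : prime_idealr_closed prime_mem.
Proof.
have [_ _ _ _ qM] := primeq.
by move=> x y /asboolP/qM[?|?]; apply/orP; [left|right]; apply/asboolP.
Qed.

HB.instance Definition _ := isPrimeIdealrClosed.Build A prime_mem prime_mem_prime.

Let Q : Type := {ideal_quot (prime_mem : idealr A)}.
HB.instance Definition _ := GRing.ComNzRing.on Q.

(** Inverses in [A / q] are picked by choice, extended by the identity to non-units; they serve to
    give the quotient the structure of an integral domain, whose fraction field is then taken. *)
Let unitQ : {pred Q} := fun x => `[< exists y, y * x = 1 >].
Let invQ (x : Q) : Q := if pselect (exists y, y * x = 1) is left ex then sval (cid ex) else x.

Let mulVQ : {in unitQ, left_inverse 1 invQ *%R}.
Proof.
move=> x /asboolP xu; rewrite /invQ; case: pselect => // ex.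
exact: (svalP (cid ex)).
Qed.

Let unitQ_intro (x y : Q) : y * x = 1 -> unitQ x.
Proof. by move=> yx; apply/asboolP; exists y. Qed.

Let invQ_out : {in [predC unitQ], invQ =1 id}.
Proof.
by move=> x /negP xnu; rewrite /invQ; case: pselect => // ex; case: xnu; apply/asboolP.
Qed.

HB.instance Definition _ := GRing.ComNzRing_hasMulInverse.Build Q mulVQ unitQ_intro invQ_out.
HB.instance Definition _ :=
  GRing.ComUnitRing_isIntegral.Build Q (@Quotient.rquot_IdomainAxiom A (prime_mem : prime_idealr
    A)).

Lemma prime_residue_field : exists (K : fieldType) (pi : {rmorphism A -> K}),
  forall x, pi x = 0 <-> q x.
Proof.
pose piQ : {rmorphism A -> Q} := (\pi_Q)%qT.
exists {fraction Q}, (@FracField.tofrac Q \o piQ : {rmorphism A -> {fraction Q}}) => x /=.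
have piE : (piQ x == 0) = prime_mem x.
  rewrite -[prime_mem x]/(x \in (prime_mem : idealr A)) -[in RHS](subr0 x) Quotient.idealrBE.
  by rewrite -[0 in LHS](rmorph0 piQ).
split.
  by move=> /eqP; rewrite tofrac_eq0 piE => /asboolP.
by move=> qx; apply/eqP; rewrite tofrac_eq0 piE; apply/asboolP.
Qed.

End PrimeField.

Section TwoCopies.
Variables (k : comNzRingType) (m : nat).
Implicit Types (p : {mpoly k[m]}) (v : 'I_(m + m) -> k).

Definition vars_left : m.-tuple {mpoly k[m + m]} := [tuple 'X_(lshift m i) | i < m].
Definition vars_right : m.-tuple {mpoly k[m + m]} := [tuple 'X_(rshift m i) | i < m].
Definition pt_left v : 'I_m -> k := fun i => v (lshift m i).
Definition pt_right v : 'I_m -> k := fun i => v (rshift m i).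
Definition pt_pair (x y : 'I_m -> k) : 'I_(m + m) -> k := fun i =>
  match fintype.split i with inl j => x j | inr j => y j end.

Local Notation lft := (comp_mpoly vars_left).
Local Notation rgt := (comp_mpoly vars_right).

Lemma meval_left p v : (lft p).@[v] = p.@[pt_left v].
Proof. by rewrite comp_mpoly_meval; apply: meval_eq => i; rewrite tnth_mktuple mevalXU. Qed.

Lemma meval_right p v : (rgt p).@[v] = p.@[pt_right v].
Proof. by rewrite comp_mpoly_meval; apply: meval_eq => i; rewrite tnth_mktuple mevalXU. Qed.

Lemma pt_left_pair x y : pt_left (pt_pair x y) = x.
Proof. by apply/funext => i; rewrite /pt_left /pt_pair (unsplitK (inl i)). Qed.

Lemma pt_right_pair x y : pt_right (pt_pair x y) = y.
Proof. by apply/funext => i; rewrite /pt_right /pt_pair (unsplitK (inr i)). Qed.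

Lemma comp_left_var i : lft 'X_i = 'X_(lshift m i).
Proof. by rewrite comp_mpolyXU -tnth_nth tnth_mktuple. Qed.

Lemma comp_right_var i : rgt 'X_i = 'X_(rshift m i).
Proof. by rewrite comp_mpolyXU -tnth_nth tnth_mktuple. Qed.

Definition diff_var (i : 'I_m) : {mpoly k[m + m]} := 'X_(lshift m i) - 'X_(rshift m i).

(** Hadamard's lemma: the quotients restrict to the partial derivatives on the diagonal. For
    products, [p(x) q(x) - p(y) q(y) = (p(x) - p(y)) q(x) + p(y) (q(x) - q(y))]. *)
Lemma difference_quotient p : exists G : 'I_m -> {mpoly k[m + m]},
  lft p - rgt p = \sum_i G i * diff_var i /\
  forall v i, pt_left v = pt_right v -> (G i).@[v] = (mderiv i p).@[pt_left v].
Proof.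
elim/mpoly_ind_ring: p => [c|j|p q [G [pE GE]] [H [qE HE]]|p q [G [pE GE]] [H [qE HE]]].
- exists (fun=> 0); split=> [|v i _]; last by rewrite mderivC !meval0.
  by rewrite !comp_mpolyC subrr big1 // => i _; rewrite mul0r.
- exists (fun i => (i == j)%:R); split=> [|v i _].
    rewrite comp_left_var comp_right_var (bigD1 j) //= eqxx mul1r big1 ?addr0 //.
    by move=> i /negPf ->; rewrite mul0r.
  rewrite mderivX mnm1E eq_sym; have [->|_] := eqVneq i j; last by rewrite scale0r !meval0.
  by rewrite scale1r submm mpolyX0 !meval1.
- exists (fun i => G i + H i); split=> [|v i vE]; last by rewrite mevalD mderivD mevalD GE ?HE.
  rewrite !rmorphD /= opprD addrACA pE qE -big_split.
  by apply: eq_bigr => i _; rewrite mulrDl.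
- exists (fun i => G i * lft q + rgt p * H i).
  split=> [|v i vE].
    rewrite !rmorphM /=.
    transitivity ((lft p - rgt p) * lft q + rgt p * (lft q - rgt q)); first by ring.
    rewrite pE qE [X in X + _]mulr_suml [X in _ + X]mulr_sumr -big_split.
    by apply: eq_bigr => i _ /=; ring.
  by rewrite mevalD !mevalM mderivM mevalD !mevalM GE // HE // meval_left meval_right -vE.
Qed.

End TwoCopies.

Notation left_copy := (comp_mpoly (vars_left _ _)).
Notation right_copy := (comp_mpoly (vars_right _ _)).

Definition product_ideal (k : comNzRingType) n (f : {mpoly k[n]}) : set {mpoly k[(n + n)%N]} :=
  ideal_add (principal (left_copy f)) (principal (right_copy f)).

(** * The product of a chart with itself *)

Section ChartDescent.
Variables (k : closedFieldType) (n : nat) (f a : {mpoly k[n]}) (c d : nat).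
Variables (g : 'I_c -> {mpoly k[(c + d)%N]}) (xt : n.-tuple {mpoly k[(c + d)%N]}).
Hypothesis k_uncountable : ~ countable [set: k].
Hypothesis chartP : chart f a g xt.
Notation N := (c + d)%N.
Implicit Types (v : 'I_(N + N) -> k).

Let vars_pair : (n + n).-tuple {mpoly k[(N + N)%N]} :=
  [tuple match fintype.split i with inl j => left_copy (tnth xt j) | inr j =>
    right_copy (tnth xt j) end | i < n + n].

Definition pair_map : {rmorphism {mpoly k[(n + n)%N]} -> {mpoly k[(N + N)%N]}} :=
  comp_mpoly vars_pair.

Definition pair_point v := pt_pair (chart_map xt (pt_left v)) (chart_map xt (pt_right v)).
Definition on_chart2 v : Prop := on_chart a g xt (pt_left v) /\ on_chart a g xt (pt_right v).
Definition vanishing2 : set {mpoly k[(N + N)%N]} := [set p | forall v, on_chart2 v -> p.@[v] = 0].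
Definition chart_denom : {mpoly k[(n + n)%N]} := left_copy a * right_copy a.

Lemma meval_pair_map p v : (pair_map p).@[v] = p.@[pair_point v].
Proof.
rewrite comp_mpoly_meval; apply: meval_eq => i; rewrite tnth_mktuple /pair_point /pt_pair.
by case: (fintype.split i) => j; rewrite ?meval_left ?meval_right.
Qed.

Lemma pair_map_diff i : pair_map (diff_var k i) = left_copy (tnth xt i) - right_copy (tnth xt i).
Proof.
rewrite rmorphB /= !comp_mpolyXU -!tnth_nth !tnth_mktuple.
by rewrite (unsplitK (inl i)) (unsplitK (inr i)).
Qed.

Lemma meval_denom v : (pair_map chart_denom).@[v] =
  a.@[chart_map xt (pt_left v)] * a.@[chart_map xt (pt_right v)].
Proof.
by rewrite meval_pair_map mevalM meval_left meval_right pt_left_pair pt_right_pair.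
Qed.

Lemma is_ideal_vanishing2 : is_ideal vanishing2.
Proof.
split=> [v _|p q Ip Iq v vc|p q Iq v vc]; first by rewrite meval0.
  by rewrite mevalD Ip ?Iq ?addr0.
by rewrite mevalM Iq ?mulr0.
Qed.

Lemma is_ideal_product : is_ideal (product_ideal f).
Proof. by apply: is_ideal_add; exact: is_ideal_principal. Qed.

(** Multiplying an integral equation by powers of [s] raises its degree; a single degree then serves
    all coordinates. *)
Lemma chart_integral_ge s : exists r, forall D, (r <= D)%N ->
  exists M (al : 'I_D -> {mpoly k[n]}), forall z, on_chart a g xt z ->
    a.@[chart_map xt z] ^+ M * s.@[z] ^+ D = \sum_(j < D) (al j).@[chart_map xt z] * s.@[z] ^+ j.
Proof.
have [M [r [al alE]]] := chart_integral chartP s; exists r => D rD.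
exists M; rewrite -(subnK rD); elim: (D - r)%N => [|e [be beE]]; first by exists al.
exists (fun j => if unlift ord0 j is Some i then be i else 0) => z zc.
rewrite [s.@[z] ^+ (_ + _)](exprSr s.@[z] (e + r)) mulrA beE // big_ord_recl unlift_none meval0
  mul0r add0r mulr_suml.
by apply: eq_bigr => j _; rewrite liftK /= -mulrA -exprSr.
Qed.

(** The generators are the monomials with all exponents below [D]. Multiplied by a variable, such a
    monomial is again one of them or contains a power [X_l ^+ D], which an integral equation
    rewrites. *)
Lemma chart_finite : exists r (m : nat -> {mpoly k[(N + N)%N]}), forall s,
  exists M (b : nat -> {mpoly k[(n + n)%N]}),
  vanishing2 (pair_map (chart_denom ^+ M) * s - \sum_(i < r) pair_map (b i) * m i).
Proof.
have /choice[r rP] i := chart_integral_ge ('X_i : {mpoly k[N]}).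
pose D := (\sum_i r i).+1.
have rD i : (r i <= D)%N by rewrite /D (bigD1 i) //= -addnS leq_addr.
have rel (l : 'I_(N + N)) : exists M (be : 'I_D -> {mpoly k[(n + n)%N]}),
    vanishing2 (pair_map (chart_denom ^+ M) * 'X_l ^+ D - \sum_(j < D) pair_map (be j) * 'X_l ^+ j).
  rewrite -(splitK l); case: (fintype.split l) => i /=.
    have [M [al alE]] := rP i D (rD i).
    (* The factor from the second copy completes [a(x) ^+ M] to the power [M] of the denominator
       [a(x) a(y)]. *)
    exists M, (fun j => left_copy (al j) * right_copy a ^+ M) => v [vL vR].
    rewrite mevalB mevalM [X in _ - X](raddf_sum (meval v)) rmorphXn /= [X in X *
      _]rmorphXn /= meval_denom rmorphXn /= mevalXU.
    apply/eqP; rewrite subr_eq0; apply/eqP.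
    have := alE _ vL; rewrite mevalXU => E.
    transitivity (a.@[chart_map xt (pt_left v)] ^+ M * pt_left v i ^+ D *
      a.@[chart_map xt (pt_right v)] ^+ M); first by rewrite exprMn mulrAC.
    rewrite E.
    rewrite mulr_suml; apply: eq_bigr => j _.
    rewrite mevalM meval_pair_map mevalM meval_left rmorphXn /= meval_right pt_left_pair
      pt_right_pair.
    by rewrite rmorphXn /= mevalXU /pt_left; ring.
  have [M [al alE]] := rP i D (rD i).
  exists M, (fun j => right_copy (al j) * left_copy a ^+ M) => v [vL vR].
  rewrite mevalB mevalM [X in _ - X](raddf_sum (meval v)) rmorphXn /= [X in X *
    _]rmorphXn /= meval_denom rmorphXn /= mevalXU.
  apply/eqP; rewrite subr_eq0; apply/eqP.
  have := alE _ vR; rewrite mevalXU => E.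
  transitivity (a.@[chart_map xt (pt_left v)] ^+ M *
    (a.@[chart_map xt (pt_right v)] ^+ M * pt_right v i ^+ D)); first by rewrite exprMn mulrA.
  rewrite E.
  rewrite mulr_sumr; apply: eq_bigr => j _.
  rewrite mevalM meval_pair_map mevalM meval_right rmorphXn /= meval_left pt_left_pair
    pt_right_pair.
  by rewrite rmorphXn /= mevalXU /pt_right; ring.
have pmC e : pair_map e%:MP = e%:MP by exact: comp_mpolyC.
move: pair_map pmC rel => pair_map pmC rel.
pose F := {ffun 'I_(N + N) -> 'I_D}.
pose mon (phi : F) : {mpoly k[(N + N)%N]} := 'X_[[multinom (phi i : nat) | i < N + N]].
pose Sp s := exists M (b : F -> {mpoly k[(n + n)%N]}),
  vanishing2 (pair_map (chart_denom ^+ M) * s - \sum_phi pair_map (b phi) * mon phi).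
have idV := is_ideal_vanishing2.
have SpM x s : Sp s -> Sp (pair_map x * s).
  move=> [M [b Vb]]; exists M, (fun phi => x * b phi).
  rewrite (_ : _ - _ = pair_map x * (pair_map (chart_denom ^+ M) *
    s - \sum_phi pair_map (b phi) * mon phi)).
    exact: (ideal_mull idV).
  rewrite mulrBr mulr_sumr; congr (_ - _); first by ring.
  by apply: eq_bigr => phi _; rewrite rmorphM mulrA.
have SpD s s' : Sp s -> Sp s' -> Sp (s + s').
  move=> [M [b Vb]] [M' [b' Vb']].
  exists (M + M')%N, (fun phi => chart_denom ^+ M' * b phi + chart_denom ^+ M * b' phi).
  rewrite (_ : _ - _ = pair_map (chart_denom ^+ M') * (pair_map (chart_denom ^+ M) *
    s - \sum_phi pair_map (b phi) * mon phi) +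
     pair_map (chart_denom ^+ M) * (pair_map (chart_denom ^+ M') *
       s' - \sum_phi pair_map (b' phi) * mon phi)).
    by apply: (idealD idV) => //; exact: (ideal_mull idV).
  rewrite exprD !mulrBr !mulr_sumr addrACA -opprD -big_split; congr (_ - _);
    first by rewrite rmorphM; ring.
  by apply: eq_bigr => phi _ /=; rewrite rmorphD !rmorphM; ring.
have Sp0 : Sp 0.
  exists 0%N, (fun=> 0); rewrite mulr0 sub0r big1 ?oppr0; first exact: (ideal0 idV).
  by move=> phi _; rewrite rmorph0 mul0r.
have Sp_sum (J : Type) (u : seq J) (G : J -> {mpoly k[(N + N)%N]}) : (forall i,
  Sp (G i)) -> Sp (\sum_(i <- u) G i).
  by move=> SG; elim/big_ind: _ => // x y; exact: SpD.
have SpV s s' : vanishing2 (s - s') -> Sp s' -> Sp s.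
  move=> Vs [M [b Vb]]; exists M, b; rewrite (_ : _ - _ = pair_map (chart_denom ^+ M) * (s - s') +
    (pair_map (chart_denom ^+ M) * s' - \sum_phi pair_map (b phi) * mon phi)); last by ring.
  by apply: (idealD idV) => //; exact: (ideal_mull idV).
have SpK M s : Sp (pair_map (chart_denom ^+ M) * s) -> Sp s.
  move=> [M' [b Vb]]; exists (M' + M)%N, b; move: Vb.
  by rewrite exprD rmorphM mulrA.
have Sp_mon phi : Sp (mon phi).
  exists 0%N, (fun psi => (psi == phi)%:R); rewrite expr0 rmorph1 mul1r (bigD1 phi) //= eqxx
    rmorph1 mul1r.
  rewrite big1 ?addr0 ?subrr; first exact: (ideal0 idV).
  by move=> psi /negPf ->; rewrite rmorph0 mul0r.
pose upd (phi : F) l (j : 'I_D) : F := [ffun i => if i == l then j else phi i].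
have mon_upd phi l (j : 'I_D) : mon (upd phi l j) = 'X_l ^+ j * mon (upd phi l ord0).
  rewrite mpolyXn -mpolyXD; congr 'X_[_]; apply/mnmP => i.
  rewrite mnmDE mulmnE mnm1E !mnmE !ffunE eq_sym; case: eqP => _; last by rewrite mul0n.
  by rewrite mul1n addn0.
have Sp_Xmon l phi : Sp ('X_l * mon phi).
  have phiE : phi = upd phi l (phi l) by apply/ffunP => i; rewrite ffunE; case: eqP => [->|].
  rewrite phiE mon_upd mulrA -exprS.
  have [lt|] := ltnP (phi l).+1 D; first by rewrite -(mon_upd phi l (Ordinal lt)).
  move=> geD; have -> : (phi l).+1 = D by apply/eqP; rewrite eqn_leq geD ltn_ord.
  have [M [be Vbe]] := rel l; apply: (SpK M).
  apply: (SpV _ (\sum_(j < D) pair_map (be j) * mon (upd phi l j))).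
    rewrite (_ : _ - _ = (pair_map (chart_denom ^+ M) *
      'X_l ^+ D - \sum_(j < D) pair_map (be j) * 'X_l ^+ j) * mon (upd phi l ord0)).
      exact: (ideal_mulr idV).
    rewrite mulrBl mulr_suml mulrA; congr (_ - _); apply: eq_bigr => j _.
    by rewrite mon_upd mulrA.
  by apply: Sp_sum => j; exact: SpM.
have Sp_X l s : Sp s -> Sp ('X_l * s).
  move=> [M [b Vb]]; apply: (SpK M); apply: (SpV _ (\sum_phi pair_map (b phi) * ('X_l * mon phi))).
    rewrite (_ : _ - _ = 'X_l * (pair_map (chart_denom ^+ M) * s - \sum_phi pair_map (b phi) *
      mon phi)).
      exact: (ideal_mull idV).
    rewrite mulrBr mulr_sumr; congr (_ - _); first by ring.
    by apply: eq_bigr => phi _; ring.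
  by apply: Sp_sum => phi; apply: SpM.
have Sp_all p : forall s, Sp s -> Sp (p * s).
  elim/mpoly_ind_ring: p => [e|i|p q IHp IHq|p q IHp IHq] s Ss.
  - by rewrite -pmC; exact: SpM.
  - exact: Sp_X.
  - by rewrite mulrDl; apply: (SpD); [exact: IHp | exact: IHq].
  - by rewrite -mulrA; apply: IHp; exact: IHq.
have D0 : (0 < D)%N by [].
pose phi0 : F := [ffun=> Ordinal D0].
have Sp1 : Sp 1.
  rewrite (_ : 1 = mon phi0) // -mpolyX0; congr 'X_[_].
  by apply/mnmP => i; rewrite mnm0E mnmE ffunE.
exists #|F|, (fun i => mon (nth phi0 (enum F) i)) => s.
have [M [b Vb]] := Sp_all s 1 Sp1; exists M, (fun i => b (nth phi0 (enum F) i)).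
by rewrite mulr1 -big_enum (big_nth phi0) big_mkord -cardE in Vb.
Qed.

End ChartDescent.

Section ChartVanishing.
Variables (k : closedFieldType) (n : nat) (f a : {mpoly k[n]}) (c d : nat).
Variables (g : 'I_c -> {mpoly k[(c + d)%N]}) (xt : n.-tuple {mpoly k[(c + d)%N]}).
Hypothesis k_uncountable : ~ countable [set: k].
Hypothesis char0 : [pchar k] =i pred0.
Hypothesis f_neq0 : f != 0.
Hypothesis chartP : chart f a g xt.
Notation N := (c + d)%N.
Implicit Types (v : 'I_(N + N) -> k).

Notation rho := (pair_map xt).
Notation denom := (rho (chart_denom a)).
Notation tau i := (rho (diff_var k i)).
Notation IB := (vanishing2 a g xt).

Let idIB : is_ideal IB := is_ideal_vanishing2 a g xt.

(** If [x] is not in [q], some zero of [q] avoids the zeros of [chart_denom a * x]. Both halves of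
    that point lift to the chart by surjectivity, and evaluating the relation at the lift makes [x]
    vanish there. *)
Lemma chart_contract_prime q : prime_ideal q -> product_ideal f `<=` q -> ~ q (chart_denom a) ->
  forall x, ideal_add IB (extension rho q) (rho x) -> q x.
Proof.
move=> primeq fq nqe x [p [_ [Ip [l [b [y [qy ->]]]] xE]]]; have idq := prime_is_ideal primeq.
have [_ _ _ _ qM] := primeq.
apply: contrapT => nqx.
have [v vq vn0] : exists2 v, forall p, q p -> p.@[v] = 0 & (chart_denom a * x).@[v] != 0.
  apply: contrapT => nex.
  have [|m] := @nullstellensatz k _ k_uncountable q (chart_denom a * x) idq.
    move=> v vq; apply/eqP/negP => /negP vn0; apply: nex; by exists v.
  by move=> /(prime_expr primeq)/qM[].
have fl : f.@[pt_left v] = 0.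
  rewrite -meval_left; apply/vq/fq; apply: (ideal_addl (is_ideal_principal _)).
  by exists 1; rewrite mul1r.
have fr : f.@[pt_right v] = 0.
  rewrite -meval_right; apply/vq/fq; apply: (ideal_addr (is_ideal_principal _)).
  by exists 1; rewrite mul1r.
move: vn0; rewrite !mevalM meval_left meval_right !mulf_eq0 !negb_or => /andP[/andP[al ar] xn0].
have [z zc zE] := chart_surjective chartP fl al; have [z' zc' zE'] := chart_surjective chartP fr ar.
have PE : pair_point xt (pt_pair z z') = v.
  rewrite /pair_point pt_left_pair pt_right_pair zE zE'; apply/funext => i.
  by rewrite /pt_pair -{2}(splitK i); case: (fintype.split i).
have := congr1 (meval (pt_pair z z')) xE.
rewrite mevalD Ip ?add0r; last by split; rewrite ?pt_left_pair ?pt_right_pair.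
rewrite meval_pair_map PE [RHS](raddf_sum (meval (pt_pair z z'))) big1 => [/eqP|i _].
  by rewrite (negPf xn0).
by rewrite /= mevalM meval_pair_map PE (vq _ (qy i)) mulr0.
Qed.

(* Off the locus [delta = 0], which does not meet the diagonal, the diagonal of the
   smooth variety is cut out by the differences of its last [d] coordinates. *)
Lemma chart_diagonal : exists (delta : {mpoly k[(N + N)%N]}),
  (forall v, on_zeros g (pt_left v) -> pt_left v = pt_right v -> delta.@[v] != 0) /\
  forall l, exists b : 'I_d -> {mpoly k[(N + N)%N]},
    IB (delta * diff_var k l - \sum_j b j * diff_var k (rshift c j)).
Proof.
have /choice[G GP] j := difference_quotient (g j).
(* On the diagonal this matrix of difference quotients is the Jacobian matrix of the chart. *)
pose GM := \matrix_(i < c, j < c) G j (lshift d i).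
exists (\det GM); split.
  move=> v vz vE; rewrite -det_map_mx; have := chart_jacobian chartP vz.
  rewrite -det_map_mx (_ : map_mx _ _ = map_mx (meval v) GM) //.
  by apply/matrixP => i j; rewrite !mxE (GP j).2.
move=> l; rewrite -(splitK l); case: (fintype.split l) => i /=; last first.
  exists (fun j => (j == i)%:R * \det GM); rewrite (bigD1 i) //= eqxx mul1r big1 ?addr0 ?subrr.
    exact: (ideal0 idIB).
  by move=> j /negPf ->; rewrite !mul0r.
pose zeta : 'rV_c := \row_i diff_var k (lshift d i).
pose S j := left_copy (g j) - right_copy (g j).
pose U j := \sum_(l < d) G j (rshift c l) * diff_var k (rshift c l).
have zG : zeta *m GM = \row_j (S j - U j).
  apply/rowP => j; rewrite !mxE /S (GP j).1 big_split_ord /= addrK.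
  by apply: eq_bigr => i' _; rewrite !mxE mulrC.
(* Cramer's rule for the first [c] differences; the terms [S j] vanish on pairs of chart points. *)
have zd : \det GM * diff_var k (lshift d i) = \sum_j (S j - U j) * \adj GM j i.
  have := congr1 (fun A => (A *m \adj GM) 0 i) zG.
  rewrite -mulmxA mul_mx_adj mul_mx_scalar !mxE => ->.
  by apply: eq_bigr => j _; rewrite mxE.
exists (fun l => - \sum_j G j (rshift c l) * \adj GM j i).
rewrite zd (_ : _ - _ = \sum_j \adj GM j i * S j).
  apply: (ideal_sum idIB) => j _; apply: (ideal_mull idIB) => v [[vl _] [vr _]].
  by rewrite /S mevalB meval_left meval_right vl vr subrr.
have UE : \sum_j U j * \adj GM j i =
    \sum_(l < d) (\sum_j G j (rshift c l) * \adj GM j i) * diff_var k (rshift c l).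
  under eq_bigr do rewrite /U mulr_suml.
  rewrite exchange_big; apply: eq_bigr => l' _; rewrite mulr_suml.
  by apply: eq_bigr => j _; rewrite mulrAC.
rewrite (eq_bigr (fun j => \adj GM j i * S j - U j * \adj GM j i)); last by move=> j _; ring.
by rewrite sumrB UE -addrA -opprD -big_split /= [X in _ - X]big1 ?subr0 // => l' _;
  rewrite mulNr subrr.
Qed.

Lemma chart_injective2 v : on_chart2 a g xt v ->
  (forall i, (tau i).@[v] = 0) -> pt_left v = pt_right v.
Proof.
move=> [vL vR] tau0; apply: (chart_injective chartP) => //; apply/funext => i.
have := tau0 i; rewrite pair_map_diff mevalB meval_left meval_right => /eqP.
by rewrite subr_eq0 => /eqP.
Qed.

Lemma vanishing2_point v : (forall p, IB p -> p.@[v] = 0) -> denom.@[v] != 0 -> on_chart2 a g xt v.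
Proof.
move=> IBv; rewrite meval_denom mulf_eq0 negb_or => /andP[al ar].
split; split=> // j.
  by rewrite -meval_left; apply: IBv => w [[wl _] _]; rewrite meval_left wl.
by rewrite -meval_right; apply: IBv => w [_ [wr _]]; rewrite meval_right wr.
Qed.

Lemma two_neq0 (K : fieldType) (m : nat) (pi : {rmorphism {mpoly k[m]} -> K}) : 2%:R != 0 :> K.
Proof.
have k2 : 2%:R != 0 :> k by move/pcharf0P: char0 => ->.
apply/eqP => K2; have := oner_neq0 K.
rewrite -[1](rmorph1 pi) -mpolyC1 -(mulVf k2) mpolyCM rmorphM mpolyC_nat rmorph_nat K2 mulr0.
by rewrite eqxx.
Qed.

(** In the residue field of [q], with [denom * delta] inverted, the [n] elements [tau i] and the [d]
    elements [u j] generate ideals with the same radical: the [tau i] are combinations of the [u j]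
    by the description of the diagonal, and powers of the [u j] are combinations of the [tau i] by
    injectivity and the Nullstellensatz. As [d < n], the top Cech cohomology for the [tau i]
    vanishes. *)
Lemma chart_vanishing_at_prime q delta k0 : prime_ideal q -> IB `<=` q -> ~ q denom -> ~ q delta ->
  (forall l, exists b : 'I_d -> {mpoly k[(N + N)%N]},
    IB (delta * diff_var k l - \sum_j b j * diff_var k (rshift c j))) ->
  (d < n)%N ->
  exists M m s, q ((denom * delta) ^+ M * (\prod_i tau i) ^+ m - \sum_i s i * tau i ^+ (k0 + m)).
Proof.
move=> primeq Iq nqe nqd diag dn; have idq := prime_is_ideal primeq.
have [[i0 qi0]|/forallNP tau_n0] := pselect (exists i, q (tau i)).
  exists 0%N, 1%N, (fun=> 0); rewrite expr0 mul1r [X in _ - X]big1 ?subr0 => [|i _];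
    last by rewrite mul0r.
  by rewrite expr1 (bigD1 i0) //=; exact: (ideal_mulr idq).
have [K [pi piE]] := prime_residue_field primeq.
have pin0 x : ~ q x -> pi x != 0 by move=> nqx; apply/eqP => /piE.
have e0 := pin0 _ nqe; have d0 := pin0 _ nqd.
pose u j := diff_var k (rshift c j) : {mpoly k[(N + N)%N]}.
have u_rad j : exists M s, q ((denom * u j) ^+ M - \sum_i s i * tau i).
  have idJ : is_ideal (ideal_add q (span_of (fun i => tau i))).
    by apply: is_ideal_add => //; exact: is_ideal_span.
  have [|M [x [_ [qx [s ->] sE]]]] := @nullstellensatz k _ k_uncountable _ (denom * u j) idJ.
    move=> v Jv; apply/eqP; rewrite mevalM mulf_eq0; apply/orP.
    have [|en0] := eqVneq denom.@[v] 0; [by left | right].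
    have vc : on_chart2 a g xt v.
      apply: vanishing2_point => // p /Iq qp; apply: Jv.
      by apply: (ideal_addl (is_ideal_span _)).
    have /(congr1 (@^~ (rshift c j))) vE : pt_left v = pt_right v.
      apply: chart_injective2 => // i; apply: Jv; apply: (ideal_addr idq).
      exact: (span_mem (fun i => tau i)).
    by rewrite mevalB !mevalXU; move: vE; rewrite /pt_left /pt_right => ->; rewrite subrr.
  by exists M, s; rewrite sE addrK.
pose O := frac_over [set y | exists x, y = pi x] (pi (denom * delta)).
have ringP : is_subring [set y | exists x, y = pi x].
  split; first by exists 1; rewrite rmorph1.
    by move=> _ _ [x ->] [y ->]; exists (x - y); rewrite rmorphB.
  by move=> _ _ [x ->] [y ->]; exists (x * y); rewrite rmorphM.
have ringO : is_subring O by apply: is_subring_frac => //; exists (denom * delta).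
have Opi x : O (pi x) by apply: frac_over_sub; exists x.
have edE : pi (denom * delta) = pi denom * pi delta by rewrite rmorphM.
have OVe : O (pi denom)^-1.
  by exists 1%N, delta; rewrite expr1 edE mulrC mulKf.
have OVd : O (pi delta)^-1.
  by exists 1%N, denom; rewrite expr1 edE mulfK.
pose w (i : 'I_(n + d)) := match fintype.split i with inl j => pi (tau j) | inr j => pi (u j) end.
have wl j : w (lshift d j) = pi (tau j) by rewrite /w (unsplitK (inl j)).
have wr j : w (rshift n j) = pi (u j) by rewrite /w (unsplitK (inr j)).
have Ow i : O (w i) by rewrite /w; case: (fintype.split i).
pose L : {set 'I_(n + d)} := [set lshift d j | j : 'I_n].
(* The [u j] that become zero in [K] are left out, as every element of the Cech covering must be
   nonzero; sums of multiples of the [u j] do not change. *)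
pose R : {set 'I_(n + d)} := [set rshift n j | j : 'I_d & pi (u j) != 0].
have LR i : i \in L -> i \notin R.
  move=> /imsetP[j _ ->]; apply/imsetP => -[j' _ /eqP]; by rewrite eq_lrshift.
have sumL (F : 'I_(n + d) -> K) : \sum_(i in L) F i = \sum_j F (lshift d j).
  by rewrite big_imset //= => x y _ _; exact: lshift_inj.
have prodL (F : 'I_(n + d) -> K) : \prod_(i in L) F i = \prod_j F (lshift d j).
  by rewrite big_imset //= => x y _ _; exact: lshift_inj.
have sumR (F : 'I_d -> K) : \sum_(i in R) (match fintype.split i with inl _ => 0 | inr j =>
  F j end) * w i =
    \sum_j F j * pi (u j).
  rewrite big_imset /=; last by move=> x y _ _; exact: rshift_inj.
  rewrite [RHS](bigID (fun j => pi (u j) != 0)) /= [X in _ + X]big1 ?addr0; last first.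
    by move=> j; rewrite negbK => /eqP ->; rewrite mulr0.
  apply: eq_big => [j|j _]; first by rewrite inE.
  by rewrite (unsplitK (inr j)) wr.
have powR : power_in_span O w L R.
  move=> l /imsetP[j]; rewrite inE => uj ->; rewrite wr; split=> //.
  have [M [s sE]] := u_rad j.
  exists M, (fun i => match fintype.split i with inl i =>
    pi (s i) * (pi denom)^-1 ^+ M | inr _ => 0 end); split.
    move=> i; case: (fintype.split i) => i'; last exact: subring0.
    by apply: subringM => //; exact: subringX.
  rewrite sumL; under eq_bigr do rewrite (unsplitK (inl _)) wl mulrAC.
  rewrite -mulr_suml exprVn; apply: (canRL (mulfK _)); first by rewrite expf_neq0.
  move/piE: sE; rewrite rmorphB => /eqP; rewrite subr_eq0 rmorphXn rmorphM exprMn mulrC => /eqP ->.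
  by rewrite rmorph_sum; apply: eq_bigr => i _; rewrite rmorphM.
have powL : power_in_span O w R L.
  move=> i0 /imsetP[i _ ->]; rewrite wl; split; first exact: pin0.
  have [G [GE _]] := difference_quotient (tnth xt i).
  have /choice[b bE] := diag.
  exists 1%N, (fun i' => match fintype.split i' with inl _ => 0 | inr j =>
    pi (\sum_l G l * b l j) * (pi delta)^-1 end); split.
    move=> i'; case: (fintype.split i') => j; first exact: subring0.
    exact: subringM.
  rewrite expr1 (sumR (fun j => pi (\sum_l G l * b l j) * (pi delta)^-1)).
  under eq_bigr do rewrite mulrAC.
  rewrite -mulr_suml; apply: (canRL (mulfK _)) => //.
  have -> : \sum_j pi (\sum_l G l * b l j) * pi (u j) = pi (\sum_j (\sum_l G l * b l j) * u j).
    by rewrite rmorph_sum; apply: eq_bigr => j _; rewrite rmorphM.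
  apply/eqP; rewrite -rmorphM -subr_eq0 -rmorphB; apply/eqP/piE/Iq.
  rewrite pair_map_diff GE mulr_suml.
  have -> : \sum_j (\sum_l G l * b l j) * u j = \sum_l G l * \sum_j b l j * u j.
    under eq_bigr do rewrite mulr_suml.
    rewrite exchange_big; apply: eq_bigr => l _; rewrite mulr_sumr.
    by apply: eq_bigr => j _; rewrite mulrA.
  rewrite -sumrB; apply: (ideal_sum idIB) => l _.
  rewrite (_ : _ - _ = G l * (delta * diff_var k l - \sum_j b l j * u j)); last by ring.
  exact: (ideal_mull idIB).
have lt : (#|R| < #|L|)%N.
  rewrite /L (card_imset _ (@lshift_inj n d)) card_ord.
  apply: leq_ltn_trans dn; rewrite /R (card_imset _ (@rshift_inj n d)).
  by rewrite -[X in (_ <= X)%N](card_ord d) max_card.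
have [m [s [Os sE]]] := cech_top_vanishing ringO Ow LR powR powL (two_neq0 pi) lt k0.
have [M [_ MO]] := common_exponent ringP 0 (fun _ : 'I_(n +
  d) => ex_intro _ (denom * delta) erefl) Os.
have /choice[x xE] i := MO i.
exists M, m, (fun i => x (lshift d i)); apply/piE.
rewrite rmorphB rmorphM !rmorphXn rmorph_prod -(eq_bigr _ (fun i _ => wl i)) -prodL sE.
rewrite sumL mulr_sumr rmorph_sum -sumrB big1 // => i _.
by rewrite mulrA xE rmorphM rmorphXn -wl subrr.
Qed.

(** After descent to the chart, a power of [denom * delta] kills the class. So does each
    [tau i ^+ k0], so a zero of the annihilator with [denom] nonzero would lie on the diagonal,
    where [delta] does not vanish. Hence by the Nullstellensatz a power of [denom] alone
    suffices. *)
Lemma chart_top_vanishing : top_vanishing (fun i => diff_var k i) (chart_denom a) (product_ideal f).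
Proof.
have [r [m mE]] := chart_finite chartP.
apply: (@top_vanishing_descent _ _ rho _ _ _ _ IB _ _ idIB r m) => //.
- exact: mpoly_noetherian.
- exact: is_ideal_product.
- by move=> q primeq fq nqe x; exact: chart_contract_prime.
apply: top_vanishing_prime_ind => //; first exact: mpoly_noetherian.
move=> q primeq Iq nqe _ k0; have idq := prime_is_ideal primeq.
have [delta [deltaP diag]] := chart_diagonal.
have pointE (J : set {mpoly k[(N + N)%N]}) : is_ideal J -> q `<=` J -> (forall M,
  ~ J (denom ^+ M)) ->
    exists v, [/\ forall p, J p -> p.@[v] = 0, denom.@[v] != 0 & on_chart2 a g xt v].
  move=> idJ qJ nJ; apply: contrapT => nex.
  have [|M] := @nullstellensatz k _ k_uncountable J denom idJ; last exact: nJ.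
  move=> v Jv; apply/eqP/negP => /negP en0; apply: nex; exists v; split=> //.
  by apply: vanishing2_point => // p Ip; apply/Jv/qJ/Iq.
have dn : (d < n)%N.
  apply: (chart_dim char0 chartP f_neq0).
  have [//|M /(prime_expr primeq)|v [_ _ [vl _]]] := pointE q idq; first exact.
  by exists (pt_left v).
pose J := cleared (fun i => tau i) q k0.
have idJ : is_ideal J by exact: is_ideal_cleared.
suff [M [m1 [s1 q1]]] : exists M, J (denom ^+ M) by exists m1, M, s1.
apply: contrapT => /forallNP nJ.
have qJ : q `<=` J by exact: cleared_sub.
have [v [Jv en0 vc]] := pointE J idJ qJ nJ.
have vE : pt_left v = pt_right v.
  apply: chart_injective2 => // i; have : (tau i ^+ k0).@[v] = 0.
    by apply: Jv; exact: (cleared_pow (fun i => tau i)).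
  by rewrite rmorphXn /= => /eqP; rewrite expf_eq0 => /andP[_ /eqP].
have dv := deltaP v (proj1 (proj1 vc)) vE.
have [M [m1 [s1 q1]]] : exists M, J ((denom * delta) ^+ M).
  have [qd|nqd] := pselect (q delta).
    by exists 1%N; apply: qJ; rewrite expr1; exact: (ideal_mull idq).
  exact: chart_vanishing_at_prime.
have : ((denom * delta) ^+ M).@[v] = 0 by apply: Jv; exists m1, s1.
rewrite rmorphXn /= => /eqP; rewrite expf_eq0 mevalM mulf_eq0 => /andP[_].
by rewrite (negPf en0) (negPf dv).
Qed.

End ChartVanishing.

(** The annihilator of the class has no zero: such a zero would be a diagonal point of [X * X], and
    the chart around it provides a power of [a(x) a(y)] in the annihilator that does not vanish
    there. *)
Lemma hypersurface_top_vanishing (k : closedFieldType) n (f : {mpoly k[n]}) :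
  ~ countable [set: k] -> [pchar k] =i pred0 -> f != 0 ->
  (forall x, f.@[x] = 0 -> exists a c d (g : 'I_c -> {mpoly k[(c + d)%N]}) xt,
     chart f a g xt /\ a.@[x] != 0) ->
  forall k0, cleared (diff_var k (m := n)) (product_ideal f) k0 1.
Proof.
move=> kunc char0 f0 charts k0; set J := cleared _ _ _.
have idP := is_ideal_product f; have idJ : is_ideal J by exact: is_ideal_cleared.
have [|M] := @nullstellensatz k _ kunc J 1 idJ; last by rewrite expr1n.
move=> v Jv.
have Pv p : product_ideal f p -> p.@[v] = 0 by move=> Pp; apply: Jv; exact: cleared_sub.
have vE : pt_left v = pt_right v.
  apply/funext => i; have : (diff_var k i ^+ k0).@[v] = 0.
    by apply: Jv; exact: (cleared_pow (diff_var k (m := n))).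
  rewrite rmorphXn /= => /eqP; rewrite expf_eq0 mevalB !mevalXU subr_eq0.
  by move=> /andP[_ /eqP].
have fv : f.@[pt_left v] = 0.
  rewrite -meval_left; apply: Pv; apply: (ideal_addl (is_ideal_principal _)).
  by exists 1; rewrite mul1r.
have [a [c [d [g [xt [chartP av]]]]]] := charts _ fv.
have [m [M [s sE]]] := chart_top_vanishing kunc char0 f0 chartP k0.
have : (chart_denom a ^+ M).@[v] = 0 by apply: Jv; exists m, s.
rewrite rmorphXn /= => /eqP; rewrite expf_eq0 => /andP[_].
by rewrite mevalM meval_left meval_right -vE mulf_eq0 (negPf av).
Qed.

(** * Operators as bimodule elements *)

Section DifferentialOperators.
Variables (k : fieldType) (n : nat).
Hypothesis char0 : [pchar k] =i pred0.
Notation P2 := {mpoly k[(n + n)%N]}.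
Implicit Types (al be ga : 'X_{1..n}) (g x y : {mpoly k[n]}) (h p : P2).

(** The commutator of [d^be] with [x_l] is [be_l] times [d^(be - e_l)]. When [be_l = 0] the
    truncated subtraction is harmless, since its term has coefficient 0. *)
Lemma mderivm_mulX m (l : 'I_m) (be : 'X_{1..m}) (h : {mpoly k[m]}) :
  ('X_l * h)^`M[be] = 'X_l * h^`M[be] + h^`M[be - U_(l)] *+ be l.
Proof.
elim: {be}(mdeg be) {-2}be (erefl (mdeg be)) => [|D IH] be beD.
  move/eqP: beD; rewrite mdeg_eq0 => /eqP ->.
  by rewrite !mderivm0m mnm0E mulr0n addr0.
have [j bej] : exists j, be j != 0%N.
  apply: contrapT => /forallNP be0; move: beD; rewrite (_ : be = 0%MM) ?mdeg0 //.
  by apply/mnmP => j; rewrite mnm0E; apply/eqP/negP => /negP /be0.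
have beE : be = (be - U_(j) + U_(j))%MM by rewrite submK // lep1mP.
move: beE; set be' := (be - U_(j))%MM => beE.
have {}IH : ('X_l * h)^`M[be'] = 'X_l * h^`M[be'] + h^`M[be' - U_(l)] *+ be' l.
  by apply: IH; move: beD; rewrite beE mdegD mdeg1 addn1 => -[].
rewrite beE !(mderivmDm be') IH !mderivmU1m mderivD mderivM mderivMn.
rewrite mderivX mnm1E mnmDE mnm1E.
have [->|lj] := eqVneq l j.
  rewrite scale1r submm mpolyX0 mul1r.
  rewrite addmK addn1 mulrS [RHS]addrCA -addrA; congr (_ + (_ + _)).
  have [->|bj] := eqVneq (be' j) 0%N; first by rewrite !mulr0n.
  by rewrite -mderivmU1m -mderivmDm submK // lep1mP.
rewrite scale0r mul0r add0r addn0; congr (_ + _).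
have [->|bl] := eqVneq (be' l) 0%N; first by rewrite !mulr0n.
by rewrite -mderivmU1m -mderivmDm addmC addmBA ?lep1mP // addmC.
Qed.

Definition right_index ga : 'X_{1..n + n} :=
  [multinom match fintype.split i with inl _ => 0%N | inr j => ga j end | i < n + n].

Definition diagonal : {rmorphism P2 -> {mpoly k[n]}} :=
  comp_mpoly [tuple 'X_(match fintype.split i with inl j => j | inr j => j end) | i < n + n].

(* The action of [p(x, y)] on the operator [d^ga]: the variables [x] multiply on the
   left of the operator and the variables [y] on its right. *)
Definition bi_act ga p g : {mpoly k[n]} := diagonal ((p * right_copy g)^`M[right_index ga]).

Lemma right_indexl ga i : right_index ga (lshift n i) = 0%N.
Proof. by rewrite mnmE (unsplitK (inl i)). Qed.

Lemma right_indexr ga i : right_index ga (rshift n i) = ga i.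
Proof. by rewrite mnmE (unsplitK (inr i)). Qed.

Lemma right_indexB ga i : (right_index ga - U_(rshift n i))%MM = right_index (ga - U_(i))%MM.
Proof.
apply/mnmP => j; rewrite mnmBE mnm1E !mnmE -(splitK j).
case: (fintype.split j) => l; rewrite unsplitK /= ?eq_rlshift ?subn0 //.
by rewrite mnmBE mnm1E eq_rshift.
Qed.

Lemma diagonalXl i : diagonal 'X_(lshift n i) = 'X_i.
Proof. by rewrite /= comp_mpolyXU -tnth_nth tnth_mktuple (unsplitK (inl i)). Qed.

Lemma diagonalXr i : diagonal 'X_(rshift n i) = 'X_i.
Proof. by rewrite /= comp_mpolyXU -tnth_nth tnth_mktuple (unsplitK (inr i)). Qed.

Lemma diagonal_right x : diagonal (right_copy x) = x.
Proof.
elim/mpoly_ind_ring: x => [c|i|x y IHx IHy|x y IHx IHy].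
- by rewrite /= !comp_mpolyC.
- by rewrite comp_right_var diagonalXr.
- by rewrite rmorphD rmorphD IHx IHy.
- by rewrite rmorphM rmorphM IHx IHy.
Qed.

Lemma bi_actXl ga i p g : bi_act ga ('X_(lshift n i) * p) g = 'X_i * bi_act ga p g.
Proof.
rewrite /bi_act -mulrA mderivm_mulX right_indexl mulr0n addr0 rmorphM.
by rewrite diagonalXl.
Qed.

Lemma bi_actXr ga i p g : bi_act ga ('X_(rshift n i) * p) g =
  'X_i * bi_act ga p g + bi_act (ga - U_(i)) p g *+ ga i.
Proof.
rewrite /bi_act -mulrA mderivm_mulX right_indexr right_indexB rmorphD rmorphM rmorphMn.
by rewrite diagonalXr.
Qed.

Lemma bi_actD ga p q g : bi_act ga (p + q) g = bi_act ga p g + bi_act ga q g.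
Proof. by rewrite /bi_act mulrDl mderivmD rmorphD. Qed.

Lemma bi_actC ga c p g : bi_act ga (c%:MP * p) g = c%:MP * bi_act ga p g.
Proof. by rewrite /bi_act -mulrA mderivm_mulC rmorphM /= comp_mpolyC. Qed.

Lemma bi_act_left ga x p g : bi_act ga (left_copy x * p) g = x * bi_act ga p g.
Proof.
elim/mpoly_ind_ring: x p => [c|i|x y IHx IHy|x y IHx IHy] p.
- by rewrite comp_mpolyC bi_actC.
- by rewrite comp_left_var bi_actXl.
- by rewrite rmorphD !mulrDl bi_actD IHx IHy.
- by rewrite rmorphM -!mulrA IHx IHy.
Qed.

Lemma bi_act_right ga x p g : bi_act ga (right_copy x * p) g = bi_act ga p (x * g).
Proof. by rewrite /bi_act rmorphM mulrCA mulrA. Qed.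

Lemma bi_act_diff ga i p g :
  bi_act ga (diff_var k i * p) g = - (bi_act (ga - U_(i)) p g *+ ga i).
Proof.
rewrite /diff_var mulrBl (_ : - (_ * p) = (-1)%:MP * ('X_(rshift n i) * p)); last first.
  by rewrite mpolyCN mpolyC1 mulN1r.
rewrite bi_actD bi_actC bi_actXl bi_actXr mpolyCN mpolyC1 mulN1r opprD addrA subrr.
by rewrite add0r.
Qed.

Lemma bi_act_pow ga i e p g : (ga i < e)%N -> bi_act ga (diff_var k i ^+ e * p) g = 0.
Proof.
elim: e ga p => // e IH ga p; rewrite ltnS exprS -mulrA bi_act_diff.
have [->|gi] := eqVneq (ga i) 0%N; first by rewrite mulr0n oppr0.
move=> ge; rewrite IH ?mul0rn ?oppr0 // mnmBE mnm1E eqxx subn1.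
by rewrite prednK ?lt0n.
Qed.

(** Here [C] is [(-1)^|be|] times the product of the falling factorials [(ga_i + be_i)! / ga_i!],
    hence nonzero in characteristic 0. *)
Lemma bi_act_monomial ga be : exists2 C : k, C != 0 & forall p g,
  bi_act (ga + be) (\prod_i diff_var k i ^+ be i * p) g = C%:MP * bi_act ga p g.
Proof.
elim: {be}(mdeg be) {-2}be (erefl (mdeg be)) => [|D IH] be beD.
  move/eqP: beD; rewrite mdeg_eq0 => /eqP ->.
  exists 1; rewrite ?oner_neq0 // => p g; rewrite addm0 mpolyC1 mul1r big1 ?mul1r // => i _.
  by rewrite mnm0E expr0.
have [j bej] : exists j, be j != 0%N.
  apply: contrapT => /forallNP be0; move: beD; rewrite (_ : be = 0%MM) ?mdeg0 //.
  by apply/mnmP => j; rewrite mnm0E; apply/eqP/negP => /negP /be0.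
have beE : be = (be - U_(j) + U_(j))%MM by rewrite submK // lep1mP.
move: beE; set be' := (be - U_(j))%MM => beE.
have [C C0 CE] : exists2 C : k, C != 0 & forall p g,
    bi_act (ga + be') (\prod_i diff_var k i ^+ be' i * p) g = C%:MP * bi_act ga p g.
  by apply: IH; move: beD; rewrite beE mdegD mdeg1 addn1 => -[].
exists (- (C *+ (ga + be)%MM j)).
  rewrite oppr_eq0 -mulr_natr mulf_neq0 //; move/pcharf0P: char0 => ->.
  by rewrite mnmDE -lt0n addn_gt0 [X in _ || X]lt0n bej orbT.
move=> p g; rewrite (_ : \prod_i _ = diff_var k j * \prod_i diff_var k i ^+ be' i).
  rewrite -mulrA bi_act_diff (_ : (ga + be - U_(j) = ga + be')%MM) ?CE.
    by rewrite mpolyCN mpolyCMn mulNr mulrnAl.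
  by rewrite beE addmA addmK.
rewrite beE (bigD1 j) //= [in RHS](bigD1 j) //= mulrA -exprS mnmDE mnm1E eqxx addn1; congr (_ * _).
by apply: eq_bigr => i ij; rewrite mnmDE mnm1E eq_sym (negPf ij) addn0.
Qed.

Lemma mderivm_right ga g : (right_copy g)^`M[right_index ga] = right_copy (g^`M[ga]) :> P2.
Proof.
have step j x : (right_copy x)^`M(rshift n j) = right_copy (x^`M(j)) :> P2.
  elim/mpoly_ind_ring: x => [c|i|x y IHx IHy|x y IHx IHy].
  - by rewrite comp_mpolyC !mderivC comp_mpoly0.
  - rewrite comp_right_var !mderivX !mnm1E eq_rshift.
    have [->|_] := eqVneq i j; last by rewrite !scale0r comp_mpoly0.
    by rewrite !scale1r !submm !mpolyX0 rmorph1.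
  - by rewrite rmorphD !mderivD IHx IHy rmorphD.
  - by rewrite rmorphM !mderivM IHx IHy rmorphD !rmorphM.
elim: {ga}(mdeg ga) {-2}ga (erefl (mdeg ga)) => [|D IH] ga gaD.
  move/eqP: gaD; rewrite mdeg_eq0 => /eqP ->; rewrite (_ : right_index 0 = 0%MM) ?mderivm0m //.
  by apply/mnmP => i; rewrite mnmE mnm0E; case: (fintype.split i) => j; rewrite ?mnm0E.
have [j gj] : exists j, ga j != 0%N.
  apply: contrapT => /forallNP ga0; move: gaD; rewrite (_ : ga = 0%MM) ?mdeg0 //.
  by apply/mnmP => j; rewrite mnm0E; apply/eqP/negP => /negP /ga0.
have gaE : ga = (ga - U_(j) + U_(j))%MM by rewrite submK // lep1mP.
have rE : right_index ga = (right_index (ga - U_(j)) + U_(rshift n j))%MM.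
  by rewrite -right_indexB submK // lep1mP right_indexr.
rewrite rE mderivmDm IH; last by move: gaD; rewrite {1}gaE mdegD mdeg1 addn1 => -[].
by rewrite mderivmU1m step [in RHS]gaE mderivmDm mderivmU1m.
Qed.

Lemma bi_act1 ga g : bi_act ga 1 g = g^`M[ga].
Proof. by rewrite /bi_act mul1r mderivm_right diagonal_right. Qed.

Lemma weyl_mderivm ga : weyl_algebra k n (fun g => g^`M[ga]).
Proof.
elim: {ga}(mdeg ga) {-2}ga (erefl (mdeg ga)) => [|D IH] ga gaD.
  move/eqP: gaD; rewrite mdeg_eq0 => /eqP ->.
  rewrite (_ : (fun g => _) = (fun g => 1 * g)); first exact: weyl_mul.
  by apply/funext => g; rewrite mderivm0m mul1r.
have [j gj] : exists j, ga j != 0%N.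
  apply: contrapT => /forallNP ga0; move: gaD; rewrite (_ : ga = 0%MM) ?mdeg0 //.
  by apply/mnmP => j; rewrite mnm0E; apply/eqP/negP => /negP /ga0.
have gaE : ga = (ga - U_(j) + U_(j))%MM by rewrite submK // lep1mP.
rewrite (_ : (fun g => _) = (fun g => mderiv j (g^`M[ga - U_(j)]))); last first.
  by apply/funext => g; rewrite {1}gaE mderivmDm mderivmU1m.
have wj : weyl_algebra k n (fun g => g^`M[ga - U_(j)]).
  by apply: IH; move: gaD; rewrite {1}gaE mdegD mdeg1 addn1 => -[].
exact: (weyl_comp (weyl_deriv k j) wj).
Qed.

(** The induction treats [p] as a multiplier of an arbitrary [r] and lets [ga] vary, because a
    variable on the right also produces a term with [ga - U_(i)]. *)
Lemma weyl_bi_act ga p : weyl_algebra k n (bi_act ga p).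
Proof.
have weylM x P : weyl_algebra k n P -> weyl_algebra k n (fun g => x * P g).
  exact: (weyl_comp (weyl_mul x)).
suff H : forall p r, (forall ga, weyl_algebra k n (bi_act ga r)) -> forall ga,
  weyl_algebra k n (bi_act ga (p * r)).
  rewrite -[p]mulr1; apply: H => {}ga.
  rewrite (_ : bi_act ga 1 = fun g => g^`M[ga]); first exact: weyl_mderivm.
  by apply/funext => g; exact: bi_act1.
elim/mpoly_ind_ring => [c|i|p' q IHp IHq|p' q IHp IHq] r wr {}ga.
- rewrite (_ : bi_act _ _ = fun g => c%:MP * bi_act ga r g); first exact/weylM.
  by apply/funext => g; exact: bi_actC.
- rewrite -(splitK i); case: (fintype.split i) => j /=.
    rewrite (_ : bi_act _ _ = fun g => 'X_j * bi_act ga r g); first exact/weylM.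
    by apply/funext => g; exact: bi_actXl.
  rewrite (_ : bi_act _ _ = fun g => 'X_j * bi_act ga r g + (ga j)%:R * bi_act (ga - U_(j)) r g).
    by apply: weyl_add; exact/weylM.
  by apply/funext => g; rewrite bi_actXr mulr_natl.
- rewrite (_ : bi_act _ _ = fun g => bi_act ga (p' * r) g + bi_act ga (q * r) g).
    by apply: weyl_add; [exact: IHp|exact: IHq].
  by apply/funext => g; rewrite mulrDl bi_actD.
- by rewrite -mulrA; apply: IHp; exact: IHq.
Qed.

Inductive normal_form : set ({mpoly k[n]} -> {mpoly k[n]}) :=
| normal_form_mono x al : normal_form (fun g => x * g^`M[al])
| normal_form_add P Q : normal_form P -> normal_form Q -> normal_form (fun g => P g + Q g).

(** Leibniz's rule moves derivatives to the right, so normal forms are stable under composition on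
    the left; the claim is the case of the identity operator. *)
Lemma weyl_normal_form P : weyl_algebra k n P -> normal_form P.
Proof.
suff H : weyl_algebra k n P -> forall Q, normal_form Q -> normal_form (fun g => P (Q g)).
  move=> /H/(_ _ (normal_form_mono 1 0)).
  rewrite (_ : (fun g => P _) = P) //.
  by apply/funext => g; rewrite mul1r mderivm0m.
elim=> {P} [x|i|P Q _ IHP _ IHQ|P Q _ IHP _ IHQ] S NS.
- elim: NS => {S} [y al|S S' _ IH _ IH'].
    rewrite (_ : (fun g => _) = (fun g => (x * y) * g^`M[al])); first exact: normal_form_mono.
    by apply/funext => g; rewrite mulrA.
  rewrite (_ : (fun g => _) = (fun g => x * S g + x * S' g)); first exact: normal_form_add.
  by apply/funext => g; rewrite mulrDr.
- elim: NS => {S} [y al|S S' _ IH _ IH'].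
    rewrite (_ : (fun g => _) = (fun g => y^`M(i) * g^`M[al] + y * g^`M[al + U_(i)])).
      by apply: normal_form_add; exact: normal_form_mono.
    by apply/funext => g; rewrite mderivM mderivmDm mderivmU1m.
  rewrite (_ : (fun g => _) = (fun g => (S g)^`M(i) + (S' g)^`M(i))); first exact: normal_form_add.
  by apply/funext => g; rewrite mderivD.
- by apply: normal_form_add; [exact: IHP|exact: IHQ].
- by apply: IHP; exact: IHQ.
Qed.

(** Apply both sides of the relation for [k0 = |al| + 1] to [d^ga], with [ga = al + (m, ..., m)].
    The product of the [(x_i - y_i) ^+ m] gives a nonzero multiple of [d^al], while each
    [(x_i - y_i) ^+ (k0 + m)] kills [d^ga] because [al_i < k0]. What remains are multiples of
    [f(x)], which are left multiples of [f], and of [f(y)], which are right multiples. *)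
Lemma weyl_decomposition (f : {mpoly k[n]}) :
  (forall k0, cleared (diff_var k (m := n)) (product_ideal f) k0 1) ->
  weyl_algebra k n = [set (fun g => P (f * g) + f * Q g) | P in weyl_algebra k n & Q in
    weyl_algebra k n].
Proof.
move=> clearedP.
have weylM x P : weyl_algebra k n P -> weyl_algebra k n (fun g => x * P g).
  exact: (weyl_comp (weyl_mul x)).
apply/seteqP; split; last first.
  move=> _ [P wP [Q wQ <-]]; apply: weyl_add; last exact: weylM.
  exact: (weyl_comp wP (weyl_mul f)).
move=> P /weyl_normal_form; elim=> {P} [x al|P Q _ [P1 w1 [Q1 v1 <-]] _ [P2' w2 [Q2 v2 <-]]];
  last first.
  exists (fun g => P1 g + P2' g); first exact: weyl_add.
  exists (fun g => Q1 g + Q2 g); first exact: weyl_add.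
  by apply/funext => g; rewrite mulrDr addrACA.
have [m [s [u [w [[u1 ->] [w1 ->] sE]]]]] := clearedP (mdeg al).+1.
have [C C0 CE] := bi_act_monomial al [multinom m | _ < n].
pose ga := (al + [multinom m | _ < n])%MM.
have gaE g : C%:MP * g^`M[al] = f * bi_act ga u1 g + bi_act ga w1 (f * g).
  rewrite -bi_act1 -CE mulr1.
  have -> : \prod_i diff_var k i ^+ [multinom m | _ < n] i =
    \sum_i s i * diff_var k i ^+ ((mdeg al).+1 + m) + (u1 * left_copy f + w1 * right_copy f).
    rewrite -sE mul1r addrC subrK -prodrXl; apply: eq_bigr => i _; by rewrite mnmE.
  rewrite !bi_actD [u1 * _]mulrC [w1 * _]mulrC bi_act_left bi_act_right.
  have bi_act0 : bi_act ga 0 g = 0 by rewrite -(mul0r 0) -mpolyC0 bi_actC mpolyC0 mul0r.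
  rewrite (big_morph (fun p => bi_act ga p g) (fun p q =>
    bi_actD ga p q g) bi_act0) big1 ?add0r // => i _.
  rewrite mulrC bi_act_pow // mnmDE mnmE addSn ltnS leq_add2r.
  by rewrite mdegE (bigD1 i) //= leq_addr.
exists (fun g => (x * C^-1%:MP) * bi_act ga w1 g); first by apply: weylM; exact: weyl_bi_act.
exists (fun g => (x * C^-1%:MP) * bi_act ga u1 g); first by apply: weylM; exact: weyl_bi_act.
apply/funext => g; rewrite [f * (_ * _)]mulrCA -mulrDr addrC -gaE -mulrA; congr (_ * _).
by rewrite mulrA -mpolyCM mulVf // mpolyC1 mul1r.
Qed.

End DifferentialOperators.

(** * Morphisms into affine open subschemes *)

Section Invertible.
Variable (A : comPzRingType).
Implicit Types a b : A.

Lemma invertible1 : invertible (1 : A).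
Proof. by exists 1; rewrite mulr1. Qed.

Lemma invertibleM a b : invertible a -> invertible b -> invertible (a * b).
Proof. by move=> [a' aa'] [b' bb']; exists (a' * b'); rewrite mulrACA aa' bb' mulr1. Qed.

Lemma invertible_mulr a b : invertible (a * b) -> invertible a.
Proof. by move=> [c abc]; exists (b * c); rewrite mulrA. Qed.

Lemma invertibleX a m : invertible a -> invertible (a ^+ m).
Proof.
by move=> ia; elim: m => [|m IH]; [exact: invertible1 | rewrite exprS; exact: invertibleM].
Qed.

Lemma invertible_inj a b c : invertible a -> a * b = a * c -> b = c.
Proof. by move=> [a' aa'] E; rewrite -[b]mul1r -[c]mul1r -aa' ![a * a']mulrC -!mulrA E. Qed.

Lemma invertible_rmorph (B : comPzRingType) (h : {rmorphism A -> B}) a :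
  invertible a -> invertible (h a).
Proof. by move=> [b ab]; exists (h b); rewrite -rmorphM ab rmorph1. Qed.

End Invertible.

Section OpenSub.
Variable T : topologicalType.
Implicit Types U V W : set T.

Lemma opensubT U : open U -> opensub U setT.
Proof. by move=> oU; split=> //; exact: openT. Qed.

Lemma opensub_refl U : open U -> opensub U U.
Proof. by move=> oU; split. Qed.

Lemma opensub_trans W V U : opensub W V -> opensub V U -> opensub W U.
Proof. by move=> [oW oV WV] [_ oU VU]; split=> //; exact: subset_trans VU. Qed.

Lemma opensubIl U V : open U -> open V -> opensub (U `&` V) U.
Proof. by move=> oU oV; split=> //; exact: openI. Qed.

Lemma opensubIr U V : open U -> open V -> opensub (U `&` V) V.
Proof. by move=> oU oV; split=> //; exact: openI. Qed.

Lemma opensub_open W U : opensub W U -> open W. Proof. by case. Qed.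
Lemma opensub_sub W U : opensub W U -> W `<=` U. Proof. by case. Qed.

End OpenSub.

Lemma restr_irr (X : ringedSpace) (V U : set X) (h h' : opensub V U) (s : sect U) :
  restr h s = restr h' s.
Proof. by rewrite (Prop_irrelevance h h'). Qed.

Section Units.
Variable X : ringedSpace.
Implicit Types (U V W : set X) (x : X).

Lemma unit_at_mem U (s : sect U) x : unit_at x s -> U x.
Proof. by move=> [V [[_ _ VU] [Vx _]]]; exact: VU. Qed.

Lemma unit_at_openl U (s : sect U) x : unit_at x s -> open U.
Proof. by move=> [V [[_ oU _] _]]. Qed.

Lemma unit_at1 U x : open U -> U x -> unit_at x (1 : sect U).
Proof. by move=> oU Ux; exists U, (opensub_refl oU); rewrite rmorph1; split=> //;
  exact: invertible1. Qed.

Lemma invertible_unit_at U (s : sect U) x : open U -> U x -> invertible s -> unit_at x s.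
Proof. by move=> oU Ux is_; exists U, (opensub_refl oU); split=> //; exact: invertible_rmorph. Qed.

Lemma unit_at_mulr U (s t : sect U) x : unit_at x (s * t) -> unit_at x s.
Proof. by move=> [V [h [Vx]]]; rewrite rmorphM => /invertible_mulr is_; exists V, h. Qed.

Lemma unit_at_mull U (s t : sect U) x : unit_at x (s * t) -> unit_at x t.
Proof. by rewrite mulrC; exact: unit_at_mulr. Qed.

Lemma unit_atM U (s t : sect U) x : unit_at x s -> unit_at x t -> unit_at x (s * t).
Proof.
move=> [V [h [Vx is_]]] [V' [h' [Vx' it]]].
have o := opensub_open h; have o' := opensub_open h'.
exists (V `&` V'), (opensub_trans (opensubIl o o') h); split=> //.
rewrite rmorphM; apply: invertibleM.
  by rewrite -(restr_comp (opensubIl o o') h); exact: invertible_rmorph.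
rewrite (restr_irr _ (opensub_trans (opensubIr o o') h')).
by rewrite -(restr_comp (opensubIr o o') h'); exact: invertible_rmorph.
Qed.

Lemma unit_atX U (s : sect U) x m : unit_at x s -> unit_at x (s ^+ m).
Proof.
move=> us; elim: m => [|m IH]; last by rewrite exprS; exact: unit_atM.
by rewrite expr0; apply: unit_at1; [exact: unit_at_openl us | exact: unit_at_mem us].
Qed.

Lemma unit_at_restr V U (h : opensub V U) (s : sect U) x : V x ->
  unit_at x (restr h s) <-> unit_at x s.
Proof.
move=> Vx; split=> [[W [h' [Wx]]]|[W [h' [Wx is_]]]].
  by rewrite (restr_comp _ _ (opensub_trans h' h)) => is_; exists W, (opensub_trans h' h).
have oV := opensub_open h; have oW := opensub_open h'.
exists (V `&` W), (opensubIl oV oW); split=> //.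
rewrite (restr_comp _ _ (opensub_trans (opensubIr oV oW) h')).
by rewrite -(restr_comp (opensubIr oV oW) h'); exact: invertible_rmorph.
Qed.

(** Inverses are unique, so local ones agree on overlaps and glue. *)
Lemma invertible_local U (s : sect U) : open U -> (forall x, U x -> unit_at x s) -> invertible s.
Proof.
move=> oU us.
pose I := {x : X | U x}.
have /choice[V Vp] (i : I) : exists V, exists h : opensub V U, V (sval i) /\ invertible (restr h s).
  exact: us (svalP i).
pose h i := sval (cid (Vp i)); pose hp i := svalP (cid (Vp i)).
pose b i := sval (cid (hp i).2).
have bp i : restr (h i) s * b i = 1 := svalP (cid (hp i).2).
have cover : U `<=` \bigcup_i V i.
  by move=> x Ux; exists (exist _ x Ux) => //; exact: (hp (exist _ x Ux)).1.
have [i j hi hj|t tp] := @sheaf_gluing X I V U h cover b.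
  have hij := opensub_trans hi (h i).
  have iu : invertible (restr hij s).
    by rewrite -(restr_comp hi (h i)); apply: invertible_rmorph; exists (b i).
  apply: (invertible_inj iu).
  rewrite -{1}(restr_comp hi (h i)) -rmorphM bp rmorph1.
  by rewrite -(restr_comp hj (h j)) -rmorphM bp rmorph1.
exists t; apply: (@sheaf_locality X I V U h cover) => i.
by rewrite rmorphM tp bp rmorph1.
Qed.

Lemma basic_open_invertible U (s : sect U) (h : opensub (basic_open s) U) :
  invertible (restr h s).
Proof.
apply: invertible_local; first by case: h.
by move=> x sx; apply/unit_at_restr.
Qed.

End Units.

Section StalkPrime.
Variables (X : locallyRingedSpace) (U : set X).

Lemma nunit_at0 x : ~ unit_at x (0 : sect U).
Proof.
move=> [V [h [Vx]]]; rewrite rmorph0 => i0; apply: (stalk_nonzero (x := x)).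
by exists V, (opensubT (opensub_open h)); rewrite rmorph0.
Qed.

Lemma stalk_prime x : open U -> U x -> prime_ideal [set s : sect U | ~ unit_at x s].
Proof.
move=> oU Ux; split=> /=.
- exact: nunit_at0.
- by move=> a b na nb /stalk_local[].
- by move=> a b nb /unit_at_mull.
- by apply; exact: unit_at1.
- by move=> a b nab; apply/not_andP => -[ua ub]; apply: nab; exact: unit_atM.
Qed.

End StalkPrime.

Lemma rmorphism_ext (A B : comPzRingType) (f g : {rmorphism A -> B}) : f =1 g -> f = g.
Proof.
case: f g => f cf [g cg] /= /funext fg; case: _ / fg in cg *; congr GRing.RMorphism.Pack.
case: cf cg => [[c1] [c2]] [[d1] [d2]].
by rewrite (Prop_irrelevance c1 d1) (Prop_irrelevance c2 d2).
Qed.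

Section MorphismTheory.
Variables (k : fieldType) (T Y : scheme k).
Implicit Types (h : morphism T Y) (W : set Y).

Lemma unit_at_pull h W (oW : open W) (s : sect W) t :
  unit_at t (pull h oW s) <-> unit_at (h t) s.
Proof.
split; first exact: pull_local.
move=> [W' [h1 [W't is_]]]; have o' := opensub_open h1.
exists (h @^-1` W'), (opensub_preimage h h1); split=> //.
by rewrite -(pull_restr h1 o'); exact: invertible_rmorph.
Qed.

(** The two pullbacks have values in different types until the maps on points are identified, so
    they are compared after restriction to open sets contained in both preimages. *)
Lemma morphism_ext h1 h2 : (forall t, h1 t = h2 t) ->
  (forall (E : forall t, h1 t = h2 t) W (oW : open W) (s : sect W) t, h1 t \in W ->
     exists (U : set T) (u1 : opensub U (h1 @^-1` W)) (u2 : opensub U (h2 @^-1` W)),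
       U t /\ restr u1 (pull h1 oW s) = restr u2 (pull h2 oW s)) ->
  h1 = h2.
Proof.
move=> E /(_ E); case: h1 h2 E => [f1 c1 p1 r1 l1 s1] [f2 c2 p2 r2 l2 s2] /= E.
have f12 : f1 = f2 by exact/funext.
case: _ / f12 in c2 p2 r2 l2 s2 E * => H.
have p12 : p1 = p2.
  apply: functional_extensionality_dep => W; apply: functional_extensionality_dep => oW.
  apply: rmorphism_ext => s.
  have pick (i : {t : T | f1 t \in W}) : {U : set T | exists (u : opensub U (f1 @^-1` W)),
      U (sval i) /\ restr u (p1 W oW s) = restr u (p2 W oW s)}.
    apply: cid; have [U [u1 [u2 [Ut uE]]]] := H W oW s _ (svalP i).
    by exists U, u1; split=> //; rewrite uE; exact: restr_irr.
  pose V i := sval (pick i).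
  pose hV i : opensub (V i) (f1 @^-1` W) := sval (cid (svalP (pick i))).
  apply: (@sheaf_locality _ _ V _ hV) => [t Wt|i].
    have tW : f1 t \in W by apply/mem_set.
    by exists (exist _ t tW) => //; exact: (svalP (cid (svalP (pick (exist _ t tW))))).1.
  exact: (svalP (cid (svalP (pick i)))).2.
case: _ / p12 in r2 l2 s2 H *.
by rewrite (Prop_irrelevance c1 c2) (Prop_irrelevance r1 r2) (Prop_irrelevance l1 l2)
  (Prop_irrelevance s1 s2).
Qed.

Section IntoAffine.
Variables (V : set Y) (aV : affine_open V).
Let oV : open V := affine_is_open aV.

Lemma preimage_full h : (forall t, V (h t)) -> opensub setT (h @^-1` V).
Proof.
move=> hV; have -> : h @^-1` V = setT by apply/seteqP; split=> // t _; exact: hV.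
by apply: opensub_refl; exact: openT.
Qed.

(** The ring morphism corresponding to [h] under the adjunction between Spec and global sections. *)
Definition global_pull h (hV : forall t, V (h t)) : {rmorphism sect V -> sect (setT : set T)} :=
  restr (preimage_full hV) \o pull h oV.

Lemma unit_at_global_pull h (hV : forall t, V (h t)) (s : sect V) t :
  unit_at t (global_pull hV s) <-> unit_at (h t) s.
Proof.
rewrite -(unit_at_pull h oV); exact: unit_at_restr.
Qed.

Lemma affine_fraction W (s : sect W) y : open W -> W y -> V y ->
  exists (v a : sect V) m (h1 : opensub (basic_open v) V) (h2 : opensub (basic_open v) W),
    unit_at y v /\ restr h1 v ^+ m * restr h2 s = restr h1 a.
Proof.
move=> oW Wy Vy.
have [|v [vy vW]] := affine_basis aV (opensubIr oW oV) _ (x := y); first by split.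
have h1 := basic_open_opensub v oV.
have h2 : opensub (basic_open v) W by split=> //; [case: h1 | move=> z /vW[]].
have [a [m am]] := affine_frac aV h1 (restr h2 s).
by exists v, a, m, h1, h2.
Qed.

(** A point of [V] is determined by the sections that are units there, and locally every section is
    a fraction, whose pullback is determined by those of its numerator and denominator. *)
Lemma affine_morphism_ext h1 h2 (hV1 : forall t, V (h1 t)) (hV2 : forall t, V (h2 t)) :
  global_pull hV1 =1 global_pull hV2 -> h1 = h2.
Proof.
move=> gE.
have pE t : h1 t = h2 t.
  apply: (affine_inj aV) => // s.
  by rewrite -(unit_at_global_pull hV1) -(unit_at_global_pull hV2) gE.
apply: morphism_ext => // _ W oW s t /set_mem Wt.
have [v [a [m [v1 [v2 [vt vE]]]]]] := affine_fraction s oW Wt (hV1 t).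
have oD := opensub_open v1.
have eqpre : h2 @^-1` basic_open v = h1 @^-1` basic_open v.
  by apply/seteqP; split=> x; rewrite /preimage /= pE.
pose U := h1 @^-1` basic_open v.
have w1 : opensub U (h1 @^-1` W) := opensub_preimage h1 v2.
have w2 : opensub U (h2 @^-1` W) by rewrite /U -eqpre; exact: opensub_preimage.
exists U, w1, w2; split=> //.
have oU := opensub_open w1.
have uT := opensubT oU.
have val1 x : restr (opensub_preimage h1 v1) (pull h1 oV x) = restr uT (global_pull hV1 x).
  by rewrite /= (restr_comp _ _ (opensub_preimage h1 v1)).
have u2V : opensub U (h2 @^-1` V) by rewrite /U -eqpre; exact: opensub_preimage.
have val2 x : restr u2V (pull h2 oV x) = restr uT (global_pull hV2 x).
  by rewrite /= (restr_comp _ _ u2V).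
have iv : invertible (restr uT (global_pull hV1 v) ^+ m).
  rewrite -val1 -(pull_restr v1 oD oV); apply: invertibleX; apply: invertible_rmorph.
  exact: basic_open_invertible.
apply: (invertible_inj iv).
have E1 : restr uT (global_pull hV1 v) ^+ m * restr w1 (pull h1 oW s) =
  restr uT (global_pull hV1 a).
  rewrite -!val1 -!(pull_restr v1 oD oV) -(pull_restr v2 oD oW).
  by rewrite -rmorphXn -rmorphM vE.
rewrite E1 gE [in RHS]gE.
have u2 : opensub U (h2 @^-1` basic_open v) by rewrite eqpre; exact: opensub_refl.
have E2 x : restr uT (global_pull hV2 x) = restr u2 (pull h2 oD (restr v1 x)).
  rewrite -val2 (pull_restr v1 oD oV (opensub_preimage h2 v1)).
  by rewrite (restr_comp _ _ u2V).
rewrite !E2 -rmorphXn -(restr_comp u2 (opensub_preimage h2 v2)) -(pull_restr v2 oD oW).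
by rewrite -rmorphM -rmorphXn -rmorphM vE.
Qed.

End IntoAffine.
End MorphismTheory.

Section AffineAdjunction.
Variables (k : fieldType) (T Y : scheme k) (V : set Y) (aV : affine_open V).
Variable phi : {rmorphism sect V -> sect (setT : set T)}.
Hypothesis phi_scal : forall (h : opensub V setT) c, phi (restr h (scal Y c)) = scal T c.

Let oV : open V := affine_is_open aV.

(** The point corresponds to the prime ideal of the sections of [V] whose image is not a unit at
    [t]. *)
Let point_ex t : exists y, V y /\ forall s, unit_at y s <-> unit_at t (phi s).
Proof.
have oT : open (setT : set T) by exact: openT.
have [_ _ _ n1 nM] := stalk_prime (U := setT) (x := t) oT I.
have [|y Vy yE] := affine_surj aV (P := [set s | ~ unit_at t (phi s)]).
  split=> /=.
  - by rewrite rmorph0; exact: nunit_at0.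
  - by move=> a b na nb; rewrite rmorphD => /stalk_local[].
  - by move=> a b nb; rewrite rmorphM => /unit_at_mull.
  - by apply; rewrite rmorph1; exact: unit_at1.
  - by move=> a b; rewrite rmorphM; exact: nM.
by exists y; split=> // s; apply: iff_sym; rewrite -[X in X <-> _]notK -[X in _ <-> X]notK;
  split; apply: contra_not; move=> /yE.
Qed.

Let h t : Y := sval (cid (point_ex t)).
Let hV t : V (h t) := (svalP (cid (point_ex t))).1.
Let hE t s : unit_at (h t) s <-> unit_at t (phi s) := (svalP (cid (point_ex t))).2 s.

Let obasic (v : sect V) : opensub (basic_open (phi v)) setT.
Proof. by apply: basic_open_opensub; exact: openT. Qed.

Let h_open W : open W -> open (h @^-1` W).
Proof.
move=> oW; rewrite openE => t Wt.
have [v [_ [_ [h1 [h2 [vt _]]]]]] := affine_fraction aV (1 : sect W) oW Wt (hV t).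
rewrite /interior nbhsE; exists (basic_open (phi v)).
  by split; [exact: opensub_open (obasic v) | apply/hE].
by move=> x xv; apply: (opensub_sub h2); apply/hE.
Qed.

Let h_continuous : continuous h.
Proof. by apply/continuousP => W; exact: h_open. Qed.

Let obasicW W (oW : open W) (v : sect V) : opensub (basic_open v) W ->
  opensub (basic_open (phi v)) (h @^-1` W).
Proof.
move=> h2; split; [exact: opensub_open (obasic v) | exact: h_open |].
by move=> t tv; apply: (opensub_sub h2); apply/hE.
Qed.

Let inv_basic v : invertible (restr (obasic v) (phi v)).
Proof. exact: basic_open_invertible. Qed.

(** All expressions of [s] as a fraction on a principal open subset; this type indexes the covering
    over which the pullback is glued. *)
Record fraction_of W (s : sect W) := Fraction {
  den : sect V; num : sect V; expo : nat;
  den_sub : opensub (basic_open den) V;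
  den_subW : opensub (basic_open den) W;
  fracE : restr den_sub den ^+ expo * restr den_subW s = restr den_sub num }.

Let is_pull W (s : sect W) (ga : sect (h @^-1` W)) := forall (d : fraction_of s)
  (u : opensub (basic_open (phi (den d))) (h @^-1` W)),
  restr (obasic (den d)) (phi (den d)) ^+ expo d * restr u ga =
    restr (obasic (den d)) (phi (num d)).

Let cover W (oW : open W) (s : sect W) t : W (h t) -> exists d : fraction_of s,
  unit_at t (phi (den d)).
Proof.
move=> Wt; have [v [a [m [h1 [h2 [vt vE]]]]]] := affine_fraction aV s oW Wt (hV t).
by exists (Fraction vE); apply/hE.
Qed.

Let phi_zero (v x : sect V) (hv : opensub (basic_open v) V) (U : set T)
    (uT : opensub U setT) : restr hv x = 0 -> invertible (restr uT (phi v)) -> restr uT (phi x) = 0.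
Proof.
move=> /(affine_frac_eq0 aV)[m vx] iv.
apply: (invertible_inj (invertibleX m iv)).
by rewrite mulr0 -rmorphXn -!rmorphM -rmorphXn -rmorphM vx !rmorph0.
Qed.

(** The pullback is glued from the quotients [phi num / phi den ^+ expo]. For two fractions, the
    cross difference of numerators vanishes where both denominators are units, so a power of their
    product kills it in [sect V], and its image under [phi] vanishes on the overlap. *)
Let pull_exists W (oW : open W) (s : sect W) : exists ga, is_pull s ga.
Proof.
have hW := h_open oW.
pose VV (d : fraction_of s) := basic_open (phi (den d)).
pose u (d : fraction_of s) : opensub (VV d) (h @^-1` W) := obasicW oW (den_subW d).
pose b (d : fraction_of s) := sval (cid (inv_basic (den d))).
have bE (d : fraction_of s) : restr (obasic (den d)) (phi (den d)) * b d =
  1 := svalP (cid (inv_basic (den d))).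
pose sg (d : fraction_of s) : sect (VV d) := restr (obasic (den d)) (phi (num d)) * b d ^+ expo d.
have sgE (d : fraction_of s) : restr (obasic (den d)) (phi (den d)) ^+ expo d * sg d =
  restr (obasic (den d)) (phi (num d)).
  by rewrite /sg mulrCA -exprMn bE expr1n mulr1.
have covered : h @^-1` W `<=` \bigcup_d VV d.
  by move=> t Wt; have [d dt] := cover oW s Wt; exists d.
have [i j hi hj|ga gaE] := @sheaf_gluing _ _ VV _ u covered sg.
  pose U := VV i `&` VV j.
  have uT : opensub U setT := opensub_trans hi (obasic (den i)).
  have ri x : restr hi (restr (obasic (den i)) x) = restr uT x by exact: restr_comp.
  have rj x : restr hj (restr (obasic (den j)) x) = restr uT x by exact: restr_comp.
  have invi : invertible (restr uT (phi (den i))).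
    by rewrite -ri; apply: invertible_rmorph; exact: inv_basic.
  have invj : invertible (restr uT (phi (den j))).
    by rewrite -rj; apply: invertible_rmorph; exact: inv_basic.
  have Ei : restr uT (phi (den i)) ^+ expo i * restr hi (sg i) = restr uT (phi (num i)).
    by rewrite -!ri -sgE [RHS]rmorphM [in RHS]rmorphXn.
  have Ej : restr uT (phi (den j)) ^+ expo j * restr hj (sg j) = restr uT (phi (num j)).
    by rewrite -!rj -sgE [RHS]rmorphM [in RHS]rmorphXn.
  apply: (invertible_inj (invertibleM (invertibleX (expo i) invi) (invertibleX (expo j) invj))).
  rewrite mulrAC Ei -[RHS]mulrA Ej.
  pose x := num i * den j ^+ expo j - den i ^+ expo i * num j.
  have hv : opensub (basic_open (den i * den j)) V by exact: basic_open_opensub.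
  have hvi : opensub (basic_open (den i * den j)) (basic_open (den i)).
    split; [exact: opensub_open hv | exact: opensub_open (den_sub i) |].
    by move=> y /unit_at_mulr.
  have hvj : opensub (basic_open (den i * den j)) (basic_open (den j)).
    split; [exact: opensub_open hv | exact: opensub_open (den_sub j) |].
    by move=> y /unit_at_mull.
  have hvW := opensub_trans hvi (den_subW i).
  have xi : restr hv (num i) = restr hv (den i) ^+ expo i * restr hvW s.
    rewrite -!(restr_comp hvi (den_sub i)) -(restr_comp hvi (den_subW i)).
    by rewrite -fracE rmorphM rmorphXn.
  have xj : restr hv (num j) = restr hv (den j) ^+ expo j * restr hvW s.
    rewrite -!(restr_comp hvj (den_sub j)) -(restr_comp hvj (den_subW j)).
    by rewrite -fracE rmorphM rmorphXn.
  have x0 : restr hv x = 0 by rewrite rmorphB !rmorphM !rmorphXn xi xj; ring.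
  have := phi_zero x0 (uT := uT); rewrite rmorphM rmorphM => /(_ (invertibleM invi invj)).
  rewrite /x !rmorphB !rmorphM !rmorphXn => /eqP; rewrite subr_eq0 => /eqP.
  by move=> ->.
exists ga => d u'; rewrite (restr_irr u' (u d)) gaE; exact: sgE.
Qed.

Let pullf W (oW : open W) (s : sect W) : sect (h @^-1` W) := sval (cid (pull_exists oW s)).
Let pullfP W (oW : open W) (s : sect W) : is_pull s (pullf oW s) := svalP (cid (pull_exists oW s)).

(* To identify the pullback of [s], one may use a different fraction near each point. *)
Let pull_local_eq W (oW : open W) (s : sect W) ga :
  (forall t, W (h t) -> exists (d : fraction_of s) (U : set T) (u : opensub U (h @^-1` W))
     (uT : opensub U setT), [/\ U t, U `<=` basic_open (phi (den d)) &
     restr uT (phi (den d)) ^+ expo d * restr u ga = restr uT (phi (num d))]) ->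
  ga = pullf oW s.
Proof.
move=> loc; have hW := h_open oW.
have pick (i : {t : T | (h t) \in W}) : {U : set T | exists (u : opensub U (h @^-1` W)),
    U (sval i) /\ restr u ga = restr u (pullf oW s)}.
  apply: cid; have [d [U [u [uT [Ut Ud dE]]]]] := loc _ (set_mem (svalP i)).
  exists U, u; split=> //.
  have ud : opensub U (basic_open (phi (den d))).
    by split=> //; [exact: opensub_open u | exact: opensub_open (obasic (den d))].
  have rd x : restr ud (restr (obasic (den d)) x) = restr uT x by exact: restr_comp.
  have iv : invertible (restr uT (phi (den d))).
    by rewrite -rd; apply: invertible_rmorph; exact: inv_basic.
  apply: (invertible_inj (invertibleX (expo d) iv)); rewrite dE.
  rewrite -(restr_comp ud (obasicW oW (den_subW d))) -!rd -rmorphXn -rmorphM.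
  by rewrite pullfP.
pose VV i := sval (pick i).
pose hVV i : opensub (VV i) (h @^-1` W) := sval (cid (svalP (pick i))).
apply: (@sheaf_locality _ _ VV _ hVV) => [t Wt|i].
  have tW : (h t) \in W by apply/mem_set.
  by exists (exist _ t tW) => //; exact: (svalP (cid (svalP (pick (exist _ t tW))))).1.
exact: (svalP (cid (svalP (pick i)))).2.
Qed.

Let common_den W (oW : open W) (s s' : sect W) t : W (h t) ->
  exists (v a a' : sect V) m (h1 : opensub (basic_open v) V) (h2 : opensub (basic_open v) W),
    [/\ unit_at t (phi v), restr h1 v ^+ m * restr h2 s = restr h1 a &
        restr h1 v ^+ m * restr h2 s' = restr h1 a'].
Proof.
move=> Wt; have [d dt] := cover oW s Wt; have [d' dt'] := cover oW s' Wt.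
pose v := den d * den d'.
have h1 : opensub (basic_open v) V by exact: basic_open_opensub.
have hd : opensub (basic_open v) (basic_open (den d)).
  by split; [exact: opensub_open h1 | exact: opensub_open (den_sub d) | move=> y /unit_at_mulr].
have hd' : opensub (basic_open v) (basic_open (den d')).
  by split; [exact: opensub_open h1 | exact: opensub_open (den_sub d') | move=> y /unit_at_mull].
have h2 := opensub_trans hd (den_subW d).
have E : restr h1 (den d) ^+ expo d * restr h2 s = restr h1 (num d).
  rewrite -!(restr_comp hd (den_sub d)) -(restr_comp hd (den_subW d)).
  by rewrite -fracE rmorphM rmorphXn.
have E' : restr h1 (den d') ^+ expo d' * restr h2 s' = restr h1 (num d').
  rewrite -!(restr_comp hd' (den_sub d')) -(restr_comp hd' (den_subW d')).
  by rewrite -fracE rmorphM rmorphXn.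
(* With [v = den d * den d'] raised to [expo d + expo d'], the surplus powers of the denominators go
   into the numerators. *)
exists v, (den d ^+ expo d' * den d' ^+ (expo d + expo d') * num d),
  (den d ^+ (expo d + expo d') * den d' ^+ expo d * num d'), (expo d + expo d')%N, h1, h2; split.
- by rewrite rmorphM; exact: unit_atM.
- by rewrite !rmorphM !rmorphXn -E !(exprMn, exprD); ring.
- by rewrite !rmorphM !rmorphXn -E' !(exprMn, exprD); ring.
Qed.

Let pullf_frac W (oW : open W) (s : sect W) (v a : sect V) m (h1 : opensub (basic_open v) V)
    (h2 : opensub (basic_open v) W) : restr h1 v ^+ m * restr h2 s = restr h1 a ->
  restr (obasic v) (phi v) ^+ m * restr (obasicW oW h2) (pullf oW s) = restr (obasic v) (phi a).
Proof. move=> E; exact: (@pullfP W oW s (Fraction E) (obasicW oW h2)). Qed.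

Let pullf_add W (oW : open W) : {morph pullf oW : s s' / s + s'}.
Proof.
move=> s s'; apply/esym/pull_local_eq => t Wt.
have [v [a [a' [m [h1 [h2 [vt E E']]]]]]] := common_den oW s s' Wt.
have F : restr h1 v ^+ m * restr h2 (s + s') = restr h1 (a + a').
  by rewrite !rmorphD mulrDr E E'.
exists (Fraction F), (basic_open (phi v)), (obasicW oW h2), (obasic v); split=> //=.
by rewrite !rmorphD mulrDr !(pullf_frac oW E) !(pullf_frac oW E').
Qed.

Let pullf_mul W (oW : open W) : {morph pullf oW : s s' / s * s'}.
Proof.
move=> s s'; apply/esym/pull_local_eq => t Wt.
have [v [a [a' [m [h1 [h2 [vt E E']]]]]]] := common_den oW s s' Wt.
have F : restr h1 v ^+ (m + m) * restr h2 (s * s') = restr h1 (a * a').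
  by rewrite !rmorphM exprD mulrACA E E'.
exists (Fraction F), (basic_open (phi v)), (obasicW oW h2), (obasic v); split=> //=.
by rewrite !rmorphM exprD mulrACA !(pullf_frac oW E) !(pullf_frac oW E').
Qed.

Let pullf_one W (oW : open W) : pullf oW 1 = 1.
Proof.
apply/esym/pull_local_eq => t Wt; have [d dt] := cover oW 1 Wt.
have F : restr (den_sub d) (den d) ^+ 0 * restr (den_subW d) 1 = restr (den_sub d) 1.
  by rewrite expr0 mul1r !rmorph1.
exists (Fraction F), (basic_open (phi (den d))), (obasicW oW (den_subW d)), (obasic (den d)).
by split=> //=; rewrite expr0 mul1r !rmorph1.
Qed.

Let pullf_zero W (oW : open W) : pullf oW 0 = 0.
Proof. by apply: (addrI (pullf oW 0)); rewrite -pullf_add !addr0. Qed.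

Let pullr_ex W (oW : open W) : exists g : {rmorphism sect W -> sect (h @^-1` W)}, g =1 pullf oW.
Proof.
have Fn : nmod_morphism (pullf oW) by split; [exact: pullf_zero | exact: pullf_add].
have Fm : monoid_morphism (pullf oW) by split; [exact: pullf_one | exact: pullf_mul].
pose F1 := GRing.isNmodMorphism.Build _ _ _ Fn.
pose F2 := GRing.isMonoidMorphism.Build _ _ _ Fm.
pose g : {rmorphism sect W -> sect (h @^-1` W)} := HB.pack (pullf oW) F1 F2.
by exists g.
Qed.

Let pullr W (oW : open W) := sval (cid (pullr_ex oW)).
Let pullrE W (oW : open W) : pullr oW =1 pullf oW := svalP (cid (pullr_ex oW)).

Let pullr_restr W U (o : opensub W U) (oW : open W) (oU : open U)
    (o' : opensub (h @^-1` W) (h @^-1` U)) (s : sect U) :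
  pullr oW (restr o s) = restr o' (pullr oU s).
Proof.
rewrite !pullrE.
apply/esym/pull_local_eq => t Wt; have [d dt] := cover oW (restr o s) Wt.
exists d, (basic_open (phi (den d))), (obasicW oW (den_subW d)), (obasic (den d)); split=> //.
have E := fracE d; rewrite (restr_comp _ _ (opensub_trans (den_subW d) o)) in E.
by rewrite (restr_comp _ _ (obasicW oU (opensub_trans (den_subW d) o))) (pullf_frac oU E).
Qed.

Let pullr_local t W (oW : open W) (s : sect W) : unit_at t (pullr oW s) -> unit_at (h t) s.
Proof.
rewrite pullrE.
move=> us; have [d dt] := cover oW s (unit_at_mem us).
have E := pullf_frac oW (fracE d).
have : unit_at t (phi (num d)).
  apply/(unit_at_restr (obasic (den d)) (phi (num d)) dt); rewrite -E.
  by apply: unit_atM; [apply: unit_atX; apply/unit_at_restr | apply/unit_at_restr].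
move=> /hE un; have hd : basic_open (den d) (h t) by apply/hE.
apply/(unit_at_restr (den_subW d) s hd); apply: (unit_at_mull (s := restr (den_sub d) (den d) ^+
  expo d)).
by rewrite fracE; apply/unit_at_restr.
Qed.

Let pullf_global W (oW : open W) (s : sect W) (o : opensub V W) (o' : opensub (h @^-1` W) setT) :
  pullf oW s = restr o' (phi (restr o s)).
Proof.
apply/esym/pull_local_eq => t Wt.
have h1 : opensub (basic_open (1 : sect V)) V by exact: basic_open_opensub.
have F : restr h1 1 ^+ 0 * restr (opensub_trans h1 o) s = restr h1 (restr o s).
  by rewrite expr0 mul1r (restr_comp _ _ (opensub_trans h1 o)).
exists (Fraction F), (basic_open (phi 1)), (obasicW oW (opensub_trans h1 o)), (obasic 1);
  split=> //.
  by apply/hE; apply: unit_at1.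
by rewrite /= expr0 mul1r (restr_comp _ _ (obasic 1)).
Qed.

Let pullr_scal (oT : open (setT : set Y)) (c : k) :
  pullr oT (scal Y c) = scal T c :> sect (setT : set T).
Proof.
have o : opensub (h @^-1` setT) setT by apply: opensub_refl; exact: openT.
rewrite pullrE (pullf_global oT _ (opensubT oV) o) phi_scal; exact: restr_id.
Qed.

Lemma affine_morphism_exists : exists (H : morphism T Y) (HV : forall t, V (H t)),
  global_pull aV HV =1 phi.
Proof.
exists (@Morphism k T Y h h_continuous pullr pullr_restr pullr_local pullr_scal), hV => s.
rewrite /global_pull /= pullrE (pullf_global _ s (opensub_refl oV) (opensubT (h_open oV))).
rewrite restr_id (restr_comp _ _ (opensub_refl openT)); exact: restr_id.
Qed.

End AffineAdjunction.

(** * Spectra of rings of functions *)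

(* The scheme attached to the ring of functions [ev z a / ev z e ^+ m] on a set [Z] of
   points with values in [k]: such a ring being reduced, sections can be encoded as
   functions on the [k]-valued points instead of families of germs. *)
Section SpecPoints.
Variables (k : fieldType) (A : comNzRingType) (Z : Type) (ev : Z -> {rmorphism A -> k}) (e : A).

Definition spec_pt : Type :=
  {P : set A | [/\ prime_ideal P, forall a, (forall z, ev z a = 0) -> P a & ~ P e]}.

HB.instance Definition _ := gen_eqMixin spec_pt.
HB.instance Definition _ := gen_choiceMixin spec_pt.

Definition in_pt (p : spec_pt) : set A := sval p.
Definition spec_open (U : set spec_pt) : Prop :=
  forall p, U p -> exists g, ~ in_pt p g /\ forall q, ~ in_pt q g -> U q.

Lemma pt_prime p : prime_ideal (in_pt p). Proof. by have [] := svalP p. Qed.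
Lemma pt_vanish p a : (forall z, ev z a = 0) -> in_pt p a.
Proof. by have [_ + _] := svalP p; exact. Qed.
Lemma pt_e p : ~ in_pt p e. Proof. by have [] := svalP p. Qed.
Lemma pt_mul p a b : ~ in_pt p a -> ~ in_pt p b -> ~ in_pt p (a * b).
Proof. by move=> na nb; have [_ _ _ _ pM] := pt_prime p; case/pM. Qed.
Lemma pt_mull p a b : ~ in_pt p (a * b) -> ~ in_pt p a.
Proof. by apply: contra_not => pa; apply: ideal_mulr pa; exact: prime_is_ideal (pt_prime p). Qed.
Lemma pt_mulr p a b : ~ in_pt p (a * b) -> ~ in_pt p b.
Proof. by rewrite mulrC; exact: pt_mull. Qed.
Lemma pt_one p : ~ in_pt p 1. Proof. by have [_ _ _ p1 _] := pt_prime p. Qed.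

Lemma pt_ext p q : (forall a, in_pt p a <-> in_pt q a) -> p = q.
Proof.
by case: p q => [P hP] [Q hQ] E; apply: eq_exist; apply/seteqP; split=> a /E.
Qed.

Let opT : spec_open setT.
Proof. by move=> p _; exists 1; split=> //; exact: pt_one. Qed.

Let opI : setI_closed spec_open.
Proof.
move=> U V oU oV p [Up Vp]; have [g [pg gU]] := oU p Up; have [h [ph hV]] := oV p Vp.
exists (g * h); split; first exact: pt_mul.
by move=> q qgh; split; [apply: gU; exact: pt_mull qgh | apply: hV; exact: pt_mulr qgh].
Qed.

Let op_bigU (I : Type) (F : I -> set spec_pt) : (forall i, spec_open (F i)) ->
  spec_open (\bigcup_i F i).
Proof.
by move=> oF p [i _ Fp]; have [g [pg gF]] := oF i p Fp; exists g; split=> // q qg;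
  exists i => //; exact: gF.
Qed.

HB.instance Definition _ := isOpenTopological.Build spec_pt opT opI op_bigU.

Lemma spec_openE (U : set spec_pt) : open U <-> spec_open U.
Proof.
split; last by move=> oU; rewrite openE => p Up; exists U; split.
rewrite openE => oU p /oU[V [oV Vp VU]].
by have [g [pg gV]] := oV p Vp; exists g; split=> // q qg; apply: VU; exact: gV.
Qed.

Definition principal_open (g : A) : set spec_pt := [set p | ~ in_pt p g].

Lemma principal_open_open g : open (principal_open g).
Proof. by apply/spec_openE => p pg; exists g. Qed.

Hypothesis ev_e : forall z, ev z e != 0.

Lemma closed_pt_subproof z : [/\ prime_ideal [set a | ev z a = 0],
  forall a, (forall z, ev z a = 0) -> ev z a = 0 & ~ ev z e = 0].
Proof.
split=> //; last exact/eqP.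
split=> /=.
- exact: rmorph0.
- by move=> a b ea eb; rewrite rmorphD ea eb addr0.
- by move=> a b eb; rewrite rmorphM eb mulr0.
- by rewrite rmorph1; apply/eqP; exact: oner_neq0.
- by move=> a b /eqP; rewrite rmorphM mulf_eq0 => /orP[/eqP|/eqP]; [left|right].
Qed.

Definition closed_pt z : spec_pt := exist _ _ (closed_pt_subproof z).

Lemma in_closed_pt z a : in_pt (closed_pt z) a <-> ev z a = 0.
Proof. by []. Qed.

Definition pts_in (U : set spec_pt) : Type := {z : Z | U (closed_pt z)}.

Definition frac_at (U : set spec_pt) (s : pts_in U -> k) (p : spec_pt) (a g : A) : Prop :=
  ~ in_pt p g /\ forall z, ev (sval z) g != 0 -> s z * ev (sval z) g = ev (sval z) a.

Definition is_section (U : set spec_pt) : pred (pts_in U -> k) :=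
  fun s => `[< forall p, U p -> exists a g, frac_at s p a g >].

Lemma is_section_subring U : subring_closed (@is_section U).
Proof.
split.
- apply/asboolP => p Up; exists 1, 1; split; first exact: pt_one.
  by move=> z _; rewrite mul1r.
- move=> s t /asboolP ss /asboolP st; apply/asboolP => p Up.
  have [a [g [pg sE]]] := ss p Up; have [b [h [ph tE]]] := st p Up.
  exists (a * h - g * b), (g * h); split; first exact: pt_mul.
  move=> z; rewrite !rmorphM mulf_eq0 negb_or => /andP[gz hz].
  by rewrite rmorphB !rmorphM -sE // -tE // -[(s - t) z]/(s z - t z); ring.
- move=> s t /asboolP ss /asboolP st; apply/asboolP => p Up.
  have [a [g [pg sE]]] := ss p Up; have [b [h [ph tE]]] := st p Up.
  exists (a * b), (g * h); split; first exact: pt_mul.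
  move=> z; rewrite !rmorphM mulf_eq0 negb_or => /andP[gz hz].
  by rewrite -sE // -tE // -[(s * t) z]/(s z * t z); ring.
Qed.

Definition spec_sect (U : set spec_pt) : Type := {s : pts_in U -> k | is_section s}.

HB.instance Definition _ U := [isSub of spec_sect U for (@sval _ _)].
HB.instance Definition _ U := [Choice of spec_sect U by <:].
HB.instance Definition _ U := GRing.SubChoice_isSubComPzRing.Build _ _ (spec_sect U)
  (is_section_subring U).

Definition incl U V (VU : V `<=` U) (z : pts_in V) : pts_in U := exist _ (sval z) (VU _ (svalP z)).

Lemma pts_in_ext U (z z' : pts_in U) : sval z = sval z' -> z = z'.
Proof. by case: z z' => [z zU] [z' z'U] /= E; apply: eq_exist. Qed.

Definition mk_sect U (s : pts_in U -> k) (sS : is_section s) : spec_sect U :=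
  exist (fun s : pts_in U -> k => is_section s) s sS.

Lemma spec_sect_ext U (s t : spec_sect U) : (forall z, val s z = val t z) -> s = t.
Proof. by move=> E; apply: val_inj; apply/funext. Qed.

Lemma spec_sectP U (s : spec_sect U) p : U p -> exists a g, frac_at (val s) p a g.
Proof. by have /asboolP := valP s; exact. Qed.

Lemma restr_subproof U V (VU : V `<=` U) (s : spec_sect U) : is_section (val s \o incl VU).
Proof.
apply/asboolP => p /VU /(spec_sectP s)[a [g [pg sE]]]; exists a, g; split=> // z zg.
exact: (sE (incl VU z)).
Qed.

Definition spec_restr_fun V U (h : opensub V U) (s : spec_sect U) : spec_sect V :=
  mk_sect (restr_subproof (opensub_sub h) s).

Lemma spec_restr_nmod V U (h : opensub V U) : nmod_morphism (spec_restr_fun h).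
Proof. by split=> [|s t]; apply: spec_sect_ext. Qed.

Lemma spec_restr_monoid V U (h : opensub V U) : monoid_morphism (spec_restr_fun h).
Proof. by split=> [|s t]; apply: spec_sect_ext. Qed.

HB.instance Definition _ V U (h : opensub V U) :=
  GRing.isNmodMorphism.Build (spec_sect U) (spec_sect V) (spec_restr_fun h) (spec_restr_nmod h).
HB.instance Definition _ V U (h : opensub V U) :=
  GRing.isMonoidMorphism.Build (spec_sect U) (spec_sect V) (spec_restr_fun h) (spec_restr_monoid h).

Definition spec_restr V U (h : opensub V U) : {rmorphism spec_sect U -> spec_sect V} :=
  spec_restr_fun h.

Lemma spec_restr_id U (h : opensub U U) (s : spec_sect U) : spec_restr h s = s.
Proof. by apply: spec_sect_ext => z; congr (val s); exact: pts_in_ext. Qed.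

Lemma spec_restr_comp W V U (hWV : opensub W V) (hVU : opensub V U) (hWU : opensub W U) s :
  spec_restr hWV (spec_restr hVU s) = spec_restr hWU s.
Proof. by apply: spec_sect_ext => z; congr (val s); exact: pts_in_ext. Qed.

Lemma spec_locality (I : Type) (V : I -> set spec_pt) (U : set spec_pt)
    (h : forall i, opensub (V i) U) : U `<=` \bigcup_i V i ->
  forall s t : spec_sect U, (forall i, spec_restr (h i) s = spec_restr (h i) t) -> s = t.
Proof.
move=> cover s t E; apply: spec_sect_ext => z.
have [i _ Vz] := cover _ (svalP z).
have := congr1 (fun r => val r (exist _ (sval z) Vz)) (E i).
rewrite /= /spec_restr_fun /= (_ : incl _ _ = z) //; exact: pts_in_ext.
Qed.

Lemma spec_gluing (I : Type) (V : I -> set spec_pt) (U : set spec_pt)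
    (h : forall i, opensub (V i) U) : U `<=` \bigcup_i V i ->
  forall s : (forall i, spec_sect (V i)),
    (forall i j (hi : opensub (V i `&` V j) (V i)) (hj : opensub (V i `&` V j) (V j)),
      spec_restr hi (s i) = spec_restr hj (s j)) ->
    exists t : spec_sect U, forall i, spec_restr (h i) t = s i.
Proof.
move=> cover s compat.
have pick (z : pts_in U) : {i | V i (closed_pt (sval z))}.
  by apply: cid; have [i _ Vz] := cover _ (svalP z); exists i.
pose tf (z : pts_in U) := val (s (sval (pick z))) (exist _ (sval z) (svalP (pick z))).
have tE (z : pts_in U) i (Vz : V i (closed_pt (sval z))) : tf z = val (s i) (exist _ (sval z) Vz).
  rewrite /tf; move: (sval (pick z)) (svalP (pick z)) => j Vj.
  have oi := opensub_open (h i); have oj := opensub_open (h j).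
  have := congr1 (fun r => val r (exist _ (sval z) (conj Vj Vz))) (compat j i (opensubIl oj oi)
    (opensubIr oj oi)).
  rewrite /= /spec_restr_fun /= (_ : incl _ _ = exist _ (sval z) Vj); last exact: pts_in_ext.
  by rewrite (_ : incl _ _ = exist _ (sval z) Vz) //; exact: pts_in_ext.
have tS : is_section tf.
  apply/asboolP => p Up; have [i _ Vp] := cover p Up.
  have [a [g [pg sE]]] := spec_sectP (s i) Vp.
  have /spec_openE/(_ p Vp)[g0 [pg0 g0V]] := opensub_open (h i).
  exists (a * g0), (g * g0); split; first exact: pt_mul.
  move=> z; rewrite !rmorphM mulf_eq0 negb_or => /andP[gz g0z].
  have Vz : V i (closed_pt (sval z)) by apply: g0V; exact/eqP.
  by rewrite (tE z i Vz) mulrA (sE (exist _ (sval z) Vz)).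
exists (mk_sect tS) => i; apply: spec_sect_ext => z /=.
rewrite (tE (incl (opensub_sub (h i)) z) i (svalP z)) /=; congr (val (s i)); exact: pts_in_ext.
Qed.

Definition spec_ringed : ringedSpace :=
  @RingedSpace spec_pt spec_sect spec_restr spec_restr_id spec_restr_comp
    spec_locality spec_gluing.

Let is_section_const U a g : (forall z : pts_in U, ev (sval z) g != 0) ->
  (forall p, U p -> ~ in_pt p g) -> is_section (fun z : pts_in U => ev (sval z) a / ev (sval z) g).
Proof.
move=> gz gp; apply/asboolP => p Up; exists a, g; split; first exact: gp.
by move=> z _; rewrite divfK.
Qed.

Definition spec_fraction U a g gz gp : spec_sect U := mk_sect (@is_section_const U a g gz gp).

(** If [s = a / g] has the inverse [a' / g'] near [p], then [a * a' - g * g'], multiplied by the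
    denominators and by some [g0] supported in the neighbourhood, vanishes at all points of [Z],
    hence lies in [p]. Conversely [g / a] is an inverse where [a * g] is nonzero. *)
Lemma spec_unit_at (p : spec_ringed) (U : set spec_ringed) (s : sect U) a g :
  open U -> U p -> frac_at (val (s : spec_sect U)) p a g -> unit_at p s <-> ~ in_pt p a.
Proof.
move=> oU Up [pg sE]; split.
  move=> [V [h [Vp [b sb]]]].
  have [a' [g' [pg' bE]]] := spec_sectP (b : spec_sect V) Vp.
  have /spec_openE/(_ p Vp)[g0 [pg0 g0V]] := opensub_open h.
  have px : in_pt p (g0 * g * g' * (a * a' - g * g')).
    apply: pt_vanish => z; rewrite !rmorphM rmorphB !rmorphM.
    have [->|g0z] := eqVneq (ev z g0) 0; first by rewrite !mul0r.
    have [->|gz] := eqVneq (ev z g) 0; first by rewrite !(mulr0, mul0r).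
    have [->|g'z] := eqVneq (ev z g') 0; first by rewrite !(mulr0, mul0r).
    have Vz : V (closed_pt z) by apply: g0V; exact/eqP.
    have E1 := sE (incl (opensub_sub h) (exist _ z Vz)) gz.
    have E2 := bE (exist _ z Vz) g'z.
    have E3 := congr1 (fun r => val (r : spec_sect V) (exist _ z Vz)) sb.
    rewrite -E1 -E2 /= mulrACA.
    rewrite (_ : val (s : spec_sect U) _ * val (b : spec_sect V) _ = 1); last exact: E3.
    by rewrite mul1r subrr mulr0.
  have [_ _ _ _ pM] := pt_prime p.
  case: (pM _ _ px) => [pggg|px2]; first by case: (pt_mul (pt_mul pg0 pg) pg' pggg).
  move=> pa; apply: (pt_mul pg pg').
  have idp := prime_is_ideal (pt_prime p).
  by rewrite -[_ * _](subKr (a * a')); apply: (idealB idp) => //; exact: (ideal_mulr idp).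
move=> pa; pose V := U `&` principal_open (a * g).
have oV : open V by apply: openI => //; exact: principal_open_open.
have hV : opensub V U by split=> // x [].
exists V, hV; split; first by split=> //; exact: pt_mul.
have agz (z : pts_in V) : ev (sval z) a != 0 /\ ev (sval z) g != 0.
  have [_] := svalP z; rewrite /principal_open /= => /eqP.
  by rewrite rmorphM mulf_eq0 negb_or => /andP[].
have gp q : V q -> ~ in_pt q a by move=> [_]; exact: pt_mull.
exists (@spec_fraction V g a (fun z => (agz z).1) gp).
apply: spec_sect_ext => z; rewrite -[RHS]/(1 : k).
have [az gz] := agz z.
have E1 := sE (incl (opensub_sub hV) z) gz.
rewrite -[LHS]/(val (s : spec_sect U) (incl (opensub_sub hV) z) * (ev (sval z) g / ev (sval z) a)).
by rewrite mulrA E1 divff.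
Qed.

Lemma spec_stalk_nonzero (x : spec_ringed) : ~ unit_at x (0 : sect (setT : set spec_ringed)).
Proof.
have F : frac_at (val (0 : spec_sect setT)) x 0 1.
  split; first exact: pt_one.
  by move=> z _; rewrite -[val _ z]/(0 : k) mul0r rmorph0.
move=> /(spec_unit_at openT I F); apply; apply: ideal0; exact: prime_is_ideal (pt_prime x).
Qed.

Lemma spec_stalk_local (x : spec_ringed) (U : set spec_ringed) (s t : sect U) :
  unit_at x (s + t) -> unit_at x s \/ unit_at x t.
Proof.
move=> us; have Ux := unit_at_mem us; have oU := unit_at_openl us.
have [a [g Fs]] := spec_sectP (s : spec_sect U) Ux.
have [b [h Ft]] := spec_sectP (t : spec_sect U) Ux.
have F : frac_at (val (s + t : spec_sect U)) x (a * h + b * g) (g * h).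
  split; first by apply: pt_mul; [case: Fs | case: Ft].
  move=> z; rewrite !rmorphM mulf_eq0 negb_or => /andP[gz hz].
  rewrite (rmorphD (ev (sval z))) !rmorphM -(Fs.2 z gz) -(Ft.2 z hz).
  rewrite -[val _ z]/(val (s : spec_sect U) z + val (t : spec_sect U) z); ring.
move/(spec_unit_at oU Ux F): us => nab.
apply: contrapT => /not_orP[ns nt]; apply: nab.
have idx := prime_is_ideal (pt_prime x).
have pa : in_pt x a by apply: contrapT => /(spec_unit_at oU Ux Fs).
have pb : in_pt x b by apply: contrapT => /(spec_unit_at oU Ux Ft).
by apply: (idealD idx); exact: (ideal_mulr idx).
Qed.

Definition spec_lrs : locallyRingedSpace := LocallyRingedSpace spec_stalk_nonzero spec_stalk_local.

Let is_section_global a : is_section (fun z : pts_in setT => ev (sval z) a).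
Proof.
apply/asboolP => p _; exists a, 1; split; first exact: pt_one.
by move=> z _; rewrite rmorph1 mulr1.
Qed.

Definition spec_global_fun a : spec_sect setT := mk_sect (@is_section_global a).

Lemma spec_global_nmod : nmod_morphism spec_global_fun.
Proof. by split=> [|a b]; apply: spec_sect_ext => z; rewrite /= ?rmorph0 ?rmorphD. Qed.

Lemma spec_global_monoid : monoid_morphism spec_global_fun.
Proof. by split=> [|a b]; apply: spec_sect_ext => z; rewrite /= ?rmorph1 ?rmorphM. Qed.

HB.instance Definition _ := GRing.isNmodMorphism.Build A (spec_sect setT) spec_global_fun
  spec_global_nmod.
HB.instance Definition _ := GRing.isMonoidMorphism.Build A (spec_sect setT) spec_global_fun
  spec_global_monoid.

Definition spec_global : {rmorphism A -> spec_sect setT} := spec_global_fun.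

Lemma unit_at_spec_global (p : spec_ringed) a :
  unit_at p (spec_global a : sect (setT : set spec_ringed)) <-> ~ in_pt p a.
Proof.
apply: (@spec_unit_at p setT (spec_global a) a 1 openT I); split; first exact: pt_one.
by move=> z _; rewrite rmorph1 mulr1.
Qed.

Lemma spec_global_eq0 a : spec_global a = 0 -> forall z, ev z a = 0.
Proof. by move=> a0 z; have := congr1 (fun s => val s (exist _ z I)) a0. Qed.

Lemma spec_global_e_invertible : invertible (spec_global e).
Proof.
have ez (z : pts_in setT) : ev (sval z) e != 0 by [].
exists (@spec_fraction setT 1 e ez (fun p _ => pt_e (p := p))).
by apply: spec_sect_ext => z; rewrite -[LHS]/(ev (sval z) e * (ev (sval z) 1 /
  ev (sval z) e)) rmorph1 mul1r divff.
Qed.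

(* As the functions are evaluated at points, [g ^+ 2 * t] is globally [g * a] as soon
   as [t = a / g] where [g] does not vanish. *)
Lemma spec_denominator (b : A) (U : set spec_pt) (t : spec_sect U) : U = principal_open b ->
  exists m c, forall z : pts_in U, (ev (sval z) b * ev (sval z) e) ^+ m * val t z = ev (sval z) c.
Proof.
move=> UE.
(* The ideal of global denominators of [t]. A prime containing it but not [b * e] would be a point
   of [U], near which [t] is a fraction. *)
pose J : set A := [set g | exists c, forall z : pts_in U, ev (sval z) g * val t z = ev (sval z) c].
have idJ : is_ideal J.
  split; first by exists 0 => z; rewrite !rmorph0 mul0r.
  - by move=> g h [c gc] [d hd]; exists (c + d) => z; rewrite !rmorphD mulrDl gc hd.
  - by move=> g h [d hd]; exists (g * d) => z; rewrite !rmorphM -mulrA hd.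
suff [m [c mc]] : exists m, J ((b * e) ^+ m).
  by exists m, c => z; rewrite -rmorphM -rmorphXn; exact: mc.
apply: contrapT => /forallNP /(prime_avoiding idJ)[P [primeP JP nbe _]].
have idP := prime_is_ideal primeP.
have [nb ne] : ~ P b /\ ~ P e.
  by split=> Px; apply: nbe; [exact: (ideal_mulr idP) | exact: (ideal_mull idP)].
have vP a : (forall z, ev z a = 0) -> P a.
  by move=> va; apply: JP; exists 0 => z; rewrite va mul0r rmorph0.
pose p : spec_pt := exist _ P (And3 primeP vP ne).
have Up : U p by rewrite UE.
have [a [g [pg tE]]] := spec_sectP t Up.
apply: pg; apply: (@prime_expr _ P g 2) => //; apply: JP.
exists (g * a) => z; rewrite rmorphXn rmorphM expr2 -mulrA.
have [->|gz] := eqVneq (ev (sval z) g) 0; first by rewrite !mul0r.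
by rewrite [ev _ g * val t z]mulrC tE.
Qed.

Lemma spec_global_frac (s : spec_sect setT) : exists m c, spec_global e ^+ m * s = spec_global c.
Proof.
have T1 : setT = principal_open 1 by apply/seteqP; split=> // p _; exact: pt_one.
have [m [c sE]] := spec_denominator s T1.
exists m, c; apply: spec_sect_ext => z; rewrite -rmorphXn.
rewrite -[LHS]/(ev (sval z) (e ^+ m) * val s z) rmorphXn -[ev _ e]mul1r -[1](rmorph1 (ev (sval z))).
exact: sE.
Qed.

Lemma unit_at_frac (p : spec_ringed) (s : spec_sect setT) m c : spec_global e ^+ m * s =
  spec_global c ->
  unit_at p (s : sect (setT : set spec_ringed)) <-> ~ in_pt p c.
Proof.
move=> sE; rewrite -unit_at_spec_global -sE; split; last exact: unit_at_mull.
apply: unit_atM; apply: unit_atX.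
exact: (@invertible_unit_at spec_ringed setT _ p openT I spec_global_e_invertible).
Qed.

Lemma spec_affine : @affine_open spec_lrs setT.
Proof.
split.
- exact: openT.
- move=> p q _ _ E; apply: pt_ext => a; rewrite -[X in X <-> _]notK -[X in _ <-> X]notK.
  by split; apply: contra_not => /unit_at_spec_global/E/unit_at_spec_global.
- move=> P primeP; have idP := prime_is_ideal primeP; have [_ _ _ P1 PM] := primeP.
  have nPe : ~ P (spec_global e).
    by have [e' ee'] := spec_global_e_invertible; move=> Pe; have := ideal_mulr idP e' Pe;
      rewrite ee'.
  have primep : prime_ideal [set a | P (spec_global a)].
    split=> /=; first by rewrite rmorph0; exact: ideal0.
    + by move=> a b; rewrite rmorphD; exact: idealD.
    + by move=> a b; rewrite rmorphM; exact: ideal_mull.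
    + by rewrite rmorph1.
    + by move=> a b; rewrite rmorphM; exact: PM.
  have vp a : (forall z, ev z a = 0) -> P (spec_global a).
    move=> va; rewrite (_ : spec_global a = 0); first exact: ideal0.
    by apply: spec_sect_ext => z; exact: va.
  exists (exist _ _ (And3 primep vp nPe) : spec_pt) => // s.
  have [m [c sE]] := spec_global_frac s.
  rewrite (unit_at_frac _ sE) notK -[in_pt _ c]/(P (spec_global c)) -sE; split.
    exact: ideal_mull.
  by move=> /PM[] // /(prime_expr primeP).
- move=> W p [oW _ _] Wp; have /spec_openE/(_ p Wp)[g [pg gW]] := oW.
  exists (spec_global g); split; first exact/unit_at_spec_global.
  by move=> q /unit_at_spec_global; exact: gW.
- move=> s h t; have [j [b sE]] := spec_global_frac s.
  have bE : basic_open (s : sect (setT : set spec_ringed)) = principal_open b.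
    by apply/seteqP; split=> q /(unit_at_frac q sE).
  have [m [c mcE]] := spec_denominator t bE.
  have [e' ee'] := spec_global_e_invertible.
  (* Here [e ^+ j * s = b] and [(b * e) ^+ m * t = c], so the inverse [e'] of [e] has to compensate
     [e ^+ ((j + 1) * m)]. *)
  exists (spec_global c * e' ^+ ((j + 1) * m)), m.
  apply: spec_sect_ext => z.
  have zE (x y : spec_sect setT) : x = y ->
    val x (incl (opensub_sub h) z) = val y (incl (opensub_sub h) z) by move=> ->.
  have e1 : ev (sval z) e * val e' (incl (opensub_sub h) z) = 1 := zE _ _ ee'.
  have s1 : ev (sval z) (e ^+ j) * val s (incl (opensub_sub h) z) = ev (sval z) b.
    have := zE _ _ sE; rewrite -rmorphXn; exact.
  have vX (x : spec_sect setT) i w : val (x ^+ i) w = val x w ^+ i.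
    by elim: i => [//|i IH]; rewrite !exprS -IH.
  have -> : val (restr h s ^+ m * t : spec_sect _) z = val s (incl (opensub_sub h) z) ^+ m *
    val (t : spec_sect _) z.
    by rewrite -vX -rmorphXn.
  rewrite -[RHS]/(ev (sval z) c * val (e' ^+ ((j + 1) * m)) (incl (opensub_sub h) z)) vX.
  rewrite -mcE -s1 rmorphXn.
  set E := ev _ e in e1 *; set E' := val e' _ in e1 *; set S := val s _.
  rewrite mulrAC -[LHS]mul1r mulrA; congr (_ * _).
  by rewrite mulrAC -exprSr -addn1 exprMn -!exprM mulrAC -exprMn e1 expr1n.
(* One factor [s] is enough: sections are functions, and a point where [s] is nonzero lies in the
   open set on which [a] vanishes. *)
- move=> s h a a0; exists 1%N; rewrite expr1; apply: spec_sect_ext => z.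
  rewrite -[LHS]/(val (s : spec_sect setT) z * val (a : spec_sect setT) z) -[RHS]/(0 : k).
  have [->|sz] := eqVneq (val s z) 0; first by rewrite mul0r.
  have sz' : basic_open (s : sect (setT : set spec_ringed)) (closed_pt (sval z)).
    have [j [b sE]] := spec_global_frac s.
    apply/(unit_at_frac _ sE) => /in_closed_pt bz.
    have := congr1 (fun r => val r z) sE; rewrite -rmorphXn => E.
    have {E} : ev (sval z) (e ^+ j) * val s z = ev (sval z) b by exact: E.
    by move/eqP; rewrite bz mulf_eq0 rmorphXn expf_eq0 (negbTE (ev_e _)) (negbTE sz) andbF.
  have a0' (w : pts_in (basic_open (s : sect (setT : set spec_ringed)))) :
    val (spec_restr h a) w = 0 by rewrite -[spec_restr h a]/(restr h a) a0.
  have := a0' (exist _ (sval z) sz').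
  rewrite -[LHS]/(val (a : spec_sect setT) (incl (opensub_sub h) (exist _ (sval z) sz'))).
  rewrite (_ : incl _ _ = z); last exact: pts_in_ext.
  by move=> ->; rewrite mulr0.
Qed.

End SpecPoints.

(** Each [s] is sent to [psi c / psi e ^+ m] for a chosen fraction; [FE] shows that the choice is
    immaterial, which also gives additivity and multiplicativity. *)
Lemma localization_lift (A S B : comPzRingType) (theta : {rmorphism A -> S})
    (psi : {rmorphism A -> B}) e :
  (forall s, exists m c, theta e ^+ m * s = theta c) ->
  (forall a, theta a = 0 -> psi a = 0) -> invertible (psi e) ->
  exists phi : {rmorphism S -> B}, forall a, phi (theta a) = psi a.
Proof.
move=> frac ker [b eb].
have /choice[nf nfP] (s : S) : exists mc : nat * A, theta e ^+ mc.1 * s = theta mc.2.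
  by have [m [c E]] := frac s; exists (m, c).
pose F s := psi (nf s).2 * b ^+ (nf s).1.
have FE s m c : theta e ^+ m * s = theta c -> F s = psi c * b ^+ m.
  move=> E; have /eqP : psi (e ^+ m * (nf s).2) = psi (e ^+ (nf s).1 * c).
    apply/eqP; rewrite -subr_eq0 -rmorphB; apply/eqP/ker.
    rewrite rmorphB !rmorphM !rmorphXn -nfP -E; ring.
  move=> /eqP; rewrite !rmorphM !rmorphXn => E'.
  have bX i : b ^+ i * psi e ^+ i = 1 by rewrite -exprMn mulrC mulrC [b * _]mulrC eb expr1n.
  rewrite /F -[LHS]mul1r -(bX m) -[RHS]mul1r -(bX (nf s).1).
  have -> : b ^+ m * psi e ^+ m * (psi (nf s).2 * b ^+ (nf s).1)
     = b ^+ m * b ^+ (nf s).1 * (psi e ^+ m * psi (nf s).2) by ring.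
  by rewrite E'; ring.
have Fn : nmod_morphism F.
  split=> [|s t]; first by rewrite (FE _ 0%N 0) ?rmorph0 ?mulr0 ?mul0r.
  rewrite (FE (s + t) ((nf s).1 + (nf t).1)%N (e ^+ (nf t).1 * (nf s).2 +
    e ^+ (nf s).1 * (nf t).2)).
    have bX i : psi e ^+ i * b ^+ i = 1 by rewrite -exprMn eb expr1n.
    rewrite rmorphD !rmorphM !rmorphXn mulrDl exprD /F; congr (_ + _).
      by rewrite -[RHS]mul1r -(bX (nf t).1); ring.
    by rewrite -[RHS]mul1r -(bX (nf s).1); ring.
  by rewrite rmorphD !rmorphM !rmorphXn -!nfP exprD; ring.
have Fm : monoid_morphism F.
  split=> [|s t]; first by rewrite (FE _ 0%N 1) ?rmorph1 ?mulr1 ?expr0 ?mul1r.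
  rewrite (FE (s * t) ((nf s).1 + (nf t).1)%N ((nf s).2 * (nf t).2)).
    by rewrite rmorphM exprD /F; ring.
  by rewrite rmorphM -!nfP exprD; ring.
pose F1 := GRing.isNmodMorphism.Build _ _ _ Fn.
pose F2 := GRing.isMonoidMorphism.Build _ _ _ Fm.
pose phi : {rmorphism S -> B} := HB.pack F F1 F2.
exists phi => a; rewrite -[LHS]/(F (theta a)) (FE _ 0%N a) ?expr0 ?mul1r //.
by rewrite mulr1.
Qed.

Lemma localization_ext (A S B : comPzRingType) (theta : {rmorphism A -> S})
    (phi phi' : {rmorphism S -> B}) e :
  (forall s, exists m c, theta e ^+ m * s = theta c) -> invertible (phi (theta e)) ->
  (forall a, phi (theta a) = phi' (theta a)) -> phi =1 phi'.
Proof.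
move=> frac ie E s; have [m [c sE]] := frac s.
apply: (invertible_inj (invertibleX m ie)).
by rewrite [in RHS]E -(rmorphXn phi) -(rmorphXn phi') -!rmorphM sE E.
Qed.

(** Evaluation at [t] is an explicit sum over coefficients, as the target may be the zero ring. *)
Lemma poly_lift (R : comNzRingType) (B : comPzRingType) (psi : {rmorphism R -> B}) t :
  exists phi : {rmorphism {poly R} -> B}, (forall c, phi c%:P = psi c) /\ phi 'X = t.
Proof.
pose F (p : {poly R}) := \sum_(i < size p) psi p`_i * t ^+ i.
have FE (p : {poly R}) m : (size p <= m)%N -> F p = \sum_(i < m) psi p`_i * t ^+ i.
  move=> pm; rewrite /F (big_ord_widen _ (fun i => psi p`_i * t ^+ i) pm) big_mkcond /=.
  apply: eq_bigr => i _; case: ltnP => // mi.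
  by rewrite nth_default // rmorph0 mul0r.
have FC c : F c%:P = psi c.
  by rewrite (FE _ 1%N) ?size_polyC_leq1 // big_ord1 coefC mulr1.
have FD p q : F (p + q) = F p + F q.
  pose m := maxn (size p) (size q).
  rewrite (FE p m) ?leq_maxl // (FE q m) ?leq_maxr // (FE (p + q) m) ?size_polyD //.
  by rewrite -big_split; apply: eq_bigr => i _; rewrite /= coefD rmorphD mulrDl.
have FX p : F (p * 'X) = F p * t.
  rewrite (FE _ (size p).+1); last first.
    by apply: leq_trans (size_polyMleq _ _) _; rewrite size_polyX addn2.
  rewrite big_ord_recl /= coefMX rmorph0 mul0r add0r /F mulr_suml.
  by apply: eq_bigr => i _; rewrite coefMX /= exprSr mulrA.
have FZ c p : F (c%:P * p) = psi c * F p.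
  rewrite (FE _ (size p)) ?mul_polyC ?size_scale_leq // mulr_sumr.
  by apply: eq_bigr => i _; rewrite coefZ rmorphM mulrA.
have FM p q : F (p * q) = F p * F q.
  elim/poly_ind: p => [|p c IH]; first by rewrite mul0r -[0 : {poly R}]polyC0 FC rmorph0 mul0r.
  by rewrite mulrDl FD FZ mulrAC FX IH FD FX FC mulrDl mulrAC.
have Fn : nmod_morphism F by split=> //; rewrite -polyC0 FC rmorph0.
have Fm : monoid_morphism F by split=> //; rewrite -polyC1 FC rmorph1.
pose F1 := GRing.isNmodMorphism.Build _ _ _ Fn.
pose F2 := GRing.isMonoidMorphism.Build _ _ _ Fm.
pose phi : {rmorphism {poly R} -> B} := HB.pack F F1 F2.
exists phi; split=> //; rewrite -[LHS]/(F 'X) -['X]mul1r FX -polyC1 FC rmorph1; exact: mul1r.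
Qed.

Lemma poly_rmorph_ext (R : comNzRingType) (B : comPzRingType) (phi phi' : {rmorphism {poly R} ->
  B}) :
  (forall c, phi c%:P = phi' c%:P) -> phi 'X = phi' 'X -> phi =1 phi'.
Proof.
move=> EC EX; elim/poly_ind => [|p c IH]; first by rewrite !rmorph0.
by rewrite !rmorphD !rmorphM IH EX EC.
Qed.

Section MorphismComposition.
Variable k : fieldType.

Lemma comp_id_morphism (X Y : scheme k) (h : morphism X Y) : comp_morphism (id_morphism Y) h = h.
Proof.
apply: morphism_ext => // _ W oW s t Wt; have o := open_preimage h oW.
exists (h @^-1` W), (opensub_refl o), (opensub_refl o); split; first exact/set_mem.
rewrite /= (_ : open_preimage (id_morphism Y) oW = oW);
  [exact: restr_irr | exact: Prop_irrelevance].
Qed.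

Lemma comp_morphism_id (X Y : scheme k) (h : morphism X Y) : comp_morphism h (id_morphism X) = h.
Proof.
apply: morphism_ext => // _ W oW s t Wt; have o := open_preimage h oW.
exists (h @^-1` W), (opensub_refl o), (opensub_refl o); split; first exact/set_mem.
exact: restr_irr.
Qed.

Lemma comp_morphismA (X Y Z W : scheme k) (h3 : morphism Z W) (h2 : morphism Y Z) (h1 : morphism
  X Y) :
  comp_morphism h3 (comp_morphism h2 h1) = comp_morphism (comp_morphism h3 h2) h1.
Proof.
apply: morphism_ext => // _ U oU s t Ut.
have o := open_preimage (comp_morphism h3 (comp_morphism h2 h1)) oU.
exists (comp_morphism h3 (comp_morphism h2 h1) @^-1` U), (opensub_refl o), (opensub_refl o).
split; first exact/set_mem.
rewrite /= (Prop_irrelevance (open_preimage (comp_morphism h3 h2) oU) (open_preimage h2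
  (open_preimage h3 oU))).
exact: restr_irr.
Qed.

Lemma universal_homeomorphism_homeo (X Y : scheme k) (h : morphism Y X) :
  universal_homeomorphism h -> homeomorphism h.
Proof.
move=> uh; apply: (uh X Y (id_morphism X) h (id_morphism Y)).
split; first by rewrite comp_id_morphism comp_morphism_id.
move=> T a b; rewrite comp_id_morphism => ->.
exists b; split; first by rewrite comp_id_morphism.
by move=> c [_]; rewrite comp_id_morphism.
Qed.

(** A base change of the identity is an isomorphism: the universal property yields a section of
    [f'], and its uniqueness clause shows that it is a two-sided inverse. *)
Lemma id_universal_homeomorphism (X : scheme k) : universal_homeomorphism (id_morphism X).
Proof.
move=> X' Y' g f' g' [comm univ].
have [c [[f'c g'c] _]] := univ X' (id_morphism X') g (etrans (comp_morphism_id g) (esym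
  (comp_id_morphism g))).
have [w [_ wE]] := univ Y' f' g' comm.
have E1 := wE (id_morphism Y') (conj (comp_morphism_id _) (comp_morphism_id _)).
have E2 : w = comp_morphism c f'.
  apply: wE; rewrite !comp_morphismA f'c g'c comp_id_morphism; split=> //.
  by rewrite comm comp_id_morphism.
exists c; split.
- by move=> y; rewrite -[LHS]/(comp_morphism c f' y) -E2 E1.
- by move=> x; rewrite -[LHS]/(comp_morphism f' c x) f'c.
- exact: mfun_continuous.
- exact: mfun_continuous.
Qed.

End MorphismComposition.

Section GlobalPull.
Variable k : fieldType.

Lemma global_pull_eq (T Y : scheme k) (V : set Y) (aV : affine_open V) (h1 h2 : morphism T Y)
    (hV1 : forall t, V (h1 t)) (hV2 : forall t, V (h2 t)) :
  h1 = h2 -> global_pull aV hV1 =1 global_pull aV hV2.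
Proof. by move=> h12; case: _ / h12 in hV2 * => s; rewrite (Prop_irrelevance hV1 hV2). Qed.

Lemma global_pull_comp (T Y X : scheme k) (h1 : morphism T Y) (h2 : morphism Y X)
    (V : set Y) (W : set X) (aV : affine_open V) (aW : affine_open W)
    (hV : forall t, V (h1 t)) (hW : forall t, W (comp_morphism h2 h1 t))
    (u : opensub V (h2 @^-1` W)) s :
  global_pull aW hW s = global_pull aV hV (restr u (pull h2 (affine_is_open aW) s)).
Proof.
rewrite /global_pull /=.
have o := open_preimage h2 (affine_is_open aW).
rewrite (pull_restr u (affine_is_open aV) o (opensub_preimage h1 u)).
rewrite (restr_comp _ _ (preimage_full hW)).
by rewrite (Prop_irrelevance (open_preimage h2 _) o).
Qed.

Lemma global_pull_scal (T Y : scheme k) (V : set Y) (aV : affine_open V) (h : morphism T Y)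
    (hV : forall t, V (h t)) (o : opensub V setT) c :
  global_pull aV hV (restr o (scal Y c)) = scal T c.
Proof.
rewrite /global_pull /= (pull_restr o (affine_is_open aV) openT (opensub_preimage h o)).
rewrite (restr_comp _ _ (opensub_refl openT)) pull_scal; exact: restr_id.
Qed.

End GlobalPull.

Section SpecScheme.
Variables (k : fieldType) (A : comNzRingType) (Z : Type) (ev : Z -> {rmorphism A -> k}) (e : A).
Hypothesis ev_e : forall z, ev z e != 0.
Variable kappa : {rmorphism k -> A}.

Let cover (x : spec_lrs ev_e) : exists2 U, affine_open U & U x.
Proof. by exists setT => //; exact: spec_affine. Qed.

Definition spec_scheme : scheme k := Scheme cover (spec_global ev_e \o kappa).

Definition spec_fun : {rmorphism A -> sect (setT : set spec_scheme)} := spec_global ev_e.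

Lemma spec_scheme_affine : affine_open (setT : set spec_scheme).
Proof. exact: spec_affine. Qed.

Lemma spec_fun0 a : (forall z, ev z a = 0) -> spec_fun a = 0.
Proof. by move=> a0; apply: spec_sect_ext => z; exact: a0. Qed.

Lemma spec_fun_e : invertible (spec_fun e).
Proof. exact: spec_global_e_invertible. Qed.

Lemma spec_lift (B : comPzRingType) (psi : {rmorphism A -> B}) :
  (forall a, (forall z, ev z a = 0) -> psi a = 0) -> invertible (psi e) ->
  exists phi : {rmorphism sect (setT : set spec_scheme) -> B}, forall a, phi (spec_fun a) = psi a.
Proof.
move=> ker ie; apply: (localization_lift (e := e)) => //; first exact: spec_global_frac.
by move=> a /spec_global_eq0/ker.
Qed.

Lemma spec_ext (B : comPzRingType) (phi phi' : {rmorphism sect (setT : set spec_scheme) -> B}) :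
  (forall a, phi (spec_fun a) = phi' (spec_fun a)) -> phi =1 phi'.
Proof.
apply: (localization_ext (e := e)); first exact: spec_global_frac.
exact/invertible_rmorph/spec_fun_e.
Qed.

Lemma unit_at_spec_fun (p : spec_scheme) a : unit_at p (spec_fun a) <-> ~ in_pt p a.
Proof. exact: unit_at_spec_global. Qed.

End SpecScheme.

Section Lines.
Variable k : fieldType.

Definition line_eval m (S : set ('I_m -> k)) (z : {v | S v} *
  k) : {rmorphism {poly {mpoly k[m]}} -> k} :=
  horner_eval z.2 \o map_poly (meval (sval z.1)).

Definition line_const m : {rmorphism k -> {poly {mpoly k[m]}}} := @polyC {mpoly k[m]} \o @mpolyC
  m k.

Section Scheme.
Variables (m : nat) (S : set ('I_m -> k)) (a : {mpoly k[m]}).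
Hypothesis aS : forall v, S v -> a.@[v] != 0.

Lemma line_evalC (z : {v | S v} * k) p : line_eval z p%:P = p.@[sval z.1].
Proof. by rewrite /line_eval /= map_polyC /= horner_evalE hornerC. Qed.

Lemma line_eval_a (z : {v | S v} * k) : line_eval z a%:P != 0.
Proof. by rewrite line_evalC; apply: aS; case: z.1. Qed.

(* The product of the affine line with the open subset [a != 0] of the closure of [S]
   in affine space. *)
Definition line_scheme : scheme k := spec_scheme line_eval_a (@line_const m).

Definition line_fun : {rmorphism {poly {mpoly k[m]}} -> sect (setT : set line_scheme)} :=
  @spec_fun _ _ _ _ _ line_eval_a (@line_const m).

Lemma line_affine : affine_open (setT : set line_scheme).
Proof. exact: spec_scheme_affine. Qed.

Lemma line_fun0 P : (forall z, @line_eval m S z P = 0) -> line_fun P = 0.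
Proof. exact: (@spec_fun0 _ _ _ _ _ line_eval_a (@line_const m)). Qed.

Lemma line_fun_a : invertible (line_fun a%:P).
Proof. exact: (@spec_fun_e _ _ _ _ _ line_eval_a (@line_const m)). Qed.

Lemma line_scal c : scal line_scheme c = line_fun (line_const m c).
Proof. by []. Qed.

Lemma line_lift (B : comPzRingType) (psi : {rmorphism {poly {mpoly k[m]}} -> B}) :
  (forall P, (forall z, @line_eval m S z P = 0) -> psi P = 0) -> invertible (psi a%:P) ->
  exists phi : {rmorphism sect (setT : set line_scheme) -> B}, forall P, phi (line_fun P) = psi P.
Proof. exact: (@spec_lift _ _ _ _ _ line_eval_a (@line_const m)). Qed.

Lemma line_ext (B : comPzRingType) (phi phi' : {rmorphism sect (setT : set line_scheme) -> B}) :
  (forall P, phi (line_fun P) = phi' (line_fun P)) -> phi =1 phi'.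
Proof. exact: (@spec_ext _ _ _ _ _ line_eval_a (@line_const m)). Qed.

Lemma unit_at_line_fun (p : line_scheme) P : unit_at p (line_fun P) <-> ~ in_pt p P.
Proof. exact: (@unit_at_spec_fun _ _ _ _ _ line_eval_a (@line_const m)). Qed.

Lemma line_projection (Y : scheme k) (V : set Y) (aV : affine_open V)
    (theta : {rmorphism {mpoly k[m]} -> sect V}) :
  presentation theta -> (forall p, theta p = 0 -> forall v, S v -> p.@[v] = 0) ->
  exists (H : morphism line_scheme Y) (HV : forall t, V (H t)),
    forall p, global_pull aV HV (theta p) = line_fun p%:P.
Proof.
move=> [scalP surj] ker.
have [|||G GE] := @localization_lift _ _ _ theta (line_fun \o polyC) 1.
- by move=> s; have [p <-] := surj s; exists 0%N, p; rewrite mul1r.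
- move=> p p0 /=; apply: line_fun0 => z; rewrite line_evalC; apply: (ker _ p0); by case: z.1.
- by rewrite rmorph1; exact: invertible1.
have [|H [HV HE]] := affine_morphism_exists aV (phi := G).
  by move=> h c; rewrite -(scalP h) GE.
by exists H, HV => p; rewrite HE GE.
Qed.

End Scheme.

Lemma line_map n m (S : set ('I_m -> k)) (S' : set ('I_n -> k)) (a : {mpoly k[n]})
    (xt : n.-tuple {mpoly k[m]}) (aS : forall v, S v -> (a \mPo xt).@[v] != 0)
    (aS' : forall v, S' v -> a.@[v] != 0) :
  (forall v, S v -> S' (fun i => (tnth xt i).@[v])) ->
  exists (H : morphism (line_scheme aS) (line_scheme aS')) (HV : forall t,
    [set: line_scheme aS'] (H t)),
    forall P, global_pull (line_affine aS') HV (line_fun aS' P) =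
      line_fun aS (map_poly (comp_mpoly xt) P).
Proof.
move=> SS'.
have evE (z : {v | S v} * k) P : line_eval z (map_poly (comp_mpoly xt) P) =
    line_eval (exist S' (fun i => (tnth xt i).@[sval z.1]) (SS' _ (svalP z.1)), z.2) P.
  rewrite /line_eval /= !horner_evalE -map_poly_comp.
  by congr (_.[_]); apply: eq_map_poly => p; exact: comp_mpoly_meval.
have [||G GE] := @line_lift _ _ _ aS' _ (line_fun aS \o map_poly (comp_mpoly xt)).
- by move=> P P0; apply: line_fun0 => z; rewrite evE.
- by rewrite /= map_polyC; exact: line_fun_a.
have [|H [HV HE]] := affine_morphism_exists (line_affine aS') (phi := G).
  move=> h c; rewrite restr_id line_scal GE /=; congr (line_fun _ _).
  by rewrite map_polyC /= comp_mpolyC.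
by exists H, HV => P; rewrite HE GE.
Qed.

End Lines.

(** * Charts from universal homeomorphisms *)

Lemma horner_zero_poly (k : closedFieldType) (p : {poly k}) : (forall c, p.[c] = 0) -> p = 0.
Proof.
move=> p0; apply/eqP/negP => /negP pn0.
have [c] := closed_nonrootP p pn0.
by rewrite /root p0 eqxx.
Qed.

Section LocalBaseChange.
Variables (k : closedFieldType) (X Y : scheme k) (h : morphism Y X) (n : nat) (f a : {mpoly k[n]}).
Variables (aX : affine_open (setT : set X)) (phi : {rmorphism {mpoly k[n]} -> sect (setT : set X)}).
Hypotheses (phiP : presentation phi) (phi0 : forall p, phi p = 0 -> exists q, p = q * f).
Variables (c d : nat) (V : set Y) (aV : affine_open V) (theta : {rmorphism {mpoly k[(c +
  d)%N]} -> sect V}).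
Variables (g : 'I_c -> {mpoly k[(c + d)%N]}) (xt : n.-tuple {mpoly k[(c + d)%N]}).
Hypotheses (thetaP : presentation theta)
  (theta0 : forall p, theta p = 0 <-> exists b : 'I_c -> {mpoly k[(c + d)%N]},
    p = \sum_j b j * g j).
Hypothesis radical : forall p, (forall z, on_zeros g z -> p.@[z] = 0) ->
  exists b : 'I_c -> {mpoly k[(c + d)%N]}, p = \sum_j b j * g j.
Hypothesis zero : forall z, on_zeros g z -> f.@[chart_map xt z] = 0.
Hypothesis theta_xt : forall (o : open (setT : set X)) (u : opensub V (h @^-1` setT)) p,
  theta (p \mPo xt) = restr u (pull h o (phi p)).
Hypothesis preimage_in_V : forall y, unit_at (h y) (phi a) -> V y.

Let SX : set ('I_n -> k) := [set x | f.@[x] = 0 /\ a.@[x] != 0].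
Let SY : set ('I_(c + d) -> k) := on_chart a g xt.
Let aSX v : SX v -> a.@[v] != 0. Proof. by case. Qed.
Let aSY v : SY v -> (a \mPo xt).@[v] != 0.
Proof. by rewrite comp_mpoly_meval; case. Qed.
Let SYX v : SY v -> SX (fun i => (tnth xt i).@[v]).
Proof. by move=> [zv av]; split=> //; exact: zero. Qed.

Let vanish_SX p : phi p = 0 -> forall v, SX v -> p.@[v] = 0.
Proof. by move=> /phi0[q ->] v [fv _]; rewrite mevalM fv mulr0. Qed.
Let vanish_SY p : theta p = 0 -> forall v, SY v -> p.@[v] = 0.
Proof.
move=> /theta0[b ->] v [gv _]; rewrite (raddf_sum (meval v)) big1 // => j _.
by rewrite /= mevalM gv mulr0.
Qed.

Let X' := line_scheme aSX.
Let Y' := line_scheme aSY.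

Let oT : open (setT : set X) := affine_is_open aX.
Let u : opensub V (h @^-1` setT).
Proof. by split=> //; [exact: affine_is_open aV | exact: openT]. Qed.

(** The base change goes to the affine line over the open subset [a != 0] of [X]. Since the preimage
    of this subset lies in [V], a compatible morphism to [Y] lands in [V]; all targets are then
    affine, and the universal property becomes one of rings. *)
Lemma local_base_change : exists (g0 : morphism X' X) (f' : morphism Y' X') (g' : morphism Y' Y),
  is_fibre_product g0 h f' g' /\
  (forall q P, in_pt (f' q) P <-> in_pt q (map_poly (comp_mpoly xt) P)).
Proof.
have [g0 [g0T g0E]] := line_projection aSX aX phiP vanish_SX.
have [f' [f'T f'E]] := line_map aSY aSX SYX.
have [g' [g'V g'E]] := line_projection aSY aV thetaP vanish_SY.
have thetaX p : theta (p \mPo xt) = restr u (pull h oT (phi p)) := theta_xt oT u p.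
exists g0, f', g'; split; last first.
  move=> q P; rewrite -[in_pt (f' q) P]notK -[X in _ <-> X]notK.
  apply: not_iff_compat; rewrite -(unit_at_line_fun (f' q)) -(unit_at_line_fun q) -f'E.
  by rewrite unit_at_global_pull.
have phi_surj s : exists p, phi p = s := phiP.2 s.
have theta_surj s : exists p, theta p = s := thetaP.2 s.
split.
  have c1T t : [set: X] (comp_morphism g0 f' t) by [].
  have c2T t : [set: X] (comp_morphism h g' t) by [].
  refine (affine_morphism_ext (aV := aX) (hV1 := c1T) (hV2 := c2T) _) => s.
  have [p <-] := phi_surj s.
  have uT : opensub [set: X'] (g0 @^-1` setT) := preimage_full g0T.
  rewrite (global_pull_comp (line_affine aSX) aX f'T c1T uT).
  rewrite (global_pull_comp aV aX g'V c2T u) -thetaX g'E.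
  rewrite (restr_irr uT (preimage_full g0T)) -[restr _ _]/(global_pull aX g0T (phi p)) g0E f'E.
  by rewrite map_polyC.
move=> T al be comm.
have beV t : V (be t).
  apply: preimage_in_V.
  have -> : h (be t) = g0 (al t) by rewrite -[LHS]/(comp_morphism h be t) -comm.
  rewrite -(unit_at_global_pull aX g0T) g0E.
  by apply: invertible_unit_at => //; [exact: openT | exact: line_fun_a].
pose chi0 := global_pull aV beV; pose alT t : [set: X'] (al t) := I.
pose tau := global_pull (line_affine aSX) alT (line_fun aSX 'X).
have chi0_xt p : chi0 (theta (p \mPo xt)) = global_pull (line_affine aSX) alT (line_fun aSX p%:P).
  have c1T t : [set: X] (comp_morphism h be t) by [].
  have c2T t : [set: X] (comp_morphism g0 al t) by [].
  rewrite thetaX /chi0 -(global_pull_comp aV aX beV c1T u) -g0E.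
  rewrite -(global_pull_comp (line_affine aSX) aX alT c2T (preimage_full g0T)).
  exact: global_pull_eq.
(* Coefficients are pulled back through [Y], the coordinate of the line through [X']. *)
have [psi [psiC' psiX]] := poly_lift (chi0 \o theta) tau.
have psiC p : psi p%:P = chi0 (theta p) := psiC' p.
have ia : invertible (psi (a \mPo xt)%:P).
  by rewrite psiC chi0_xt; apply: invertible_rmorph; exact: line_fun_a.
(* A polynomial vanishing on the whole line over each point of the chart has coefficients vanishing
   on the chart. Multiplied by [a], these lie in the ideal of the [g j], and [a] becomes invertible
   on [T]. *)
have ker P : (forall z, @line_eval k _ SY z P = 0) -> psi P = 0.
  move=> P0; have coef0 i : chi0 (theta P`_i) = 0.
    have : theta (P`_i * (a \mPo xt)) = 0.
      apply/theta0/radical => z zz; rewrite mevalM comp_mpoly_meval.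
      have [->|az] := eqVneq a.@[fun i => (tnth xt i).@[z]] 0; first by rewrite mulr0.
      have : map_poly (meval z) P = 0.
        apply: horner_zero_poly => y.
        exact: (P0 (exist SY z (conj zz az), y)).
      by move=> /(congr1 (fun p : {poly k} => p`_i)); rewrite coef_map coef0 /= => ->;
        rewrite mul0r.
    move=> /(congr1 chi0); rewrite rmorphM rmorph0 rmorphM => E.
    move: ia; rewrite psiC => ia; apply: (invertible_inj ia).
    by rewrite mulr0 mulrC.
  rewrite -[P]coefK poly_def rmorph_sum big1 //= => i _.
  by rewrite -mul_polyC rmorphM psiC coef0 mul0r.
have [chi chiE] := line_lift aSY ker ia.
have [|w [wT wE]] := affine_morphism_exists (line_affine aSY) (phi := chi).
  move=> o y; rewrite restr_id line_scal chiE psiC.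
  rewrite (thetaP.1 (opensubT (affine_is_open aV))); exact: global_pull_scal.
have wfun (w1 : morphism T Y') (w1T : forall t, [set: Y'] (w1 t)) p :
    comp_morphism g' w1 = be -> global_pull (line_affine aSY) w1T (line_fun aSY p%:P) =
      chi0 (theta p).
  move=> E; have w1V t : V (comp_morphism g' w1 t) by exact: g'V.
  rewrite -(global_pull_eq aV w1V beV E) -g'E.
  by rewrite -(global_pull_comp (line_affine aSY) aV w1T w1V (preimage_full g'V)).
exists w; split; first split.
- have c1T t : [set: X'] (comp_morphism f' w t) by [].
  refine (affine_morphism_ext (aV := line_affine aSX) (hV1 := c1T) (hV2 := alT) _) => s.
  rewrite (global_pull_comp (line_affine aSY) (line_affine aSX) wT c1T (preimage_full f'T)).
  rewrite -[restr _ _]/(global_pull (line_affine aSX) f'T s).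
  apply: (line_ext (phi := global_pull (line_affine aSY) wT \o global_pull (line_affine aSX)
    f'T)) => P.
  rewrite -[LHS]/(global_pull _ wT (global_pull _ f'T (line_fun aSX P))) f'E wE chiE; move: P.
  apply: (poly_rmorph_ext (phi := psi \o map_poly (comp_mpoly xt))
    (phi' := global_pull (line_affine aSX) alT \o line_fun aSX)) => [p|].
    rewrite -[LHS]/(psi (map_poly (comp_mpoly xt) p%:P)) map_polyC psiC; exact: chi0_xt.
  by rewrite -[LHS]/(psi (map_poly (comp_mpoly xt) 'X)) map_polyX psiX.
- have c1V t : V (comp_morphism g' w t) by exact: g'V.
  refine (affine_morphism_ext (aV := aV) (hV1 := c1V) (hV2 := beV) _) => s.
  have [p <-] := theta_surj s.
  rewrite (global_pull_comp (line_affine aSY) aV wT c1V (preimage_full g'V)).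
  by rewrite -[restr _ _]/(global_pull aV g'V (theta p)) g'E wE chiE psiC.
- move=> w' [w'al w'be]; pose w'T t : [set: Y'] (w' t) := I.
  refine (affine_morphism_ext (aV := line_affine aSY) (hV1 := wT) (hV2 := w'T) _).
  apply: line_ext => P; rewrite wE chiE; move: P.
  apply: (poly_rmorph_ext (phi := psi) (phi' := global_pull (line_affine aSY) w'T \o line_fun
    aSY)) => [p|].
    by rewrite psiC; exact/esym/wfun.
  have c1T t : [set: X'] (comp_morphism f' w' t) by [].
  rewrite psiX -[RHS]/(global_pull (line_affine aSY) w'T (line_fun aSY 'X)) /tau -(global_pull_eq
    (line_affine aSX) c1T alT w'al).
  rewrite (global_pull_comp (line_affine aSY) (line_affine aSX) w'T c1T (preimage_full f'T)).
  by rewrite -[restr _ _]/(global_pull (line_affine aSX) f'T _) f'E map_polyX.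
Qed.

End LocalBaseChange.

(* The image of the closed set [s * 'X = 1] is closed and misses [x = 0]; its equation
   evaluated at [x = 1 / s] is an integral dependence relation for [s]. *)
Lemma line_map_integral (k : fieldType) n m (S : set ('I_m -> k)) (S' : set ('I_n ->
  k)) (a : {mpoly k[n]})
    (xt : n.-tuple {mpoly k[m]}) (aS : forall v, S v -> (a \mPo xt).@[v] != 0)
    (aS' : forall v, S' v -> a.@[v] != 0) (f' : morphism (line_scheme aS) (line_scheme aS')) :
  (forall v, S v -> S' (fun i => (tnth xt i).@[v])) ->
  (forall q P, in_pt (f' q) P <-> in_pt q (map_poly (comp_mpoly xt) P)) -> homeomorphism f' ->
  forall s : {mpoly k[m]}, exists N r (al : 'I_r -> {mpoly k[n]}), forall v, S v ->
    a.@[fun i => (tnth xt i).@[v]] ^+ N * s.@[v] ^+ r =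
    \sum_(j < r) (al j).@[fun i => (tnth xt i).@[v]] * s.@[v] ^+ j.
Proof.
move=> SS' f'P [inv [f'K invK _ inv_c]] s.
pose u : {poly {mpoly k[m]}} := s%:P * 'X - 1.
pose O : set (line_scheme aS') := inv @^-1` principal_open u.
have oO : open O by apply: open_comp => [x _|]; [exact: inv_c | exact: principal_open_open].
pose xv v i := (tnth xt i).@[v].
(* [I0] consists of the equations of the image of [s * 'X = 1], tested at [k]-points; [J] adds the
   equation ['X = 0]. *)
pose I0 := [set P : {poly {mpoly k[n]}} | forall v c, S v -> s.@[v] * c = 1 ->
  (map_poly (meval (xv v)) P).[c] = 0].
pose J := [set P | exists Q H, I0 Q /\ P = Q + H * 'X].
have idJ : is_ideal J.
  split.
  - by exists 0, 0; split=> [v c _ _|]; rewrite ?rmorph0 ?horner0 // mul0r addr0.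
  - move=> _ _ [Q [H [Q0 ->]]] [Q' [H' [Q0' ->]]]; exists (Q + Q'), (H + H').
    split=> [v c Sv sc|]; last by rewrite mulrDl addrACA.
    by rewrite rmorphD hornerD Q0 ?Q0' ?addr0.
  - move=> P _ [Q [H [Q0 ->]]]; exists (P * Q), (P * H); split=> [v c Sv sc|].
      by rewrite rmorphM hornerM Q0 ?mulr0.
    by rewrite mulrDr mulrA.
have J0 Q : I0 Q -> J Q by move=> Q0; exists Q, 0; rewrite mul0r addr0.
have [N [Q [H [Q0 aE]]]] : exists N, J (a%:P ^+ N).
  apply: contrapT => /forallNP /(prime_avoiding idJ)[P [primeP JP nPa _]].
  have vP Q : (forall z, @line_eval k n S' z Q = 0) -> P Q.
    move=> Q0; apply/JP/J0 => v c Sv _; exact: (Q0 (exist S' _ (SS' v Sv), c)).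
  pose p : line_scheme aS' := exist _ P (And3 primeP vP nPa).
  have pX : in_pt p 'X.
    apply: JP; exists 0, 1; rewrite mul1r add0r; split=> // v c _ _.
    by rewrite rmorph0 horner0.
  (* [O] is the complement of the image of [s * 'X = 1]. If [p] is in [O], a function nonzero at [p]
     and vanishing off [O] belongs to [I0], hence to [P]. Otherwise the preimage of [p] contains
     both [s * 'X - 1] and ['X]. *)
  have [Op|nOp] := pselect (O p).
    have /spec_openE/(_ p Op)[G [pG GO]] := oO.
    have nG : ~ I0 G by move=> /J0/JP.
    apply: nG => v c Sv sc; apply: contrapT => Gc.
    pose q : line_scheme aS := closed_pt (line_eval_a aS) (exist S v Sv, c).
    have Oq : O (f' q).
      apply: GO => /f'P; rewrite -[in_pt _ _]/((map_poly (meval v) (map_poly (comp_mpoly xt)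
        G)).[c] = 0).
      rewrite -map_poly_comp (eq_map_poly (g := meval (xv v))) // => r; exact: comp_mpoly_meval.
    move: Oq; rewrite /O /preimage /= f'K; apply.
    rewrite -[in_pt _ _]/((map_poly (meval v) u).[c] = 0).
    by rewrite rmorphB rmorphM rmorph1 /= map_polyC map_polyX !hornerE sc subrr.
  have qu : in_pt (inv p) u by apply: contrapT.
  have qX : in_pt (inv p) 'X.
    by have := f'P (inv p) 'X; rewrite invK map_polyX => <-.
  have idq := prime_is_ideal (pt_prime (inv p)).
  apply: (@pt_one _ _ _ _ _ (inv p)); rewrite -[1](subKr (s%:P * 'X)); apply: (idealB idq) => //.
  exact: (ideal_mull idq).
(* From [a ^+ N = Q + H * 'X] at [1 / s], multiplied by [s ^+ (size H).+1]; the coefficients of [H]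
   appear in reverse order. The constant coefficient is zero, so the equation also holds where [s]
   vanishes. *)
exists N, (size H).+1, (fun j => H`_(size H - j)) => v Sv.
rewrite big_ord_recl /= subn0 nth_default // meval0 mul0r add0r.
have [->|sv] := eqVneq s.@[v] 0.
  by rewrite expr0n mulr0 big1 // => j _; rewrite expr0n mulr0.
pose y := s.@[v]^-1; have sy : s.@[v] * y = 1 by rewrite mulfV.
have := congr1 (fun P => (map_poly (meval (xv v)) P).[y]) aE.
rewrite rmorphD rmorphM rmorphXn /= map_polyX map_polyC !hornerE (Q0 v y Sv sy) add0r => ->.
rewrite (horner_coef_wide _ (size_poly _ _)) !mulr_suml (reindex_inj rev_ord_inj).
apply: eq_bigr => j _ /=; rewrite coef_map -!mulrA; congr (_ * _).
have -> : (size H).+1 = ((size H - j.+1).+1 + j.+1)%N by rewrite addSn subnK.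
by rewrite mulrA -exprSr exprD mulrA -exprMn [y * _]mulrC sy expr1n mul1r /bump leq0n.
Qed.

(** The images of the polynomials vanishing at [v] form a prime ideal of [sect V], hence define a
    point of the affine open set. *)
Lemma point_of_zero (k : fieldType) (X : scheme k) (V : set X) (aV : affine_open V) m
    (theta : {rmorphism {mpoly k[m]} -> sect V}) (v : 'I_m -> k) :
  presentation theta -> (forall p, theta p = 0 -> p.@[v] = 0) ->
  exists y, V y /\ forall p, unit_at y (theta p) <-> p.@[v] != 0.
Proof.
move=> [_ surj] ker.
have kerE p q : theta p = theta q -> p.@[v] = q.@[v].
  move=> E; have /ker : theta (p - q) = 0 by rewrite rmorphB E subrr.
  by rewrite mevalB => /eqP; rewrite subr_eq0 => /eqP.
have [|y Vy yP] := affine_surj aV (P := [set s | exists p, theta p = s /\ p.@[v] = 0]).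
  split=> /=.
  - by exists 0; rewrite rmorph0 meval0.
  - by move=> _ _ [p [<- pv]] [q [<- qv]]; exists (p + q); rewrite rmorphD mevalD pv qv addr0.
  - move=> s _ [q [<- qv]]; have [p <-] := surj s.
    by exists (p * q); rewrite rmorphM mevalM qv mulr0.
  - by move=> [p []]; rewrite -(rmorph1 theta) => /kerE -> /eqP; rewrite meval1 oner_eq0.
  - move=> s t [r [rE rv]]; have [p pE] := surj s; have [q qE] := surj t.
    have : (p * q).@[v] = 0 by rewrite -rv; apply: kerE; rewrite rmorphM pE qE.
    by rewrite mevalM => /eqP; rewrite mulf_eq0 => /orP[] /eqP; [left; exists p | right; exists q].
exists y; split=> // p; rewrite -[X in X <-> _]notK -yP; split.
  by move=> np; apply/eqP => pv; apply: np; exists p.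
by move=> /eqP pv [q [/kerE E qv]]; apply: pv; rewrite -E.
Qed.

Section ChartOfPoint.
Variables (k : closedFieldType) (X Y : scheme k) (h : morphism Y X) (n : nat) (f : {mpoly k[n]}).
Hypotheses (ncountable : ~ countable [set: k]) (redY : reduced Y) (smoothY : smooth Y)
  (uh : universal_homeomorphism h).
Variables (aX : affine_open (setT : set X)) (phi : {rmorphism {mpoly k[n]} -> sect (setT : set X)}).
Hypotheses (phiP : presentation phi) (phi0 : forall p, phi p = 0 <-> exists q, p = q * f).

Let phif : phi f = 0. Proof. by apply/phi0; exists 1; rewrite mul1r. Qed.

(** The chart is a standard smooth neighbourhood [V] of the preimage of [xi], and [xt] lifts the
    coordinates of [X] to polynomials on [V]. *)
Lemma chart_of_point xi : f.@[xi] = 0 ->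
  exists a c d (g : 'I_c -> {mpoly k[(c + d)%N]}) (xt : n.-tuple {mpoly k[(c + d)%N]}),
    chart f a g xt /\ a.@[xi] != 0.
Proof.
move=> fxi.
have phi_vanish v p : f.@[v] = 0 -> phi p = 0 -> p.@[v] = 0.
  by move=> fv /phi0[q ->]; rewrite mevalM fv mulr0.
have [inv [hK invK h_c inv_c]] := universal_homeomorphism_homeo uh.
have [x [_ xP]] := point_of_zero aX phiP (fun p => phi_vanish xi p fxi).
have [V [aV Vy [c [d [theta [g [thetaP theta0 jac]]]]]]] := smoothY (inv x).
have oV := affine_is_open aV; have oT := affine_is_open aX.
have oW : open (inv @^-1` V) by apply: open_comp => // z _; exact: inv_c.
(* The image of [V] is open, [h] being a homeomorphism, so a principal neighbourhood [a != 0] of [x]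
   has its full preimage in [V]. *)
have [sa [xa aW]] := affine_basis aX (opensubT oW) Vy.
have [a aE] := phiP.2 sa; rewrite -{}aE in xa aW; move/xP: xa => axi.
have preimage_in_V y : unit_at (h y) (phi a) -> V y by move=> /aW; rewrite /preimage /= hK.
have u : opensub V (h @^-1` setT) by split=> //; exact: open_preimage.
pose rho p := restr u (pull h oT (phi p)).
have rhoE p y : V y -> unit_at y (rho p) <-> unit_at (h y) (phi p).
  by move=> Vy'; rewrite -(unit_at_pull h oT); exact: unit_at_restr.
have /choice[xs xsE] (i : 'I_n) : exists p, theta p = rho 'X_i by exact: thetaP.2.
pose xt : n.-tuple {mpoly k[(c + d)%N]} := [tuple xs i | i < n].
have theta_xt p : theta (p \mPo xt) = rho p.
  rewrite /rho; elim/mpoly_ind_ring: p => [b|i|p q IHp IHq|p q IHp IHq].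
  - rewrite comp_mpolyC (thetaP.1 (opensubT oV)) (phiP.1 (opensubT oT)) restr_id pull_scal.
    exact: restr_irr.
  - by rewrite comp_mpolyXU -tnth_nth tnth_mktuple xsE.
  - by rewrite (rmorphD (comp_mpoly xt)) !rmorphD IHp IHq.
  - by rewrite (rmorphM (comp_mpoly xt)) !rmorphM IHp IHq.
have theta_xt_irr (o : open (setT : set X)) (u' : opensub V (h @^-1` setT)) p :
    theta (p \mPo xt) = restr u' (pull h o (phi p)).
  by rewrite theta_xt /rho (Prop_irrelevance oT o) (Prop_irrelevance u u').
have theta_zero p z : on_zeros g z -> theta p = 0 -> p.@[z] = 0.
  move=> gz /theta0[b ->]; rewrite (raddf_sum (meval z)) big1 // => j _.
  by rewrite /= mevalM gz mulr0.
have theta_g j : theta (g j) = 0.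
  apply/theta0; exists (fun i => (i == j)%:R); rewrite (bigD1 j) //= eqxx mul1r big1 ?addr0 // =>
    i ij.
  by rewrite (negbTE ij) mul0r.
have radical p : (forall z, on_zeros g z -> p.@[z] = 0) ->
    exists b : 'I_c -> {mpoly k[(c + d)%N]}, p = \sum_j b j * g j.
  move=> pz; apply/theta0.
  have idI : is_ideal [set q | theta q = 0].
    split=> /=; first exact: rmorph0.
    + by move=> q r q0 r0; rewrite rmorphD q0 r0 addr0.
    + by move=> q r r0; rewrite rmorphM r0 mulr0.
  (* A power of [p] vanishes on [V], and [Y] is reduced. *)
  have [z zI|m] := nullstellensatz ncountable (h := p) idI.
    by apply: pz => j; apply: zI; exact: theta_g.
  by rewrite /= rmorphXn => /redY; exact.
have zero z : on_zeros g z -> f.@[chart_map xt z] = 0.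
  move=> gz; rewrite /chart_map -comp_mpoly_meval; apply: theta_zero => //.
  by rewrite theta_xt /rho phif !rmorph0.
have pointY z : on_zeros g z -> exists y, V y /\ forall p, unit_at y (theta p) <-> p.@[z] != 0.
  by move=> gz; apply: point_of_zero => // p; exact: theta_zero.
exists a, c, d, g, xt; split=> //; split=> //.
- move=> z gz; have [b] := jac; have [p <-] := thetaP.2 b.
  move=> E; have /(theta_zero _ _ gz) : theta (\det (\matrix_(i < c,
    j < c) mderiv (lshift d i) (g j)) * p - 1) = 0.
    by rewrite rmorphB rmorphM rmorph1 E subrr.
  rewrite mevalB mevalM meval1 => /eqP; rewrite subr_eq0; apply: contraTneq => ->.
  by rewrite mul0r eq_sym oner_eq0.
- move=> z z' [gz az] [gz' az'] zz'.
  have [y [Vy1 yP]] := pointY z gz; have [y' [Vy2 yP']] := pointY z' gz'.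
  (* The images under [h] have the same units, hence coincide, and [h] is injective. *)
  have yy' : y = y'.
    apply: (can_inj hK); apply: (affine_inj aX) => // s; have [p <-] := phiP.2 s.
    rewrite -(rhoE p y) // -(rhoE p y') // -theta_xt yP yP' !comp_mpoly_meval.
    by rewrite -!/(chart_map _ _) zz'.
  apply/funext => i; apply/esym/eqP; rewrite -subr_eq0 -[X in _ - X](mevalC z').
  rewrite -(mevalXU z') -mevalB; apply/negP => /negP/yP'; rewrite -yy' => /yP.
  by rewrite mevalB mevalXU mevalC subrr eqxx.
- move=> v fv av.
  have [w [_ wP]] := point_of_zero aX phiP (fun p => phi_vanish v p fv).
  have Vw : V (inv w) by apply: preimage_in_V; rewrite invK; apply/wP.
  have wE p : unit_at (inv w) (theta (p \mPo xt)) <-> p.@[v] != 0.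
    by rewrite theta_xt rhoE // invK.
  pose I := [set p | ~ unit_at (inv w) (theta p)].
  have primeI : prime_ideal I.
    have [I0 ID IM I1 IP] := stalk_prime oV Vw.
    split; rewrite /I /=.
    + by rewrite rmorph0.
    + by move=> p q; rewrite rmorphD; exact: ID.
    + by move=> p q; rewrite rmorphM; exact: IM.
    + by rewrite rmorph1.
    + by move=> p q; rewrite rmorphM; exact: IP.
  (* The preimage of the point [v] is only known as a point of the scheme; a zero [z] of its ideal
     has coordinates in [k], and it maps to [v] because the pullbacks of the [X_i - v_i] lie in that
     ideal. *)
  have [z [Iz az]] : exists z, (forall p, I p -> p.@[z] = 0) /\ (a \mPo xt).@[z] != 0.
    apply: contrapT => /forallNP nz.
    have [z zI|m] := nullstellensatz ncountable (h := a \mPo xt) (prime_is_ideal primeI).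
      by apply/eqP/negP => /negP az; exact: (nz z).
    by move=> /(prime_expr primeI); apply; apply/wE.
  exists z; first split.
  + by move=> j; apply: Iz; rewrite /I /= theta_g; exact: nunit_at0.
  + by rewrite /chart_map -comp_mpoly_meval.
  apply/funext => i; apply/eqP; rewrite -subr_eq0 -[X in _ - X](mevalC z).
  rewrite -mevalB; apply/eqP/Iz; rewrite /I /=.
  have -> : tnth xt i - (v i)%:MP = ('X_i - (v i)%:MP) \mPo xt.
    by rewrite (rmorphB (comp_mpoly xt)) /= comp_mpolyC comp_mpolyXU -tnth_nth.
  by rewrite wE mevalB mevalXU mevalC subrr eqxx.
(* Integrality is the one condition that requires a proper base change: [uh] is applied over the
   affine line. *)
- have [g0 [f' [g' [fibre f'P]]]] := local_base_change aX phiP (fun p =>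
    (phi0 p).1) aV thetaP theta0
    radical zero theta_xt_irr preimage_in_V.
  have SYX z : on_chart a g xt z -> f.@[chart_map xt z] = 0 /\ a.@[chart_map xt z] != 0.
    by move=> [gz az]; split=> //; exact: zero.
  refine (line_map_integral SYX f'P (uh fibre)).
Qed.

End ChartOfPoint.

(** Given an injection [e] into the natural numbers, each set of reals avoiding a value of [e] omits
    at most one point, so it is open and dense; the intersection of these sets is empty, against
    Baire's theorem. *)
Lemma complex_uncountable (R : realType) : ~ countable [set: complex R].
Proof.
move=> /countable_injP[e /in2TT e_inj].
pose F i : set R^o := ~` [set x : R | e x%:C%C = i].
have odF i : open (F i) /\ dense (F i).
  have [[r ri]|nr] := pselect (exists r : R, e r%:C%C = i).
    have -> : F i = ~` [set r].
      apply/seteqP; split=> x; apply: contra_not; first by move=> ->.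
      by rewrite /= -ri => /e_inj[].
    split; last exact: pseudometric_normed_Zmodule.dense_set1C.
    by rewrite openC; exact: num_normedtype.closed_eq.
  have -> : F i = setT by apply/seteqP; split=> // x _ xi; apply: nr; exists x.
  by split; [exact: openT | move=> O O0 _; rewrite setIT].
have := sequences.Baire odF; rewrite (_ : \bigcap_i F i = set0); first exact: dense0.
by apply/seteqP; split=> // x /(_ (e x%:C%C) I); exact.
Qed.

Theorem corollary1p3 (R : realType) (n : nat) (f : {mpoly (complex R)[n]})
    (X : scheme (complex R)) :
  is_hypersurface f X ->
  smooth X \/ cuspidal X ->
  weyl_algebra (complex R) n =
  [set (fun g : {mpoly (complex R)[n]} => P (f * g) + f * Q g)
  | P in weyl_algebra (complex R) n & Q in weyl_algebra (complex R) n].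
Proof.
move=> [f1 [redX _ _] aX [phi [phiP phi0]]] smooth_or_cuspidal.
(* From here on both cases are the same: a smooth reduced [Y] with a universal homeomorphism to
   [X]. *)
have [Y [h [redY smoothY uh]]] : exists (Y : scheme R[i]) (h : morphism Y X),
    [/\ reduced Y, smooth Y & universal_homeomorphism h].
  case: smooth_or_cuspidal => [smoothX|[_ _ [Y [h [[redY _ _] smoothY uh]]]]].
    by exists X, (id_morphism X); split=> //; exact: id_universal_homeomorphism.
  by exists Y, h.
have ncountable := @complex_uncountable R.
have char0 : [pchar R[i]] =i pred0 by exact: pchar_num.
apply: weyl_decomposition => //; apply: hypersurface_top_vanishing => //.
  by apply: contraTneq f1 => ->; rewrite msize0.
move=> xi fxi; exact: (chart_of_point ncountable redY smoothY uh aX phiP phi0 fxi).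
Qed.
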